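(* Let $F:\mathbb{R}^3\to\mathbb{R}^3$ be the map $F(x,y,z)=(x,y,|z|)$. Let $K_1$ and $K_2$ be elements of $\mathcal{K}$, the set of all oriented tame knot types in $\mathbb{R}^3$. Then there is an element $k_1$ of $K_1$ such that $F$ maps $k_1$ homeomorphically onto an element $F(k_1)$ of $K_2$.
   Context: A knot in $\mathbb{R}^3$ is a subset of $\mathbb{R}^3$ homeomorphic to a circle; an oriented knot is a knot with a chosen orientation. $\mathcal{K}$ denotes the set of all oriented tame knot types in $\mathbb{R}^3$, where an oriented knot type $K$ is an ambient isotopy class of oriented knots in $\mathbb{R}^3$ and it is tame if it contains a smooth or polygonal knot (polygonal: a union of finitely many straight line segments). Thus an element $k$ of $K\in\mathcal{K}$ is an oriented knot in $\mathbb{R}^3$. Oriented knots are smooth or polygonal unless otherwise stated. If a continuous map $f:\mathbb{R}^3\to\mathbb{R}^3$ is injective on an oriented knot $k$, then $f(k)$ is regarded as an oriented knot with the orientation carried over from $k$ by $f$. *)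

(* Defs.v *)
From mathcomp Require Import all_boot all_order all_algebra.
From mathcomp Require Import all_classical all_reals all_analysis.

Set Implicit Arguments.
Unset Strict Implicit.
Unset Printing Implicit Defensive.

Import Order.TTheory GRing.Theory Num.Theory.
Import numFieldNormedType.Exports.

Local Open Scope classical_set_scope.
Local Open Scope ring_scope.

Notation R3 R := (R * R * R)%type.

Definition homeomorphism_on (S T : topologicalType) (A : set S) (B : set T)
    (f : S -> T) : Prop :=
  [/\ set_bij A B f, {within A, continuous f}
    & exists2 g : T -> S, {within B, continuous g}
                        & {in A, cancel f g}].

Definition unit_circle (R : realType) : set (R * R) :=
  [set v | v.1 ^+ 2 + v.2 ^+ 2 = 1].
Arguments unit_circle : clear implicits.

Definition circle_exp (R : realType) (t : R) : R * R := (cos t, sin t).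

Definition is_knot (R : realType) (A : set (R3 R)) : Prop :=
  exists h : R * R -> R3 R, homeomorphism_on (unit_circle R) A h.

(* A homeomorphism from the circle onto A is encoded by its composite with
   t |-> (cos t, sin t), which is 2 pi-periodic on the whole line; two such
   homeomorphisms agree on the circle iff these composites are equal. *)
Definition knot_param (R : realType) (A : set (R3 R)) (p : R -> R3 R) : Prop :=
  exists2 h : R * R -> R3 R, homeomorphism_on (unit_circle R) A h
                           & p = h \o @circle_exp R.

(* Lifts to the line of the orientation-preserving self-homeomorphisms of the
   circle. *)
Definition positive_reparam (R : realType) (phi : R -> R) : Prop :=
  [/\ continuous phi, {homo phi : s t / s < t}
    & forall t, phi (t + 2 * pi) = phi t + 2 * pi].

(* An orientation is recorded as a class of parametrizations modulo
   orientation-preserving reparametrization; a knot has exactly two. *)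
Definition is_orientation (R : realType) (A : set (R3 R))
    (O : set (R -> R3 R)) : Prop :=
  exists2 p, knot_param A p
           & O = [set p \o phi | phi in @positive_reparam R].

(* Raw data; it is an oriented knot when [is_oriented_knot] holds. *)
Record oriented_set (R : realType) := OrientedSet {
  carrier : set (R3 R);
  orientation : set (R -> R3 R)
}.

Definition is_oriented_knot (R : realType) (k : oriented_set R) : Prop :=
  is_knot (carrier k) /\ is_orientation (carrier k) (orientation k).

(* f(k), with the orientation carried over from k by f; only meaningful when
   f is continuous and injective on the carrier of k. *)
Definition oriented_image (R : realType) (f : R3 R -> R3 R)
    (k : oriented_set R) : oriented_set R :=
  OrientedSet (f @` carrier k) [set f \o p | p in orientation k].

Definition ambient_isotopy (R : realType) (H : R -> R3 R -> R3 R) : Prop :=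
  [/\ {within `[0, 1]%classic `*` [set: R3 R],
         continuous (fun tx : R * R3 R => H tx.1 tx.2)},
      forall t, 0 <= t <= 1 -> homeomorphism_on [set: R3 R] [set: R3 R] (H t)
    & H 0 = id].

Definition ambient_isotopic (R : realType) (k k' : oriented_set R) : Prop :=
  exists2 H : R -> R3 R -> R3 R, ambient_isotopy H
                               & oriented_image (H 1) k = k'.

(* C^infinity regular parametrization by the circle. *)
Definition is_smooth (R : realType) (A : set (R3 R)) : Prop :=
  exists p : R -> R3 R,
    [/\ knot_param A p,
        forall (n : nat) (t : R), derivable (derive1n n p) t 1
      & forall t : R, derive1 p t != 0].

Definition line_segment (R : realType) (a b : R3 R) : set (R3 R) :=
  [set (1 - t) *: a + t *: b | t in `[0, 1]%classic].

Definition is_polygonal (R : realType) (A : set (R3 R)) : Prop :=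
  exists s : seq (R3 R * R3 R),
    A = \bigcup_(ab in [set` s]) line_segment ab.1 ab.2.

Definition smooth_or_polygonal (R : realType) (k : oriented_set R) : Prop :=
  is_smooth (carrier k) \/ is_polygonal (carrier k).

(* The class is taken among all oriented knots, so that tameness is a genuine
   condition on it. *)
Definition oriented_knot_type (R : realType) (K : set (oriented_set R)) :
    Prop :=
  exists2 k0, is_oriented_knot k0
            & K = [set k | is_oriented_knot k /\ ambient_isotopic k0 k].

Definition tame_knot_types (R : realType) : set (set (oriented_set R)) :=
  [set K | oriented_knot_type K /\ exists2 k, K k & smooth_or_polygonal k].
Arguments tame_knot_types : clear implicits.

(* By convention, the oriented knots considered as elements of a tame knot
   type are smooth or polygonal. *)
Definition knot_of_type (R : realType) (K : set (oriented_set R))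
    (k : oriented_set R) : Prop :=
  K k /\ smooth_or_polygonal k.

Definition fold (R : realType) (v : R3 R) : R3 R :=
  let '(x, y, z) := v in (x, y, `|z|).

(* Main.v *)
From HB Require Import structures.
Require Import Defs.
From mathcomp Require Import all_boot all_order all_algebra.
From mathcomp Require Import all_classical all_reals all_analysis.
From mathcomp Require Import ring lra zify.

(** Both knot types can be drawn over one and the same closed curve in the
    plane; then only heights remain to be chosen.

    A tame knot type contains a simple closed polygon.  Such a polygon can be
    cut open near a vertex that is farthest in some horizontal direction: what
    remains is a chain in a half-space [x <= 0] with its ends on the boundary
    plane, and the chain can be closed up in the half-space [x >= 0] by any path
    that is monotone in height, because two such paths are joined by the linear
    motion between them and no polygon met on the way intersects itself
    ([exists_normal_chain]).  Take such a chain for the first knot type in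
    [x <= 0] and one for the second in [x >= 0].  Close each by a path of
    evenly increasing or decreasing heights that lies over the projection of
    the other one: both knots now have the same projection, in which one half
    carries a knotted strand of the first and a trivial strand of the second,
    and vice versa for the other half ([exists_common_projection]).

    After a small perturbation the only self-intersections of the projection
    are finitely many double points.  A knot type does not change when the
    heights are changed but their order at each double point is kept, again by
    a linear motion ([change_heights]).  At each double point give height 1 to
    the strand that is lower for the second knot, and to its upper strand
    height 2 or -2, according to whether that strand is the upper or the lower
    one for the first knot; let the heights be 0 in between.  These heights are
    ordered as in the first knot, and their absolute values as in the second
    ([exists_folding_heights]).  So the polygon with these heights is of the
    first type, its image under the folding map is of the second type, and the
    folding map is injective on it because the image is a simple polygon.

    The ambient isotopies come from one construction.  If two loops [p] and [q]
    are such that [q - p] is Lipschitz with a constant smaller than the one that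
    bounds the chords of [p] from below, then [q - p] is a contraction as a
    function on the image of [p] and extends to a contraction [U] of the whole
    space; moving [v] to [v + t *: U v] is an ambient isotopy
    ([lip_perturbation]).  A linear motion through simple polygons is a finite
    succession of such steps ([represents_linear]), and a smooth knot is carried
    to a fine inscribed polygon by a single one ([regular_represents]). *)

Set Implicit Arguments.
Unset Strict Implicit.
Unset Printing Implicit Defensive.

Import Order.TTheory GRing.Theory Num.Theory.
Import numFieldNormedType.Exports.

Local Open Scope classical_set_scope.
Local Open Scope ring_scope.

(** * Lipschitz displacements of space *)

HB.instance Definition _ (T U : puniformType) := Pointed.on (T * U)%type.

(** Both projections of a Cauchy filter are Cauchy, and a filter converges as
    soon as its projections do. *)
Lemma prod_complete (T U : completeType) (F : set_system (T * U)%type) :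
  ProperFilter F -> cauchy F -> cvg F.
Proof.
move=> FF Fc.
have cF1 : cauchy (fst @ F).
  move=> A entA; rewrite near_simpl -near2E near_map2; apply: Fc.
  exists (A, setT); first by split=> //; exact: entourageT.
  by move=> [[x y] [x' y']] /= [Axy _]; exists ((x, x'), (y, y')).
have cF2 : cauchy (snd @ F).
  move=> A entA; rewrite near_simpl -near2E near_map2; apply: Fc.
  exists (setT, A); first by split=> //; exact: entourageT.
  by move=> [[x y] [x' y']] /= [_ Axy]; exists ((x, x'), (y, y')).
have /cvg_ex[a Fa] : cvg (fst @ F) by exact: cauchy_cvg.
have /cvg_ex[b Fb] : cvg (snd @ F) by exact: cauchy_cvg.
apply/cvg_ex; exists (a, b) => A /= nA.
have h := @cvg_pair _ _ _ F _ _ _ _ _ fst snd Fa Fb A nA.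
have e : A = (fun x => (x.1, x.2)) @^-1` A.
  by apply/seteqP; split => -[].
by rewrite e; exact: h.
Qed.

HB.instance Definition _ (T U : completeType) :=
  Uniform_isComplete.Build (T * U)%type (@prod_complete T U).

HB.instance Definition _ (R : realType) (V W : completeNormedModType R) :=
  Complete.on (V * W)%type.

Section LipschitzMaps.
Variable R : realType.
Implicit Types (V W : normedModType R) (K L : R).

Definition lip V W L (f : V -> W) := forall u v, `|f u - f v| <= L * `|u - v|.

Lemma lip_continuous V W L (f : V -> W) : lip L f -> continuous f.
Proof.
move=> lf x; apply/cvgrPdist_le => e e0.
have L1 : 0 < `|L| + 1 by rewrite ltr_wpDl.
near=> y; apply: (le_trans (lf _ _)).
apply: (@le_trans _ _ ((`|L| + 1) * `|x - y|)).
  by rewrite ler_wpM2r// (le_trans (ler_norm L))// lerDl.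
rewrite -ler_pdivlMl//; near: y.
have d0 : 0 < (`|L| + 1)^-1 * e by rewrite mulr_gt0// invr_gt0.
have := (@cvgrPdist_le _ _ _ (nbhs x) _ id x).1 (@cvg_id _ (nbhs x)) _ d0.
by apply.
Unshelve. all: by end_near. Qed.

(** McShane's formula: the extension is the infimum of the cones of slope [K]
    standing on the prescribed values.  The hypothesis forces [u] to factor
    through [p], which is how a displacement along a loop becomes a function on
    its image. *)
Lemma lip_extension (X : Type) V (x0 : X) (p : X -> V) (u : X -> R) K :
  0 <= K -> (forall s t, `|u s - u t| <= K * `|p s - p t|) ->
  exists2 U : V -> R, lip K U & forall s, U (p s) = u s.
Proof.
move=> K0 uK.
pose E v := [set u s + K * `|v - p s| | s in [set: X]].
have lbE v s t : u s - K * `|v - p s| <= u t + K * `|v - p t|.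
  rewrite lerBlDr -addrA -lerBlDl (le_trans (ler_norm _))//.
  rewrite (le_trans (uK _ _))// -mulrDr ler_wpM2l//.
  by rewrite [leRHS]addrC [`|v - p s|]distrC ler_distD.
have hE v : has_inf (E v).
  split; first by exists (u x0 + K * `|v - p x0|), x0.
  by exists (u x0 - K * `|v - p x0|) => _ [t _ <-].
exists (fun v => inf (E v)) => [v w|s]; last first.
  apply/eqP; rewrite eq_le; apply/andP; split.
    apply: ge_inf; first by case: (hE (p s)).
    by exists s => //; rewrite subrr normr0 mulr0 addr0.
  apply: lb_le_inf; first by case: (hE (p s)).
  by move=> _ [t _ <-]; have := lbE (p s) s t; rewrite subrr normr0 mulr0 subr0.
have half v' w' : inf (E v') - inf (E w') <= K * `|v' - w'|.
  rewrite lerBlDr -lerBlDl; apply: lb_le_inf; first by case: (hE w').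
  move=> _ [t _ <-]; rewrite lerBlDl.
  apply: (@le_trans _ _ (u t + K * `|v' - p t|)).
    by apply: ge_inf; [case: (hE v')|exists t].
  rewrite addrCA lerD2l -mulrDr ler_wpM2l//.
  by rewrite (le_trans _ (ler_normD _ _))// addrA subrK.
by rewrite ler_norml half andbT lerNl opprB distrC half.
Qed.

Lemma normR3E (v : R3 R) :
  `|v| = Num.max (Num.max `|v.1.1| `|v.1.2|) `|v.2|.
Proof. by rewrite !prod_normE. Qed.

Lemma ler_normR3 (v : R3 R) e :
  (`|v| <= e) = [&& `|v.1.1| <= e, `|v.1.2| <= e & `|v.2| <= e].
Proof. by rewrite normR3E !ge_max andbA. Qed.

Lemma lip_extension_R3 (X : Type) (x0 : X) (p u : X -> R3 R) K :
  0 <= K -> (forall s t, `|u s - u t| <= K * `|p s - p t|) ->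
  exists2 U : R3 R -> R3 R, lip K U & forall s, U (p s) = u s.
Proof.
move=> K0 uK.
have uK1 s t : [/\ `|(u s).1.1 - (u t).1.1| <= K * `|p s - p t|,
  `|(u s).1.2 - (u t).1.2| <= K * `|p s - p t| &
  `|(u s).2 - (u t).2| <= K * `|p s - p t| ].
  by have := uK s t; rewrite ler_normR3 => /and3P.
have [U1 l1 e1] := @lip_extension X _ x0 p (fun s => (u s).1.1) K K0
  (fun s t => let: And3 h _ _ := uK1 s t in h).
have [U2 l2 e2] := @lip_extension X _ x0 p (fun s => (u s).1.2) K K0
  (fun s t => let: And3 _ h _ := uK1 s t in h).
have [U3 l3 e3] := @lip_extension X _ x0 p (fun s => (u s).2) K K0
  (fun s t => let: And3 _ _ h := uK1 s t in h).
exists (fun v => (U1 v, U2 v, U3 v)) => [v w|s].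
  by rewrite ler_normR3/= l1 l2 l3.
by rewrite e1 e2 e3; case: (u s) => -[].
Qed.

(** Adding a displacement that is a contraction is a homeomorphism: surjective
    by Banach's fixed point theorem, with a Lipschitz inverse. *)
Lemma contraction_perturbation_homeo (U : R3 R -> R3 R) K :
  0 <= K -> K < 1 -> lip K U ->
  homeomorphism_on [set: R3 R] [set: R3 R] (fun v => v + U v).
Proof.
move=> K0 K1 lU.
have low v w : (1 - K) * `|v - w| <= `|(v + U v) - (w + U w)|.
  rewrite opprD addrACA mulrBl mul1r lerBlDr.
  apply: (@le_trans _ _ (`|(v - w) + (U v - U w)| + `|U v - U w|)).
    by rewrite -{1}(addrK (U v - U w) (v - w)) ler_normB.
  by rewrite lerD2l.
have K1' : 0 < 1 - K by rewrite subr_gt0.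
have inj v w : v + U v = w + U w -> v = w.
  move=> e; have := low v w; rewrite e subrr normr0 pmulr_rle0// normr_le0.
  by rewrite subr_eq0 => /eqP.
have surj y : exists v, v + U v = y.
  pose f v := y - U v.
  have fl v w : `|f v - f w| <= K * `|v - w|.
    by rewrite opprD addrACA subrr add0r -opprD normrN; exact: lU.
  have funf : set_fun [set: R3 R] [set: R3 R] f by [].
  have [v _] : exists2 v, [set: R3 R] v & v = f v.
    pose g : {fun [set: R3 R] >-> [set: R3 R]} := mkfun funf.
    apply: (@banach_fixed_point R _ _ g); [|exact: closedT|by exists 0].
    by exists (NngNum K0); split=> //= -[v w] _; exact: fl.
  by move=> ev; exists v; rewrite {1}ev subrK.
have [g gK] := choice surj.
split.
- split => //.
  + by move=> v w _ _; exact: inj.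
  + by move=> y _; have [v <-] := surj y; exists v.
- apply: continuous_subspaceT => v; apply: cvgD; first exact: cvg_id.
  exact: (lip_continuous lU).
- exists g; last by move=> v _; apply: inj; rewrite gK.
  apply: continuous_subspaceT; apply: (@lip_continuous _ _ (1 - K)^-1) => x y.
  by rewrite ler_pdivlMl// (le_trans (low _ _))// !gK.
Qed.

(** All displacements [t *: U] with [t] at most one are contractions. *)
Lemma contraction_isotopy (U : R3 R -> R3 R) K :
  0 <= K -> K < 1 -> lip K U -> ambient_isotopy (fun t v => v + t *: U v).
Proof.
move=> K0 K1 lU; split.
- apply: continuous_subspaceT => -[t v].
  apply: (@cvgD _ _ _ (nbhs (t, v))); first exact: cvg_snd.
  apply: cvgZ; first exact: cvg_fst.
  by apply: (cvg_comp snd); [exact: cvg_snd|exact: (lip_continuous lU)].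
- move=> t /andP[t0 t1].
  apply: (@contraction_perturbation_homeo _ K) => // v w.
  rewrite -scalerBr normrZ ger0_norm// (le_trans _ (lU v w))//.
  by rewrite ler_piMl.
- by apply/funext => v; rewrite scale0r addr0.
Qed.

Lemma within_continuous_comp (S T U : topologicalType) (A : set S) (B : set T)
    (f : S -> T) (g : T -> U) :
  (forall x, A x -> B (f x)) -> {within A, continuous f} ->
  {within B, continuous g} -> {within A, continuous (g \o f)}.
Proof.
move=> fAB /subspace_continuousP fc /subspace_continuousP gc.
apply/subspace_continuousP => x Ax.
apply: (@cvg_comp _ _ _ f g _ (within B (nbhs (f x)))); last exact: gc (fAB x Ax).
move=> P /= nP; have := fc x Ax _ nP; rewrite /= !nbhs_simpl /=.
rewrite /within /=; apply: filterS => y h Ay; exact: h Ay (fAB y Ay).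
Qed.

Lemma homeomorphism_on_comp (S T U : topologicalType) (A : set S) (B : set T)
    (C : set U) (f : S -> T) (g : T -> U) :
  homeomorphism_on A B f -> homeomorphism_on B C g ->
  homeomorphism_on A C (g \o f).
Proof.
move=> [[fAB finj fsurj] fc [f' f'c fK]] [[gBC ginj gsurj] gc [g' g'c gK]].
split.
- split.
  + by move=> x Ax; apply/gBC/fAB.
  + move=> x y xA yA /= e; apply: finj => //.
    by apply: ginj e; apply/mem_set/fAB/set_mem.
  + move=> z /gsurj[y By <-]; have [x Ax <-] := fsurj y By.
    by exists x.
- exact: within_continuous_comp fAB fc gc.
- exists (f' \o g') => [|x]; last first.
    by rewrite inE => Ax; rewrite /= gK ?fK// inE//; apply: fAB.
  apply: within_continuous_comp g'c f'c => z /gsurj[y By <-].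
  by rewrite gK// inE.
Qed.

Lemma ambient_isotopy_comp (H G : R -> R3 R -> R3 R) :
  ambient_isotopy H -> ambient_isotopy G ->
  ambient_isotopy (fun t v => G t (H t v)).
Proof.
move=> [Hc Hh H0] [Gc Gh G0]; split.
- pose S : set (R * R3 R) := `[0, 1]%classic `*` [set: R3 R].
  pose f (tx : R * R3 R) := (tx.1, H tx.1 tx.2).
  have fS x : S x -> S (f x) by case: x => t v [].
  have fc : {within S, continuous f}.
    move/subspace_continuousP: Hc => Hc; apply/subspace_continuousP => x Sx.
    apply: (@cvg_pair _ _ _ (within S (nbhs x)) (nbhs x.1)
      (nbhs (H x.1 x.2)) _ _ _ fst (fun tx => H tx.1 tx.2)); last exact: Hc.
    by apply: cvg_trans; [apply: cvg_app; exact: cvg_within|exact: cvg_fst].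
  exact: (within_continuous_comp fS fc Gc).
- by move=> t t01; apply: homeomorphism_on_comp (Hh t t01) (Gh t t01).
- by rewrite H0 G0.
Qed.

End LipschitzMaps.

(** * Periodic parametrizations of knots *)

Section Reparametrization.
Variable R : realType.
Implicit Types (T : R) (phi : R -> R).

(** The maps in [positive_reparam] with arbitrary periods, so that a polygon
    with [n] vertices can be parametrized with period [n]. *)
Definition reparam T T' phi :=
  [/\ continuous phi, {homo phi : s t / s < t}
    & forall t, phi (t + T) = phi t + T'].

(** The order topology: preimages of intervals are intervals. *)
Lemma increasing_surj_continuous phi :
  {homo phi : s t / s < t} -> (forall y, exists x, phi x = y) -> continuous phi.
Proof.
move=> inc surj x; apply/cvgrPdist_lt => e e0.
have [a pa] := surj (phi x - e); have [b pb] := surj (phi x + e).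
have mono := leW_mono (le_mono inc).
have ax : a < x by rewrite -mono pa ltrBlDr ltrDl.
have xb : x < b by rewrite -mono pb ltrDl.
near=> y; rewrite ltr_distlC -pa -pb !mono; apply/andP; split; near: y.
  exact: lt_nbhsr.
exact: lt_nbhsl.
Unshelve. all: by end_near. Qed.

Lemma reparamMz T T' phi (k : int) t :
  (forall t, phi (t + T) = phi t + T') ->
  phi (t + k%:~R * T) = phi t + k%:~R * T'.
Proof.
move=> per.
have nat_case (n : nat) u : phi (u + n%:R * T) = phi u + n%:R * T'.
  elim: n u => [|n IH] u; first by rewrite !mul0r !addr0.
  by rewrite -natr1 !mulrDl !mul1r !addrA per IH.
case: k => n; first by rewrite -!pmulrn nat_case.
rewrite NegzE !mulrNz -!pmulrn !mulNr.
by rewrite -[in phi t](subrK (n.+1%:R * T) t) nat_case addrK.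
Qed.

Lemma periodicMz (X : Type) T (p : R -> X) (k : int) t :
  (forall t, p (t + T) = p t) -> p (t + k%:~R * T) = p t.
Proof.
move=> per.
have nat_case (n : nat) u : p (u + n%:R * T) = p u.
  elim: n u => [|n IH] u; first by rewrite mul0r addr0.
  by rewrite -natr1 mulrDl mul1r addrA per IH.
case: k => n; first by rewrite -pmulrn nat_case.
rewrite NegzE mulrNz -pmulrn mulNr.
by rewrite -[in p t](subrK (n.+1%:R * T) t) nat_case.
Qed.

(** The intermediate value theorem between two multiples of the period. *)
Lemma reparam_surj T T' phi y :
  0 < T -> 0 < T' -> reparam T T' phi -> exists x, phi x = y.
Proof.
move=> T0 T'0 [c inc per].
pose k : int := Num.floor ((y - phi 0) / T').
have /andP[k1 k2] : k%:~R <= (y - phi 0) / T' < (k + 1)%:~R by exact: floor_itv.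
have e1 : phi (k%:~R * T) <= y.
  by rewrite -[_ * T]add0r (reparamMz _ _ per) addrC -lerBrDr -ler_pdivlMr.
have e2 : y <= phi ((k + 1)%:~R * T).
  by rewrite -[_ * T]add0r (reparamMz _ _ per) addrC -lerBlDr -ler_pdivrMr// ltW.
have kT : k%:~R * T <= (k + 1)%:~R * T by rewrite ler_pM2r// ler_int lerDl.
have [||x _ <-] := @IVT R phi _ _ y kT; last by exists x.
  exact: continuous_subspaceT.
by rewrite min_l ?max_r ?e1 ?e2// (le_trans e1).
Qed.

Lemma reparam_comp T T' T'' phi psi :
  reparam T T' phi -> reparam T' T'' psi -> reparam T T'' (psi \o phi).
Proof.
move=> [c inc per] [c' inc' per']; split.
- by move=> x; apply: continuous_comp; [exact: c|exact: c'].
- by move=> s t st; apply/inc'/inc.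
- by move=> t; rewrite /= per per'.
Qed.

Lemma reparam_inv T T' phi : 0 < T -> 0 < T' -> reparam T T' phi ->
  exists2 psi, reparam T' T psi & cancel phi psi /\ cancel psi phi.
Proof.
move=> T0 T'0 rphi.
have [psi psiK] := choice (fun y => reparam_surj y T0 T'0 rphi).
have [c inc per] := rphi.
have mono := leW_mono (le_mono inc).
have inj := inc_inj (le_mono inc).
have phiK : cancel phi psi by move=> x; apply: inj; rewrite psiK.
exists psi => //.
have inc' : {homo psi : s t / s < t} by move=> s t st; rewrite -mono !psiK.
split=> //.
- by apply: increasing_surj_continuous => // x; exists (phi x); rewrite phiK.
- by move=> t; apply: inj; rewrite per !psiK.
Qed.

Lemma reparam_scale T T' : 0 < T -> 0 < T' ->
  reparam T T' (fun t => t * (T' / T)).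
Proof.
move=> T0 T'0; split.
- by move=> x; apply: cvgMl; exact: cvg_id.
- by move=> s t st; rewrite ltr_pM2r// divr_gt0.
- by move=> t; rewrite mulrDl [T * _]mulrC divfK// gt_eqF.
Qed.

Lemma reparam_shift T a : reparam T T (fun t => t + a).
Proof.
split.
- by move=> x; apply: cvgD; [exact: cvg_id|exact: cvg_cst].
- by move=> s t st; rewrite ltrD2r.
- by move=> t; rewrite addrAC.
Qed.

End Reparametrization.

Section Loops.
Variable R : realType.
Implicit Types (T : R) (p q : R -> R3 R).

Definition loop T p := [/\ continuous p, forall t, p (t + T) = p t
  & forall s t, p s = p t -> exists k : int, s = t + k%:~R * T].

(** [reparam (2 * pi) T] brings the parameter back to the circle, whatever the
    period of [p] is. *)
Definition knot_of T p :=
  OrientedSet (range p) [set p \o phi | phi in reparam (2 * pi) T].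

Lemma two_pi_gt0 : 0 < 2 * pi :> R.
Proof. by rewrite mulr_gt0// pi_gt0. Qed.

Lemma knot_of_reparam T T' psi p : 0 < T -> 0 < T' -> reparam T T' psi ->
  knot_of T (p \o psi) = knot_of T' p.
Proof.
move=> T0 T'0 rpsi; rewrite /knot_of; congr OrientedSet.
  apply/seteqP; split=> [_ [t _ <-]|_ [t _ <-]]; first by exists (psi t).
  by have [s <-] := reparam_surj t T0 T'0 rpsi; exists s.
apply/seteqP; split=> [_ [phi rphi <-]|_ [phi rphi <-]].
  by exists (psi \o phi) => //; apply: reparam_comp rphi rpsi.
have [psi' rpsi' [_ psi'K]] := reparam_inv T0 T'0 rpsi.
exists (psi' \o phi); first exact: reparam_comp rphi rpsi'.
by apply/funext => t; rewrite /= psi'K.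
Qed.

Lemma loop_reparam T T' psi p : 0 < T -> 0 < T' -> reparam T T' psi ->
  loop T' p -> loop T (p \o psi).
Proof.
move=> T0 T'0 [c inc per] [pc pper pinj]; split.
- by move=> x; apply: continuous_comp; [exact: c|exact: pc].
- by move=> t; rewrite /= per pper.
- move=> s t /= /pinj[k]; rewrite -(reparamMz _ _ per) => e; exists k.
  exact: (inc_inj (le_mono inc)).
Qed.

Lemma oriented_image_knot_of f T p :
  oriented_image f (knot_of T p) = knot_of T (f \o p).
Proof.
rewrite /oriented_image /knot_of /=; congr OrientedSet.
  by rewrite image_comp.
apply/seteqP; split=> [_ [_ [phi rphi <-] <-]|_ [phi rphi <-]].
  by exists phi.
by exists (p \o phi) => //; exists phi.
Qed.

(** A continuous map from a compact set to a Hausdorff space is a quotient map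
    onto its image. *)
Lemma compact_pullback_continuous (S T U : topologicalType) (K : set S) (f : S -> T)
    (g : T -> U) : hausdorff_space T -> compact K -> {within K, continuous f} ->
  {within K, continuous (g \o f)} -> {within f @` K, continuous g}.
Proof.
move=> hT cK cf cgf; apply/subspace_continuousP => y [x0 Kx0 fx0] O.
rewrite nbhsE => -[W [oW Wy] WO].
have /open_subspaceP[V oV VK] : open ((g \o f) @^-1` W : set (subspace K)).
  by move/continuousP: cgf => cgf; exact: cgf.
have cC : closed (f @` (K `&` ~` V)).
  apply: compact_closed => //; apply: continuous_compact.
    by apply: continuous_subspaceW cf; exact: subIsetl.
  by apply: compact_closedI => //; exact: open_closedC.
have nyC : ~ (f @` (K `&` ~` V)) y.
  move=> [x [Kx nVx] fxy].
  have : (V `&` K) x by rewrite VK; split=> //=; rewrite fxy.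
  by case.
rewrite /= !nbhs_simpl /= /within /=.
have : nbhs y (~` (f @` (K `&` ~` V))).
  by apply: open_nbhs_nbhs; split=> //; exact: closed_openC.
apply: filterS => z /= nz [x Kx fxz]; subst z; apply: WO.
apply: contrapT => nW; apply: nz; exists x => //; split=> // Vx.
have VKx : (V `&` K) x by [].
by move: VKx; rewrite VK => -[/nW].
Qed.

End Loops.

(** * Loops and oriented knots *)

Section OrientedKnots.
Variable R : realType.
Implicit Types (T : R) (p q : R -> R3 R).

Lemma circle_exp_continuous : continuous (@circle_exp R).
Proof.
move=> t; apply: (@cvg_pair _ _ _ (nbhs t) (nbhs (cos t)) (nbhs (sin t))).
  exact: continuous_cos.
exact: continuous_sin.
Qed.

Lemma circle_exp_in t : unit_circle R (circle_exp t).
Proof. exact: cos2Dsin2. Qed.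

Lemma circle_exp_surj v : unit_circle R v -> exists t, circle_exp t = v.
Proof.
case: v => x y; rewrite /unit_circle /= => xy1.
have x1 : -1 <= x <= 1.
  rewrite -ler_norml -(@expr_le1 _ 2)// real_normK ?num_real//.
  by rewrite -xy1 lerDl sqr_ge0.
have sx : sin (acos x) = `|y|.
  by rewrite sin_acos// -xy1 addrAC subrr add0r sqrtr_sqr.
have cx : cos (acos x) = x by rewrite acosK.
have [y0|y0] := leP 0 y.
  by exists (acos x); rewrite /circle_exp cx sx ger0_norm.
by exists (- acos x); rewrite /circle_exp cosN sinN cx sx ltr0_norm// opprK.
Qed.

Lemma circle_exp_per t : circle_exp (t + 2 * pi) = circle_exp t :> R * R.
Proof.
by rewrite /circle_exp cosD sinD mulr_natl cos2pi sin2pi !mulr1 !mulr0 subr0 addr0.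
Qed.

Lemma floor_period T t : 0 < T ->
  exists2 u, 0 <= u < T & exists k : int, t = u + k%:~R * T.
Proof.
move=> T0; pose k : int := Num.floor (t / T).
have /andP[k1 k2] : k%:~R <= t / T < (k + 1)%:~R by exact: floor_itv.
exists (t - k%:~R * T); last by exists k; rewrite subrK.
rewrite subr_ge0 -ler_pdivlMr// k1 /= ltrBlDr.
by rewrite -{1}[T]mul1r -mulrDl addrC -intrD1 -ltr_pdivrMr.
Qed.

(** If [u] is the difference reduced modulo the period, then [cos u = 1] gives
    [sin (u / 2) = 0], and the sine has no zero inside the half period. *)
Lemma circle_exp_eq s t : circle_exp s = circle_exp t :> R * R ->
  exists k : int, s = t + k%:~R * (2 * pi).
Proof.
move=> [cst sst].
have c1 : cos (s - t) = 1.
  by rewrite cosB cst sst -!expr2 cos2Dsin2.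
have [u u2 [k e]] := @floor_period (2 * pi) (s - t) (two_pi_gt0 R).
exists k; suff u0 : u = 0.
  by rewrite -[s](subrK t) e u0 add0r addrC.
have cu : cos u = 1.
  rewrite -c1 e.
  by have [->] := periodicMz k u circle_exp_per.
have s0 : sin (u / 2) = 0.
  have : cos ((u / 2) *+ 2) = 1 by rewrite -mulr_natr divfK.
  rewrite cos_mulr2n => h; have := cos2Dsin2 (u / 2) => h2.
  by apply/eqP; rewrite -sqrf_eq0; apply/eqP; lra.
have [u0|] := eqVneq u 0 => //.
move: u2 => /andP[u0 u2] un0.
have : 0 < sin (u / 2).
  by apply: sin_gt0_pi; apply/andP; split; [rewrite divr_gt0// lt_neqAle eq_sym un0|
    rewrite ltr_pdivrMr// mulrC].
by rewrite s0 ltxx.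
Qed.

Lemma loop_range T p : 0 < T -> (forall t, p (t + T) = p t) ->
  range p = p @` `[0, T].
Proof.
move=> T0 per; apply/seteqP; split=> [_ [t _ <-]|_ [t _ <-]]; last by exists t.
have [u /andP[u0 uT] [k ->]] := floor_period t T0.
by rewrite periodicMz//; exists u => //=; rewrite in_itv /= u0 ltW.
Qed.

Lemma unit_circleE : unit_circle R = @circle_exp R @` `[0, 2 * pi].
Proof.
apply/seteqP; split=> [v /circle_exp_surj[t <-]|_ [t _ <-]]; last first.
  exact: circle_exp_in.
have [u /andP[u0 uT] [k ->]] := floor_period t (two_pi_gt0 R).
exists u; first by rewrite /= in_itv /= u0 ltW.
by rewrite (periodicMz _ _ circle_exp_per).
Qed.

(** The argument on the circle is a discontinuous choice, but its composite with
    a periodic map is continuous because the exponential is a quotient map; the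
    inverse is continuous because [p] is one. *)
Lemma loop_knot_param p : loop (2 * pi) p -> knot_param (range p) p.
Proof.
move=> [pc pper pinj].
have pk k t : p (t + k%:~R * (2 * pi)) = p t by exact: periodicMz.
have [arg argK] : {arg : R * R -> R | forall v, unit_circle R v ->
    circle_exp (arg v) = v}.
  apply: cid; have /choice[f fP] : forall v, exists t, unit_circle R v ->
      circle_exp t = v.
    move=> v; have [/circle_exp_surj[t et]|] := pselect (unit_circle R v).
      by exists t.
    by exists 0.
  by exists f.
have [s sK] : {s : R3 R -> R | forall t, p (s (p t)) = p t}.
  apply: cid; have /choice[f fP] : forall x, exists t, range p x -> p t = x.
    move=> x; have [[t _ et]|] := pselect (range p x); first by exists t.
    by exists 0.
  by exists f => t; apply: fP; exists t.
have hE t : p (arg (circle_exp t)) = p t.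
  have [k ->] := circle_exp_eq (argK _ (circle_exp_in t)); exact: pk.
have gE t : circle_exp (s (p t)) = circle_exp t :> R * R.
  have [k ->] := pinj _ _ (sK t).
  by rewrite (periodicMz _ _ circle_exp_per).
exists (p \o arg); last by apply/funext => t /=; rewrite hE.
split.
- split.
  + by move=> v _ /=; exists (arg v).
  + move=> v w; rewrite !inE => vC wC /= /pinj[k ek].
    by rewrite -(argK v vC) -(argK w wC) ek (periodicMz _ _ circle_exp_per).
  + move=> _ [t _ <-]; exists (circle_exp t); first exact: circle_exp_in.
    exact: hE.
- rewrite unit_circleE.
  apply: (@compact_pullback_continuous _ _ _ `[0, 2 * pi]%classic (@circle_exp R) (p \o arg)).
  + exact: norm_hausdorff.
  + exact: segment_compact.
  + by apply: continuous_subspaceT; exact: circle_exp_continuous.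
  + rewrite (_ : _ \o _ = p); last by apply/funext => t /=; rewrite hE.
    exact: continuous_subspaceT.
- exists (@circle_exp R \o s) => [|v]; last first.
    by rewrite inE => vC /=; rewrite gE argK.
  rewrite (loop_range (two_pi_gt0 R) pper).
  apply: (@compact_pullback_continuous _ _ _ `[0, 2 * pi]%classic p (@circle_exp R \o s)).
  + exact: norm_hausdorff.
  + exact: segment_compact.
  + exact: continuous_subspaceT.
  + rewrite (_ : _ \o _ = @circle_exp R); last by apply/funext => t /=; rewrite gE.
    by apply: continuous_subspaceT; exact: circle_exp_continuous.
Qed.

Lemma knot_param_loop (A : set (R3 R)) p : knot_param A p -> loop (2 * pi) p /\ A = range p.
Proof.
move=> [h [[hC hinj hsurj] hc _] ->]; split; last first.
  apply/seteqP; split=> [x /hsurj[v /circle_exp_surj[t <-] <-]|_ [t _ <-]].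
    by exists t.
  exact/hC/circle_exp_in.
split.
- move=> t; move/subspace_continuousP: hc => /(_ _ (circle_exp_in t)) hc.
  apply: (@cvg_comp _ _ _ (@circle_exp R) h _ (within (unit_circle R)
    (nbhs (circle_exp t)))); last exact: hc.
  move=> P /= nP; have := circle_exp_continuous nP.
  rewrite /= !nbhs_simpl /=; apply: filterS => y /=; apply.
  exact: circle_exp_in.
- by move=> t /=; rewrite circle_exp_per.
- move=> s t /= /hinj e; apply: circle_exp_eq; apply: e;
    by rewrite inE; exact: circle_exp_in.
Qed.

Lemma is_oriented_knotE (k : oriented_set R) : is_oriented_knot k ->
  exists2 p, loop (2 * pi) p & k = knot_of (2 * pi) p.
Proof.
case: k => A O [_ [p /= kp ->]].
by have [lp ->] := knot_param_loop kp; exists p.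
Qed.

Lemma knot_of_rescale T p : 0 < T ->
  knot_of T p = knot_of (2 * pi) (fun t => p (t * (T / (2 * pi)))).
Proof.
move=> T0; apply/esym.
apply: (@knot_of_reparam _ _ _ (fun t => t * (T / (2 * pi)))) => //.
  exact: two_pi_gt0.
by apply: reparam_scale => //; exact: two_pi_gt0.
Qed.

Lemma loop_rescale T T' p : 0 < T -> 0 < T' -> loop T' p ->
  loop T (fun t => p (t * (T' / T))).
Proof.
move=> T0 T'0.
by apply: (@loop_reparam _ _ _ (fun t => t * (T' / T))) => //; exact: reparam_scale.
Qed.

Lemma knot_of_oriented T p : 0 < T -> loop T p -> is_oriented_knot (knot_of T p).
Proof.
move=> T0 lp; rewrite knot_of_rescale//.
have kp := loop_knot_param (loop_rescale (two_pi_gt0 R) T0 lp).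
split; last by eexists; first exact: kp.
by case: kp => h hh _; exists h.
Qed.

Lemma oriented_image_comp (f g : R3 R -> R3 R) (k : oriented_set R) :
  oriented_image f (oriented_image g k) = oriented_image (f \o g) k.
Proof. by rewrite /oriented_image /= !image_comp. Qed.

(** A knot type is a class around one of its members, so this is transitivity of
    ambient isotopy. *)
Lemma oriented_knot_type_ambient (K : set (oriented_set R)) T p q : oriented_knot_type K -> 0 < T ->
  loop T q -> ambient_isotopic (knot_of T p) (knot_of T q) ->
  K (knot_of T p) -> K (knot_of T q).
Proof.
move=> [k0 _ ->] T0 lq [G iG eG] [_ [H iH eH]]; split; first exact: knot_of_oriented.
exists (fun t v => G t (H t v)); first exact: ambient_isotopy_comp.
by rewrite -eG -eH oriented_image_comp.
Qed.

(** The displacement is a contraction as a function on the image of the loop, so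
    it extends to a contraction of the whole space.  The lower bound on chords
    is asked for parameter lengths up to half a period, since longer ones can be
    shortened by shifting an end by a period. *)
Lemma lip_perturbation T c L p q : 0 < T -> loop T p ->
  (forall s t, `|s - t| <= T / 2 -> c * `|s - t| <= `|p s - p t|) ->
  (forall t, q (t + T) = q t) -> 0 <= L -> L < c ->
  (forall s t, `|(q s - p s) - (q t - p t)| <= L * `|s - t|) ->
  loop T q /\ ambient_isotopic (knot_of T p) (knot_of T q).
Proof.
move=> T0 [pc pper pinj] pc' qper L0 Lc qpL.
have c0 : 0 < c by exact: le_lt_trans Lc.
have K0 : 0 <= L / c by rewrite divr_ge0// ltW.
have K1 : L / c < 1 by rewrite ltr_pdivrMr// mul1r.
have hK s t : `|(q s - p s) - (q t - p t)| <= (L / c) * `|p s - p t|.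
  have [u [k eu hu]] : exists u, exists2 k : int, t = u + k%:~R * T & `|s - u| <= T / 2.
    have [r /andP[r0 rT] [k ek]] := floor_period (s - t + T / 2) T0.
    exists (t + k%:~R * T); first exists (- k).
      by rewrite mulrNz mulNr addrK.
    rewrite (_ : s - _ = r - T / 2); last by lra.
    by rewrite ler_norml; lra.
  rewrite eu !(periodicMz _ _ qper) !(periodicMz _ _ pper).
  rewrite (le_trans (qpL s u))// -mulrA ler_wpM2l// -ler_pdivrMl ?invr_gt0//.
  by rewrite invrK; exact: pc'.
have [U lU Up] := @lip_extension_R3 R R 0 p (fun t => q t - p t) _ K0 hK.
have iH := contraction_isotopy K0 K1 lU.
have H1 t : p t + 1 *: U (p t) = q t by rewrite scale1r Up addrC subrK.
have [_ /(_ 1) hH _] := iH.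
have [[_ Hinj _] Hc _] := hH (introT andP (conj ler01 (lexx _))).
split; last first.
  exists (fun t v => v + t *: U v) => //; rewrite oriented_image_knot_of.
  by congr knot_of; apply/funext => t /=; rewrite H1.
split=> //.
- have -> : q = (fun v => v + 1 *: U v) \o p by apply/funext => t /=; rewrite H1.
  move=> t; apply: continuous_comp; first exact: pc.
  apply: cvgD; first exact: cvg_id.
  by apply: cvgZr; exact: (lip_continuous lU).
- by move=> s t; rewrite -!H1 => /Hinj e; apply: pinj; apply: e; rewrite inE.
Qed.

End OrientedKnots.

(** * Piecewise linear paths *)

Section PiecewiseLinear.
Variable R : realType.
Implicit Types (s t u : R) (i j k : int).

(** Linear interpolation of the vertices [v]; the time is counted in edges. *)
Definition pl (V : lmodType R) (v : int -> V) t : V :=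
  v (Num.floor t) + (t - (Num.floor t)%:~R) *: (v (Num.floor t + 1) - v (Num.floor t)).

Lemma floorP t : exists2 i : int, i%:~R <= t & t < i%:~R + 1.
Proof.
have /andP[h1 h2] : (Num.floor t)%:~R <= t < (Num.floor t + 1)%:~R := floor_itv t.
by exists (Num.floor t) => //; rewrite -intrD1.
Qed.

Section Vectors.
Variable V : lmodType R.
Implicit Types v w : int -> V.

(** The formula of a cell holds at its right end too, although the definition
    uses the next cell there. *)
Lemma plE v i t : i%:~R <= t -> t <= i%:~R + 1 ->
  pl v t = v i + (t - i%:~R) *: (v (i + 1) - v i).
Proof.
move=> it; rewrite le_eqVlt => /orP[/eqP te|ti]; last first.
  by rewrite /pl (@floor_def _ _ i)// it intrD1.
have -> : pl v t = v (i + 1).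
  have fl : Num.floor t = i + 1.
    by apply: floor_def; rewrite te -intrD1 lexx ltr_int ltrDl.
  by rewrite /pl fl te -intrD1 subrr scale0r addr0.
by rewrite te addrAC subrr add0r scale1r [RHS]addrC subrK.
Qed.

Lemma pl_int v i : pl v i%:~R = v i.
Proof. by rewrite (@plE _ i)// ?subrr ?scale0r ?addr0// lerDl. Qed.

Lemma pl_periodic v (n : nat) t : (forall i, v (i + n%:Z) = v i) ->
  pl v (t + n%:R) = pl v t.
Proof.
move=> per; have [i it ti] := floorP t.
rewrite (@plE _ i t)// ?ltW// (@plE _ (i + n%:Z) (t + n%:R)) intrD; last 2 first.
- by rewrite lerD2r.
- by rewrite addrAC lerD2r ltW.
by rewrite [i + _ + 1]addrAC !per -pmulrn [i%:~R + _]addrC addrKA.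
Qed.

Lemma pl_shift v k t : pl (fun i => v (i + k)) t = pl v (t + k%:~R).
Proof.
have [i it ti] := floorP t.
rewrite (@plE _ i t)// ?ltW// (@plE _ (i + k) (t + k%:~R)) intrD; last 2 first.
- by rewrite lerD2r.
- by rewrite addrAC lerD2r ltW.
by rewrite [i + _ + 1]addrAC [i%:~R + _]addrC addrKA.
Qed.

Lemma pl_interp v w s t :
  pl (fun i => (1 - s) *: v i + s *: w i) t = (1 - s) *: pl v t + s *: pl w t.
Proof.
rewrite /pl; set i := Num.floor t; set a := t - _.
have -> : (1 - s) *: v (i + 1) + s *: w (i + 1) - ((1 - s) *: v i + s *: w i)
    = (1 - s) *: (v (i + 1) - v i) + s *: (w (i + 1) - w i).
  by rewrite !scalerBr opprD addrACA.
set D := v (i + 1) - v i; set E := w (i + 1) - w i.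
by rewrite !scalerDr !scalerA ![a * _]mulrC addrACA.
Qed.

(** Any chord of a polygonal line spanning a parameter length at most one is
    the homothetic image of a chord of parameter length exactly one, the centre
    being the vertex in between. *)
Lemma pl_chord v s u : 0 <= u -> u <= 1 ->
  exists s', pl v (s + u) - pl v s = u *: (pl v (s' + 1) - pl v s').
Proof.
move=> u0 u1; have [i si is1] := floorP s.
have [sui|sui] := leP (s + u) (i%:~R + 1).
  exists i%:~R; rewrite -intrD1 !pl_int !(@plE _ i)// ?(ltW is1)//; last lra.
  rewrite opprD addrACA subrr add0r -scalerBl; congr (_ *: _); lra.
have u_gt0 : 0 < u by lra.
pose b := (s + u - (i%:~R + 1)) / u.
have bu : b * u = s + u - (i%:~R + 1) by rewrite divfK// gt_eqF.
have b0 : 0 <= b by rewrite divr_ge0//; lra.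
have b1 : b <= 1 by rewrite ler_pdivrMr//; lra.
exists (i%:~R + b); rewrite (@plE _ (i + 1) (s + u)) ?intrD1; [|lra|lra].
rewrite (@plE _ (i + 1) (i%:~R + b + 1)) ?intrD1; [|lra|lra].
rewrite (@plE _ i s)// ?ltW// (@plE _ i (i%:~R + b)); [|lra|lra].
set A := v (i + 1 + 1); set B := v (i + 1); set C := v i.
rewrite (_ : i%:~R + b + 1 - (i%:~R + 1) = b); last by lra.
rewrite (_ : i%:~R + b - i%:~R = b); last by lra.
rewrite -bu (_ : s - i%:~R = 1 - u + b * u); last by lra.
set E := A - B; set D := B - C.
have -> : B = D + C by rewrite subrK.
move: D E => D E.
rewrite ![D + C + _]addrAC !addrKA.
rewrite scalerBr scalerDr !scalerA scalerDl scalerBl scale1r [u * b]mulrC.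
by rewrite opprD opprB addrA [D + _]addrC addrACA subrr addr0 [_ + u *: D]addrC.
Qed.

End Vectors.

(** Chords add up along the line. *)
Lemma lip_cells (V : normedModType R) (f : R -> V) L :
  (forall i s t, i%:~R <= s <= i%:~R + 1 -> i%:~R <= t <= i%:~R + 1 ->
     `|f s - f t| <= L * `|s - t|) ->
  forall s t, `|f s - f t| <= L * `|s - t|.
Proof.
move=> fL s t; wlog st : s t / s <= t.
  move=> h; have [st|/ltW ts] := leP s t; first exact: h.
  by rewrite distrC [`|s - t|]distrC; exact: h.
have [i si is1] := floorP s.
suff H (n : nat) : forall t, s <= t -> t <= i%:~R + n.+1%:R ->
    `|f s - f t| <= L * `|s - t|.
  have [j tj jt1] := floorP t.
  have ij : i <= j by rewrite -ltzD1 -(ltr_int R) intrD1; lra.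
  apply: (H (absz (j + 1 - i)%R) t st).
  rewrite -natr1 natr_absz ger0_norm; last by lia.
  by rewrite intrB intrD; lra.
elim: n => [|n IH] {st}t st ti; first by apply: (fL i); lra.
have [tn|tn] := leP t (i%:~R + n.+1%:R); first exact: IH.
set m := i%:~R + n.+1%:R in tn.
have h1 : `|f s - f m| <= L * `|s - m|.
  by apply: IH => //; rewrite /m -natr1; have := ler0n R n; lra.
have h2 : `|f m - f t| <= L * `|m - t|.
  apply: (fL (i + n.+1%:Z)); rewrite intrD -/m; first lra.
  by rewrite -natr1 addrA in ti; rewrite (ltW tn) ti.
have sm : s <= m by rewrite /m -natr1; have := ler0n R n; lra.
rewrite (le_trans (ler_distD (f m) _ _))// (le_trans (lerD h1 h2))//.
rewrite -mulrDr !ler0_norm; [|lra|lra|lra].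
by rewrite le_eqVlt; apply/orP; left; apply/eqP; congr (_ * _); lra.
Qed.

Lemma pl_lip (V : normedModType R) (v : int -> V) L :
  (forall i, `|v (i + 1) - v i| <= L) ->
  forall s t, `|pl v s - pl v t| <= L * `|s - t|.
Proof.
move=> vL; apply: lip_cells => i s t /andP[s1 s2] /andP[t1 t2].
rewrite !(@plE _ _ i)// opprD addrACA subrr add0r -scalerBl normrZ mulrC.
by rewrite opprB addrA subrK ler_wpM2r.
Qed.

Lemma periodic_mod (X : Type) (v : int -> X) (n : nat) i :
  (0 < n)%N -> (forall i, v (i + n%:Z) = v i) ->
  (absz (i %% n%:Z)%Z < n)%N /\ v i = v (absz (i %% n%:Z)%Z).
Proof.
move=> n0 per.
have step (k : nat) j : v (j + k%:Z * n%:Z) = v j.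
  elim: k => [|k IH]; first by rewrite mul0r addr0.
  by rewrite intS mulrDl mul1r [n%:Z + _]addrC addrA per IH.
have nn : n%:Z != 0 by lia.
split; first by rewrite -ltz_nat gez0_abs ?modz_ge0// ltz_pmod//; lia.
rewrite gez0_abs ?modz_ge0//.
rewrite {1}(divz_eq i n%:Z) addrC.
case: (i %/ n%:Z)%Z => k; first exact: step.
by rewrite NegzE mulNr -[in RHS](subrK (k.+1%:Z * n%:Z) (i %% n%:Z)%Z) step.
Qed.

Lemma pl_bound (V : normedModType R) (v : int -> V) (n : nat) :
  (0 < n)%N -> (forall i, v (i + n%:Z) = v i) ->
  exists2 L, 0 <= L & forall i, `|v i| <= L.
Proof.
move=> n0 per; exists (\sum_(j < n) `|v j%:Z|); first by apply: sumr_ge0.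
move=> i; have [jn ->] := periodic_mod i n0 per.
by rewrite (bigD1 (Ordinal jn))//= lerDl sumr_ge0.
Qed.

Lemma pl_continuous (V : normedModType R) (v : int -> V) (n : nat) :
  (0 < n)%N -> (forall i, v (i + n%:Z) = v i) -> continuous (pl v).
Proof.
move=> n0 per.
have [|L _ vL] := @pl_bound V (fun i => v (i + 1) - v i) n n0.
  by move=> i; rewrite addrAC !per.
exact/lip_continuous/pl_lip/vL.
Qed.

End PiecewiseLinear.

(** * Simple closed polygons and the knot types they represent *)

Section SimplePolygons.
Variable R : realType.
Implicit Types (s t u c : R) (i j k : int) (n : nat) (v w : int -> R3 R).

Definition simple n v := [/\ (2 < n)%N, forall i, v (i + n%:Z) = v i
  & forall s t, pl v s = pl v t -> exists k : int, s = t + k%:~R * n%:R].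

Definition interp s v w i := (1 - s) *: v i + s *: w i.

Lemma interp_periodic s n v w : (forall i, v (i + n%:Z) = v i) ->
  (forall i, w (i + n%:Z) = w i) ->
  forall i, interp s v w (i + n%:Z) = interp s v w i.
Proof. by move=> pv pw i; rewrite /interp pv pw. Qed.

Lemma interp0 v w : interp 0 v w = v.
Proof. by apply/funext => i; rewrite /interp subr0 scale1r scale0r addr0. Qed.

Lemma interp1 v w : interp 1 v w = w.
Proof. by apply/funext => i; rewrite /interp subrr scale1r scale0r add0r. Qed.

Lemma pl_sub v w t : pl (fun i => w i - v i) t = pl w t - pl v t.
Proof.
rewrite /pl; set i := Num.floor t; set a := t - _.
have -> : w (i + 1) - v (i + 1) - (w i - v i) =
    (w (i + 1) - w i) - (v (i + 1) - v i) by rewrite !opprD !opprK addrACA.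
by rewrite scalerBr [- (v i + _)]opprD addrACA.
Qed.

Lemma simple_gt0 n v : simple n v -> 0 < n%:R :> R.
Proof. by case=> n2 _ _; rewrite ltr0n; lia. Qed.

Lemma simple_loop n v : simple n v -> loop n%:R (pl v).
Proof.
move=> [n2 per inj]; split=> //.
  by apply: (@pl_continuous _ _ _ n) => //; lia.
by move=> t; exact: pl_periodic.
Qed.

Lemma compact_pos_bound (T : topologicalType) (A : set T) (f : T -> R) :
  A !=set0 -> compact A -> continuous f -> (forall x, A x -> 0 < f x) ->
  exists2 m, 0 < m & forall x, A x -> m <= f x.
Proof.
move=> A0 cA cf fpos.
have [c /set_mem Ac mc] := compact_EVT_min A0 cA (continuous_subspaceT cf).
by exists (f c); [exact: fpos|move=> x Ax; apply: mc; rewrite inE].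
Qed.

(** Compactness bounds the chords of parameter length between one and half the
    period from below, uniformly in the family; shorter chords are homothetic to
    chords of length one by [pl_chord]. *)
Lemma simple_family_chord n v w :
  (forall s, 0 <= s <= 1 -> simple n (interp s v w)) ->
  exists2 c, 0 < c & forall s, 0 <= s <= 1 -> forall a b, `|a - b| <= n%:R / 2 ->
    c * `|a - b| <= `|pl (interp s v w) a - pl (interp s v w) b|.
Proof.
move=> sim.
have [n2 pv _] : simple n v by rewrite -(interp0 v w); apply: sim; rewrite lexx ler01.
have [_ pw _] : simple n w by rewrite -(interp1 v w); apply: sim; rewrite lexx ler01.
have n2R : 2 < n%:R :> R by rewrite ltr_nat.
pose p s := pl (interp s v w).
have pE s t : p s t = (1 - s) *: pl v t + s *: pl w t by exact: pl_interp.
pose B : set (R * (R * R)) := `[0, 1] `*` (`[0, n%:R] `*` `[1, n%:R / 2]).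
pose f (x : R * (R * R)) := `|p x.1 (x.2.1 + x.2.2) - p x.1 x.2.1|.
have Bne : B !=set0.
  exists (0, (0, 1)); rewrite /B /=; split; [|split] => /=; rewrite in_itv /=; lra.
have Bc : compact B.
  by apply: compact_setX; [|apply: compact_setX]; exact: segment_compact.
have cv : continuous (pl v) by apply: (@pl_continuous _ _ _ n) => //; lia.
have cw : continuous (pl w) by apply: (@pl_continuous _ _ _ n) => //; lia.
have c1 : continuous (fun x : R * (R * R) => x.1) by move=> x; exact: cvg_fst.
have c21 : continuous (fun x : R * (R * R) => x.2.1).
  by move=> x; apply: continuous_comp; [exact: cvg_snd|exact: cvg_fst].
have c22 : continuous (fun x : R * (R * R) => x.2.2).
  by move=> x; apply: continuous_comp; [exact: cvg_snd|exact: cvg_snd].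
have c1' : continuous (fun x : R * (R * R) => 1 - x.1).
  by move=> x; apply: cvgB; [exact: cvg_cst|exact: c1].
have cs : continuous (fun x : R * (R * R) => x.2.1 + x.2.2).
  by move=> x; apply: cvgD; [exact: c21|exact: c22].
have fc : continuous f.
  move=> x; apply: cvg_norm; rewrite !pE.
  under eq_fun do rewrite !pE.
  have compc (q : R -> R3 R) (g : R * (R * R) -> R) : continuous q ->
      continuous g -> continuous (fun x => q (g x)).
    by move=> cq cg y; apply: continuous_comp; [exact: cg|exact: cq].
  apply: cvgB; apply: cvgD; apply: cvgZ; by
    [exact: c1'|exact: c1|exact: compc cv cs x|exact: compc cv c21 x
    |exact: compc cw cs x|exact: compc cw c21 x].
have [m m0 mf] : exists2 m, 0 < m & forall x, B x -> m <= f x.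
  apply: compact_pos_bound => // -[s [a u]] [/=].
  rewrite in_itv /= => s01 [/=]; rewrite !in_itv /= => /andP[a0 an] /andP[u1 un].
  rewrite /f /= normr_gt0 subr_eq0; apply/eqP => e.
  have [_ _ inj] := sim s s01.
  have [k ek] := inj _ _ e.
  have uk : u = k%:~R * n%:R by lra.
  have k0 : 0 < k.
    rewrite ltNge; apply/negP => k0.
    have u0 : u <= 0 by rewrite uk mulr_le0_ge0 ?lerz0.
    by move: u0; rewrite leNgt; apply/negP/negPn; exact: lt_le_trans u1.
  have : 1 <= k%:~R :> R by rewrite ler1z; lia.
  rewrite -(@ler_pM2r _ n%:R); last by lra.
  by rewrite mul1r -uk; lra.
have key s a u : 0 <= s <= 1 -> 1 <= u <= n%:R / 2 -> m <= `|p s (a + u) - p s a|.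
  move=> s01 u1.
  have [_ per _] := sim s s01.
  have n0 : 0 < n%:R :> R by lra.
  have [r /andP[r0 rn] [k ->]] := floor_period a n0.
  rewrite [r + _ + u]addrAC /p !(periodicMz _ _ (fun t => pl_periodic t per)).
  apply: (mf (s, (r, u))); split => /=; first by rewrite in_itv.
  by split => /=; rewrite in_itv /=; [rewrite r0 ltW|].
pose c := 2 * m / n%:R.
have c0 : 0 < c by rewrite divr_gt0 ?mulr_gt0//; lra.
have cm : c <= m by rewrite /c ler_pdivrMr; [rewrite mulrC ler_pM2l//; lra|lra].
exists c => // s s01.
suff H a u : 0 <= u -> u <= n%:R / 2 -> c * u <= `|p s (a + u) - p s a|.
  move=> a b; wlog ba : a b / b <= a => [h|].
    have [ba|/ltW ab] := leP b a; first exact: h.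
    by rewrite distrC [X in _ -> _ <= X]distrC; exact: h.
  have ab0 : 0 <= a - b by rewrite subr_ge0.
  rewrite (ger0_norm ab0) => ab; have := H b (a - b) ab0 ab.
  by rewrite [b + _]addrC subrK.
move=> u0 un; have [u1|u1] := leP u 1; last first.
  apply: le_trans (key s a u s01 _); last by lra.
  by rewrite /c mulrAC ler_pdivrMr; [nra|lra].
have [s' ->] := pl_chord (interp s v w) a u0 u1.
rewrite normrZ ger0_norm// mulrC ler_wpM2l// (le_trans cm)//.
by apply: key => //; lra.
Qed.

Lemma simple_chord n v : simple n v ->
  exists2 c, 0 < c & forall a b, `|a - b| <= n%:R / 2 ->
    c * `|a - b| <= `|pl v a - pl v b|.
Proof.
move=> sv; have vv s : interp s v v = v.
  by apply/funext => i; rewrite /interp -scalerDl subrK scale1r.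
have [|c c0 cP] := @simple_family_chord n v v; first by move=> s _; rewrite vv.
exists c => // a b ab; have := cP 0; rewrite vv; apply => //.
by rewrite lexx ler01.
Qed.

Section KnotType.
Variable K : set (oriented_set R).
Hypothesis typeK : oriented_knot_type K.

Definition represents n v := simple n v /\ K (knot_of n%:R (pl v)).

(** Moving the vertices by at most [e] changes the path by a [2 * e]-Lipschitz
    displacement, which is small against the bound for chords. *)
Lemma represents_perturb n v : represents n v ->
  exists2 e, 0 < e & forall w, (forall i, w (i + n%:Z) = w i) ->
    (forall i, `|w i - v i| <= e) -> represents n w.
Proof.
move=> [sv Kv]; have [c c0 cP] := simple_chord sv.
exists (c / 4) => [|w pw wv]; first by rewrite divr_gt0.
have n0 := simple_gt0 sv.
have [lw iw] : loop n%:R (pl w) /\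
    ambient_isotopic (knot_of n%:R (pl v)) (knot_of n%:R (pl w)).
  apply: (@lip_perturbation _ _ c (c / 2)) => //.
  - exact: simple_loop.
  - by move=> t; exact: pl_periodic.
  - by rewrite divr_ge0// ltW.
  - by lra.
  - move=> s t; rewrite -!pl_sub; apply: pl_lip => i.
    rewrite (le_trans (ler_normB _ _))//.
    by have := wv i; have := wv (i + 1); lra.
split; last exact: (oriented_knot_type_ambient typeK n0 lw iw Kv).
have [n2 _ _] := sv.
by case: lw.
Qed.

Lemma represents_translate n v e : represents n v ->
  represents n (fun i => v i + e).
Proof.
move=> [sv Kv]; have [c c0 cP] := simple_chord sv.
have n0 := simple_gt0 sv.
have [n2 pv _] := sv.
have pe t : pl (fun i => v i + e) t = pl v t + e.
  rewrite /pl; set i := Num.floor t; set a := t - _.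
  by rewrite [- (v i + e)]opprD addrACA subrr addr0 addrAC.
have pw i : v (i + n%:Z) + e = v i + e by rewrite pv.
have [lw iw] : loop n%:R (pl (fun i => v i + e)) /\ ambient_isotopic
    (knot_of n%:R (pl v)) (knot_of n%:R (pl (fun i => v i + e))).
  apply: (@lip_perturbation _ _ c 0) => //.
  - exact: simple_loop.
  - by move=> t; exact: pl_periodic.
  - by move=> s t; rewrite !pe ![_ + e]addrC !addrK subrr normr0 mul0r.
split; last exact: (oriented_knot_type_ambient typeK n0 lw iw Kv).
by case: lw.
Qed.

(** The bound for chords is uniform along the motion, so the motion can be cut
    into steps so short that each of them is a small perturbation of the polygon
    at which it starts. *)
Lemma represents_linear n v w :
  (forall s, 0 <= s <= 1 -> simple n (interp s v w)) ->
  represents n v -> represents n w.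
Proof.
move=> sim [sv Kv]; have [c c0 cP] := simple_family_chord sim.
have sw : simple n w by rewrite -(interp1 v w); apply: sim; rewrite lexx ler01.
split=> //.
have n0 := simple_gt0 sv.
have [n2 pv _] := sv; have [_ pw _] := sw.
have n_gt0 : (0 < n)%N by lia.
have [|L L0 LP] := @pl_bound _ _ (fun i => w i - v i) n n_gt0.
  by move=> i; rewrite pv pw.
have dL a b : `|(pl w a - pl v a) - (pl w b - pl v b)| <= (2 * L) * `|a - b|.
  rewrite -!pl_sub; apply: pl_lip => i.
  rewrite (le_trans (ler_normB _ _))//.
  by have := LP i; have := LP (i + 1); lra.
pose N := (Num.truncn (2 * L / c)).+1.
have NL : 2 * L / c < N%:R by exact: truncnS_gt.
have N0 : 0 < N%:R :> R by rewrite ltr0n.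
suff H (k : nat) : (k <= N)%N ->
    K (knot_of n%:R (pl (interp (k%:R / N%:R) v w))).
  by have := H N (leqnn _); rewrite divff ?gt_eqF// interp1.
elim: k => [|k IH] kN; first by rewrite mul0r interp0.
have s01 (j : nat) : (j <= N)%N -> 0 <= (j%:R / N%:R : R) <= 1.
  move=> jN; apply/andP; split; first by rewrite divr_ge0// ler0n.
  by rewrite ler_pdivrMr// mul1r ler_nat.
have sk := sim _ (s01 k (ltnW kN)); have sk1 := sim _ (s01 _ kN).
have [lw iw] : loop n%:R (pl (interp (k.+1%:R / N%:R) v w)) /\
    ambient_isotopic (knot_of n%:R (pl (interp (k%:R / N%:R) v w)))
      (knot_of n%:R (pl (interp (k.+1%:R / N%:R) v w))).
  apply: (@lip_perturbation _ _ c (2 * L / N%:R)) => //.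
  - exact: simple_loop.
  - by move=> a b ab; apply: cP => //; apply: s01; exact: ltnW.
  - by have [] := simple_loop sk1.
  - by rewrite divr_ge0// mulr_ge0.
  - by rewrite ltr_pdivrMr// [c * _]mulrC -ltr_pdivrMr.
  - have e t : pl (interp (k.+1%:R / N%:R) v w) t - pl (interp (k%:R / N%:R) v w) t
        = N%:R^-1 *: (pl w t - pl v t).
      rewrite !pl_interp -natr1 mulrDl mul1r; set a := k%:R / _; set b := _^-1.
      rewrite [- ((1 - a) *: _ + _)]opprD addrACA -!scalerBl scalerBr [RHS]addrC -scaleNr.
      have -> : 1 - (a + b) - (1 - a) = - b by ring.
      by have -> : a + b - a = b by ring.
    move=> a b; rewrite !e -scalerBr normrZ gtr0_norm ?invr_gt0//.
    by rewrite [leRHS]mulrAC [leRHS]mulrC ler_pM2l ?invr_gt0.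
exact: (oriented_knot_type_ambient typeK n0 lw iw (IH (ltnW kN))).
Qed.

Lemma represents_rot n v k : represents n v -> represents n (fun i => v (i + k)).
Proof.
move=> [[n2 pv inj] Kv].
have e : pl (fun i => v (i + k)) = pl v \o (fun t => t + k%:~R).
  by apply/funext => t; rewrite pl_shift.
have n0 : 0 < n%:R :> R by rewrite ltr0n; lia.
split; last by rewrite e (knot_of_reparam _ n0 n0 (reparam_shift _ _)).
split=> //; first by move=> i; rewrite addrAC pv.
by move=> s t; rewrite !pl_shift => /inj[l el]; exists l; lra.
Qed.

(** The vertices of the same polygon with every edge cut into [M] equal parts. *)
Definition refine (M : nat) v j := pl v (j%:~R / M%:R).

Lemma pl_refine (M : nat) v t : (0 < M)%N ->
  pl (refine M v) t = pl v (t / M%:R).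
Proof.
move=> M0; have MR : 0 < M%:R :> R by rewrite ltr0n.
have [j tj jt] := floorP t.
rewrite (@plE _ _ _ j)// ?ltW// /refine.
pose i := (j %/ M%:Z)%Z.
have Mnz : M%:Z != 0 by lia.
have ij : i * M%:Z <= j by rewrite lez_floor.
have ji : j + 1 <= (i + 1) * M%:Z by have := ltz_ceil j (_ : 0 < M%:Z); lia.
have h1 : i%:~R <= j%:~R / M%:R :> R.
  by rewrite ler_pdivlMr// pmulrn -intrM ler_int.
have h2 : (j + 1)%:~R / M%:R <= i%:~R + 1 :> R.
  by rewrite ler_pdivrMr// pmulrn -intrD1 -intrM ler_int.
have h3 : j%:~R / M%:R <= t / M%:R by rewrite ler_pM2r// invr_gt0.
have h4 : t / M%:R <= (j + 1)%:~R / M%:R.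
  by rewrite ler_pM2r ?invr_gt0// intrD1 ltW.
have h5 : j%:~R / M%:R <= (j + 1)%:~R / M%:R :> R by exact: le_trans h4.
rewrite (@plE _ _ v i (t / M%:R)); [|lra|lra].
rewrite (@plE _ _ v i (j%:~R / M%:R)); [|lra|lra].
rewrite (@plE _ _ v i ((j + 1)%:~R / M%:R)); [|lra|lra].
set D := v (i + 1) - v i; rewrite opprD addrACA subrr add0r -scalerBl scalerA.
rewrite -addrA -scalerDl; congr (_ + _ *: _); rewrite intrD1.
by field; rewrite gt_eqF.
Qed.

Lemma represents_refine n v (M : nat) : (0 < M)%N -> represents n v ->
  represents (n * M) (refine M v).
Proof.
move=> M0 [[n2 pv inj] Kv].
have MR : 0 < M%:R :> R by rewrite ltr0n.
have n0 : 0 < n%:R :> R by rewrite ltr0n; lia.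
have nM0 : 0 < (n * M)%:R :> R by rewrite ltr0n muln_gt0; lia.
have nME : (n * M)%:R = n%:R * M%:R :> R by rewrite natrM.
have e : pl (refine M v) = pl v \o (fun t => t * (n%:R / (n * M)%:R)).
  apply/funext => t; rewrite pl_refine//= nME; congr pl.
  by field; rewrite !gt_eqF.
split; last by rewrite e (knot_of_reparam _ nM0 n0 (reparam_scale nM0 n0)).
split; first by nia.
  move=> i; rewrite /refine intrD -pmulrn nME mulrDl mulfK ?gt_eqF//.
  exact: pl_periodic.
move=> s t; rewrite !pl_refine// => /inj[k ek]; exists k.
rewrite nME -[s](divfK (lt0r_neq0 MR)) ek mulrDl divfK ?gt_eqF//.
by rewrite mulrA.
Qed.

End KnotType.
End SimplePolygons.

(** * Loops made of straight pieces *)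

Section StraightPieces.
Variable R : realType.
Implicit Types (s t T : R) (i j k : int) (n : nat).

Section Cells.
Variable tau : int -> R.
Hypothesis tau_inc : forall i, tau i < tau (i + 1).

Lemma cells_lt i j : i < j -> tau i < tau j.
Proof.
move=> ij; have -> : j = i + (absz (j - i - 1)%R).+1%:Z by lia.
elim: (absz _) => [|m IH]; first exact: tau_inc.
by apply: (lt_trans IH); rewrite [m.+2%:Z]intS [1 + _]addrC addrA; exact: tau_inc.
Qed.

Lemma cells_le i j : i <= j -> tau i <= tau j.
Proof. by rewrite le_eqVlt => /orP[/eqP ->|/cells_lt/ltW]. Qed.

Lemma cells_unique i j t : tau i <= t -> t < tau (i + 1) ->
  tau j <= t -> t < tau (j + 1) -> i = j.
Proof.
move=> i1 i2 j1 j2; apply/eqP; rewrite eq_le; apply/andP; split.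
  rewrite leNgt; apply/negP => ji.
  have h : j + 1 <= i by lia.
  by have := cells_le h; lra.
rewrite leNgt; apply/negP => ij.
have h : i + 1 <= j by lia.
by have := cells_le h; lra.
Qed.

Variables (n : nat) (T : R).
Hypothesis n0 : (0 < n)%N.
Hypothesis tau_per : forall i, tau (i + n%:Z) = tau i + T.

Lemma cells_period_gt0 : 0 < T.
Proof.
have : tau 0 < tau (0 + n%:Z) by apply: cells_lt; lia.
by rewrite tau_per ltrDl.
Qed.

Lemma cells_perMz i (m : int) : tau (i + m * n%:Z) = tau i + m%:~R * T.
Proof.
have H (l : nat) j : tau (j + l%:Z * n%:Z) = tau j + l%:R * T.
  elim: l => [|l IH]; first by rewrite !mul0r !addr0.
  by rewrite intS !mulrDl !mul1r [n%:Z + _]addrC addrA tau_per IH -natr1 mulrDl mul1r addrA.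
case: m => l; first exact: H.
rewrite NegzE mulNr mulrNz mulNr -[in RHS](subrK (l.+1%:Z * n%:Z) i) H.
by rewrite -pmulrn addrK.
Qed.

(** The cells of one period are searched in order. *)
Lemma cells_exist t : exists2 i, tau i <= t & t < tau (i + 1).
Proof.
have T0 := cells_period_gt0.
have [k k1 k2] := floorP ((t - tau 0) / T).
have h1 : tau (k * n%:Z) <= t.
  rewrite -[k * _]add0r cells_perMz.
  by move: k1; rewrite ler_pdivlMr// lerBrDl.
have h2 : t < tau (k * n%:Z + n%:Z).
  rewrite tau_per -[k * _]add0r cells_perMz -addrA.
  by move: k2; rewrite ltr_pdivrMr// ltrBlDl mulrDl mul1r.
move: h1 h2; move: (k * _) => b; move: n => m.
elim: m => [|m IH] h1 h2; first by rewrite addr0 ltNge h1 in h2.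
have [h3|h3] := ltP t (tau (b + m%:Z)); first exact: IH.
by exists (b + m%:Z) => //; move: h2; rewrite intS [1 + _]addrC addrA.
Qed.

End Cells.

(** Continuity comes for free: the glued map is increasing and onto. *)
Lemma glue_reparam n T T' (tau ups : int -> R) (f : int -> R -> R) :
  (0 < n)%N -> (forall i, tau i < tau (i + 1)) ->
  (forall i, tau (i + n%:Z) = tau i + T) ->
  (forall i, ups (i + n%:Z) = ups i + T') ->
  (forall i s t, tau i <= s -> s < t -> t < tau (i + 1) -> f i s < f i t) ->
  (forall i t, tau i <= t -> t < tau (i + 1) -> ups i <= f i t < ups (i + 1)) ->
  (forall i y, ups i <= y -> y < ups (i + 1) ->
     exists2 t, tau i <= t < tau (i + 1) & f i t = y) ->
  (forall i t, tau i <= t -> t < tau (i + 1) ->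
     f (i + n%:Z) (t + T) = f i t + T') ->
  exists2 phi, reparam T T' phi &
    forall i t, tau i <= t -> t < tau (i + 1) -> phi t = f i t.
Proof.
move=> n0 tau_inc tau_per ups_per f_inc f_in f_onto f_per.
have ups_inc i : ups i < ups (i + 1).
  by have /andP[h1 h2] := f_in i (tau i) (lexx _) (tau_inc i); exact: le_lt_trans h2.
have /choice[idx idxP] : forall t, exists i, tau i <= t /\ t < tau (i + 1).
  by move=> t; have [i i1 i2] := cells_exist tau_inc n0 tau_per t; exists i.
have idxE i t : tau i <= t -> t < tau (i + 1) -> idx t = i.
  move=> i1 i2; have [j1 j2] := idxP t.
  exact: (cells_unique tau_inc j1 j2 i1 i2).
exists (fun t => f (idx t) t); last by move=> i t i1 i2; rewrite (idxE i).
have inc : {homo (fun t => f (idx t) t) : s t / s < t}.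
  move=> s t st /=; have [s1 s2] := idxP s; have [t1 t2] := idxP t.
  have [ij|ij|e] := ltgtP (idx s) (idx t).
  - have /andP[_ h1] := f_in _ _ s1 s2; have /andP[h2 _] := f_in _ _ t1 t2.
    apply: (lt_le_trans h1); apply: le_trans h2.
    by apply: (cells_le ups_inc); lia.
  - have h : idx t + 1 <= idx s by lia.
    by have := cells_le tau_inc h; lra.
  - by rewrite e; apply: f_inc => //; rewrite -e.
split=> //.
- apply: increasing_surj_continuous => // y.
  have [j j1 j2] := cells_exist ups_inc n0 ups_per y.
  by have [t /andP[t1 t2] ft] := f_onto _ _ j1 j2; exists t; rewrite (idxE j).
- move=> t; have [t1 t2] := idxP t.
  rewrite (idxE (idx t + n%:Z) (t + T)) ?f_per ?tau_per ?lerD2r//.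
  by rewrite addrAC tau_per ltrD2r.
Qed.

(** A coordinate of space in which the two points differ, rescaled. *)
Lemma segment_coordinate (a b : R3 R) : a <> b ->
  exists2 l : R3 R -> R, continuous l & forall c, l (a + c *: (b - a)) = c.
Proof.
move=> ab.
have [h|/eqP h1] := eqVneq a.1.1 b.1.1; last first.
  exists (fun v => (v.1.1 - a.1.1) / (b.1.1 - a.1.1)).
    move=> v; apply: cvgMl; apply: cvgB; last exact: cvg_cst.
    by apply: (@continuous_comp _ _ _ fst fst); exact: cvg_fst.
  move=> c; rewrite (_ : (a + c *: (b - a)).1.1 = a.1.1 + c * (b.1.1 - a.1.1))//.
  rewrite addrAC subrr add0r mulfK//.
  by rewrite subr_eq0 eq_sym; apply/eqP.
have [h2|/eqP h2] := eqVneq a.1.2 b.1.2; last first.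
  exists (fun v => (v.1.2 - a.1.2) / (b.1.2 - a.1.2)).
    move=> v; apply: cvgMl; apply: cvgB; last exact: cvg_cst.
    by apply: (@continuous_comp _ _ _ fst snd); [exact: cvg_fst|exact: cvg_snd].
  move=> c; rewrite (_ : (a + c *: (b - a)).1.2 = a.1.2 + c * (b.1.2 - a.1.2))//.
  rewrite addrAC subrr add0r mulfK//.
  by rewrite subr_eq0 eq_sym; apply/eqP.
exists (fun v => (v.2 - a.2) / (b.2 - a.2)).
  move=> v; apply: cvgMl; apply: cvgB; last exact: cvg_cst.
  exact: cvg_snd.
move=> c; rewrite (_ : (a + c *: (b - a)).2 = a.2 + c * (b.2 - a.2))//.
  rewrite addrAC subrr add0r mulfK//.
rewrite subr_eq0; apply/eqP => h3; apply: ab.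
by case: a b h h2 h3 => [[? ?] ?] [[? ?] ?] /= -> -> ->.
Qed.

Lemma loop_inj_short T (p : R -> R3 R) s t : loop T p -> p s = p t ->
  `|s - t| < T -> s = t.
Proof.
move=> [_ _ inj] /inj[k ->]; rewrite addrAC subrr add0r normrM => h.
have T0 : 0 < T by apply: le_lt_trans h; rewrite mulr_ge0.
rewrite (gtr0_norm T0) gtr_pMl// in h.
have k0 : k = 0.
  have : `|k|%:~R < 1 :> R by rewrite intr_norm.
  by rewrite (ltr_int R _ 1); lia.
by rewrite k0 mul0r addr0.
Qed.

(** The position of [p t] on its line is a continuous injective function of [t],
    hence monotone, so the loop runs through each of its straight pieces exactly
    once, as the polygon does. *)
Lemma loop_straight_pieces n T (p : R -> R3 R) (tau : int -> R) :
  (1 < n)%N -> loop T p -> (forall i, tau i < tau (i + 1)) ->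
  (forall i, tau (i + n%:Z) = tau i + T) ->
  (forall i t, tau i <= t <= tau (i + 1) -> exists c,
     p t = p (tau i) + c *: (p (tau (i + 1)) - p (tau i))) ->
  exists2 phi, reparam T n%:R phi & p = pl (p \o tau) \o phi.
Proof.
move=> n1 lp tau_inc tau_per straight.
have n0 : (0 < n)%N by lia.
have short i : tau (i + 1) < tau i + T.
  by rewrite -tau_per; apply: cells_lt => //; lia.
have injp i s t : tau i <= s <= tau (i + 1) -> tau i <= t <= tau (i + 1) ->
    p s = p t -> s = t.
  move=> s1 t1 e; apply: (loop_inj_short lp e).
  by have := short i; rewrite ltr_norml; lra.
have neq i : p (tau i) <> p (tau (i + 1)).
  move=> e; have := tau_inc i.
  by rewrite (injp i _ _ _ _ e) ?ltxx// ?lexx ltW//.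
have /choice[l lP] : forall i, exists l : R3 R -> R, continuous l /\
    forall c, l (p (tau i) + c *: (p (tau (i + 1)) - p (tau i))) = c.
  move=> i; by have [li lc lE] := segment_coordinate (neq i); exists li.
have pE i t : tau i <= t <= tau (i + 1) ->
    p t = p (tau i) + l i (p t) *: (p (tau (i + 1)) - p (tau i)).
  by move=> ti; have [c ->] := straight i t ti; rewrite (lP i).2.
have l0 i : l i (p (tau i)) = 0.
  by have := (lP i).2 0; rewrite scale0r addr0.
have l1 i : l i (p (tau (i + 1))) = 1.
  by have := (lP i).2 1; rewrite scale1r addrC subrK.
have cl i : continuous (l i \o p).
  by move=> t; apply: continuous_comp; [case: lp => + _ _; exact|exact: (lP i).1].
have mono i s t : s \in `[tau i, tau (i + 1)] -> t \in `[tau i, tau (i + 1)] ->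
    (l i (p s) <= l i (p t)) = (s <= t).
  apply: (@itv_continuous_inj_le _ (l i \o p) `[tau i, tau (i + 1)]).
  - have h := ltW (tau_inc i); exists (tau i), (tau (i + 1)).
    by split; rewrite ?in_itv /= ?lexx ?h// l0 l1 ler01.
  - exact: continuous_subspaceT.
  - move=> x y; rewrite !in_itv /= => xi yi e; apply: (injp i) => //.
    by rewrite (pE i x)// (pE i y)// e.
have monol i s t : s \in `[tau i, tau (i + 1)] -> t \in `[tau i, tau (i + 1)] ->
    (l i (p s) < l i (p t)) = (s < t).
  by move=> si ti; rewrite !ltNge mono.
have [phi rphi phiE] : exists2 phi, reparam T n%:R phi & forall i t,
    tau i <= t -> t < tau (i + 1) -> phi t = i%:~R + l i (p t).
  apply: (@glue_reparam n T n%:R tau intr) => //.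
  - by move=> i; rewrite intrD.
  - by move=> i s t s1 st t1; rewrite ltrD2l monol// in_itv /=; lra.
  - move=> i t t1 t2; rewrite lerDl intrD1 ltrD2l -(l0 i) -{1}(l1 i).
    by rewrite mono ?monol// ?t1 ?t2// in_itv /= ?lexx; have := tau_inc i; lra.
  - move=> i y; rewrite intrD1 => y1 y2.
    have [|||c ci /= cy] := @IVT R (l i \o p) (tau i) (tau (i + 1)) (y - i%:~R).
    + exact: ltW.
    + exact: continuous_subspaceT.
    + by rewrite /= l0 l1 min_l ?max_r//; lra.
    exists c; last by rewrite cy addrC subrK.
    move: ci; rewrite in_itv /= => /andP[-> /=]; rewrite le_eqVlt => /orP[/eqP e|//].
    by move: cy; rewrite e l1; lra.
  - move=> i t t1 t2; have [_ pper _] := lp.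
    suff -> : l (i + n%:Z) (p (t + T)) = l i (p t) by rewrite intrD addrAC.
    have h1 : tau i <= t <= tau (i + 1) by rewrite t1 ltW.
    have h2 : tau (i + n%:Z) <= t + T <= tau (i + n%:Z + 1).
      by rewrite tau_per [i + _ + 1]addrAC tau_per !lerD2r.
    have := pE _ _ h2; rewrite tau_per [i + _ + 1]addrAC tau_per !pper.
    rewrite {1}(pE i t h1) => /addrI/eqP; rewrite -subr_eq0 -scalerBl scaler_eq0.
    rewrite !subr_eq0 => /orP[/eqP ->//|/eqP/esym/neq[]].
exists phi => //; apply/funext => t /=.
have [i i1 i2] := cells_exist tau_inc n0 tau_per t.
have ti : tau i <= t <= tau (i + 1) by rewrite i1 ltW.
rewrite (phiE i)// (@plE _ _ _ i); last 2 first.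
- by rewrite lerDl -(l0 i) mono ?in_itv /= ?lexx//; exact: ltW.
- by rewrite lerD2l -(l1 i) mono ?in_itv /= ?lexx ?andbT//; exact: ltW.
by rewrite [i%:~R + _]addrC addrK /=; exact: pE.
Qed.

End StraightPieces.

(** * Polygons given by lists of vertices *)

Section VertexLists.
Variable R : realType.
Local Notation "s `_ i" := (@nth (R3 R) 0 s i) : ring_scope.
Implicit Types (t T : R) (i : int) (n : nat).

(** Indices are read modulo the size; on the empty list all values are the
    default [0]. *)
Definition vtx (s : seq (R3 R)) i : R3 R :=
  s`_(absz (i %% (size s)%:Z)%Z).

Lemma vtx_periodic (s : seq (R3 R)) i : vtx s (i + (size s)%:Z) = vtx s i.
Proof. by rewrite /vtx modzDr. Qed.

Lemma vtx_nat (s : seq (R3 R)) (j : nat) :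
  (j < size s)%N -> vtx s j%:Z = s`_j.
Proof. by move=> js; rewrite /vtx modz_small//; lia. Qed.

Lemma vtx_size (s : seq (R3 R)) : vtx s (size s)%:Z = s`_0.
Proof. by rewrite /vtx modzz. Qed.

Lemma vtx_rot (s : seq (R3 R)) (k : nat) :
  (k <= size s)%N -> vtx (rot k s) = (fun i => vtx s (i + k%:Z)).
Proof.
move=> ks; apply/funext => i; rewrite /vtx size_rot.
have [s0|s0] := posnP (size s); first by rewrite !nth_default ?size_rot ?s0.
have n0 : (size s)%:Z != 0 by lia.
set n := (size s)%:Z; pose j := absz (i %% n)%Z.
have jE : (i %% n)%Z = j%:Z by rewrite /j gez0_abs ?modz_ge0.
have jn : (j < size s)%N by have := @ltz_pmod i n; rewrite jE; lia.
rewrite -modzDml jE /= /rot nth_cat size_drop ltn_subRL addnC.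
have [h|h] := ltnP (j + k) (size s).
  by rewrite nth_drop addnC modz_small//; lia.
rewrite nth_take; last by lia.
have -> : (j%:Z + k%:Z)%R = (j - (size s - k))%N%:Z + n by lia.
by rewrite modzDr modz_small//; lia.
Qed.

Lemma vtx_mkseq (v : int -> R3 R) n : (0 < n)%N ->
  (forall i, v (i + n%:Z) = v i) -> vtx (mkseq (fun j => v j%:Z) n) = v.
Proof.
move=> n0 per; apply/funext => i; rewrite /vtx size_mkseq.
by have [jn ->] := periodic_mod i n0 per; rewrite nth_mkseq.
Qed.

Lemma pl_subsegment (V : lmodType R) (v : int -> V) i (a b t : R) :
  i%:~R <= a -> a <= t -> t <= b -> b <= i%:~R + 1 -> a < b ->
  pl v t = pl v a + ((t - a) / (b - a)) *: (pl v b - pl v a).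
Proof.
move=> ia at_ tb bi ab; rewrite (@plE _ _ v i t); [|lra|lra].
rewrite (@plE _ _ v i a); [|lra|lra].
rewrite (@plE _ _ v i b); [|lra|lra].
set D := v (i + 1) - v i.
rewrite opprD addrACA subrr add0r -scalerBl scalerA -addrA -scalerDl.
congr (_ + _ *: _); rewrite opprB addrA subrK.
by rewrite divfK ?subr_eq0 ?gt_eqF//; lra.
Qed.

Section KnotType.
Variable K : set (oriented_set R).
Hypothesis typeK : oriented_knot_type K.

(** The subdivision of one period is extended periodically to the line. *)
Lemma represents_pieces n T (p : R -> R3 R) (tau : nat -> R) :
  (2 < n)%N -> loop T p -> K (knot_of T p) ->
  (forall j, (j < n)%N -> tau j < tau j.+1) -> tau n = tau 0%N + T ->
  (forall j t, (j < n)%N -> tau j <= t <= tau j.+1 -> exists c,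
     p t = p (tau j) + c *: (p (tau j.+1) - p (tau j))) ->
  represents K n (vtx (mkseq (p \o tau) n)).
Proof.
move=> n2 lp Kp tau_inc tau_n straight.
have nz : n%:Z != 0 by lia.
have [_ pper _] := lp.
pose sig i := tau (absz (i %% n%:Z)%Z) + (i %/ n%:Z)%Z%:~R * T.
have sigE (j : nat) (q : int) : (j <= n)%N -> sig (j%:Z + q * n%:Z) = tau j + q%:~R * T.
  rewrite leq_eqVlt => /orP[/eqP ->|jn].
    have -> : n%:Z + q * n%:Z = (q + 1) * n%:Z by lia.
    by rewrite /sig modzMl mulzK// tau_n intrD1 mulrDl mul1r addrA addrAC.
  rewrite [j%:Z + _]addrC /sig divzMDl// modzMDl modz_small; last by lia.
  by rewrite divz_small ?addr0//; lia.
have intE i : exists2 j : nat, (j < n)%N & exists q, i = j%:Z + q * n%:Z.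
  exists (absz (i %% n%:Z)%Z); first by have := @ltz_pmod i n%:Z; have := modz_ge0 i nz; lia.
  exists (i %/ n%:Z)%Z; rewrite gez0_abs ?modz_ge0// addrC; exact: divz_eq.
have sig_inc i : sig i < sig (i + 1).
  have [j jn [q ->]] := intE i.
  have -> : j%:Z + q * n%:Z + 1 = j.+1%:Z + q * n%:Z by lia.
  by rewrite !sigE ?(ltnW jn)// ltrD2r tau_inc.
have sig_per i : sig (i + n%:Z) = sig i + T.
  have [j jn [q ->]] := intE i.
  have -> : j%:Z + q * n%:Z + n%:Z = j%:Z + (q + 1) * n%:Z by lia.
  by rewrite !sigE ?(ltnW jn)// intrD1 mulrDl mul1r addrA.
have T0 : 0 < T by apply: (cells_period_gt0 sig_inc _ sig_per); lia.
have n0 : 0 < n%:R :> R by rewrite ltr0n; lia.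
have pP (t : R) (q : int) : p (t + q%:~R * T) = p t by exact: periodicMz.
have [|i t|phi rphi pE] := @loop_straight_pieces R n T p sig _ lp sig_inc sig_per.
- by lia.
- have [j jn [q ->]] := intE i.
  have -> : j%:Z + q * n%:Z + 1 = j.+1%:Z + q * n%:Z by lia.
  rewrite !sigE ?(ltnW jn)// !pP => tj.
  have [|c] := straight j (t - q%:~R * T) jn; first by lra.
  by rewrite -{2}[t](subrK (q%:~R * T)) pP; exists c.
have vE : p \o sig = vtx (mkseq (p \o tau) n).
  apply/funext => i; have [j jn [q ->]] := intE i.
  rewrite /= sigE ?(ltnW jn)// pP /vtx size_mkseq [j%:Z + _]addrC modzMDl modz_small; last by lia.
  by rewrite nth_mkseq.
rewrite -vE; split; last by rewrite -(knot_of_reparam _ T0 n0 rphi) -pE.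
split=> //; first by move=> i; rewrite /= sig_per pper.
move=> a b e; have [a' ea] := reparam_surj a T0 n0 rphi.
have [b' eb] := reparam_surj b T0 n0 rphi.
have [_ _ inj] := lp; have [_ _ phiper] := rphi.
have [|k ek] := inj a' b'; first by rewrite pE /= ea eb.
by exists k; rewrite -ea -eb ek (reparamMz _ _ phiper).
Qed.

(** Cutting the last edge in two changes the parametrization only. *)
Lemma represents_rcons (s : seq (R3 R)) (c : R) : 0 < c -> c < 1 ->
  represents K (size s) (vtx s) ->
  represents K (size s).+1 (vtx (rcons s (last (0 : R3 R) s + c *: (head (0 : R3 R) s - last (0 : R3 R) s)))).
Proof.
move=> c0 c1 [ss Ks]; have [n2 per _] := ss.
have [m ms] : exists m, size s = m.+1 by exists (size s).-1; lia.
pose tau (j : nat) : R :=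
  if (j <= m)%N then j%:R else if j == m.+1 then m%:R + c else m%:R + 1.
have tau_small j : (j <= m)%N -> tau j = j%:R by rewrite /tau => ->.
have tau_m1 : tau m.+1 = m%:R + c by rewrite /tau ltnn eqxx.
have tau_m2 : tau m.+2 = m%:R + 1.
  by rewrite /tau ifF ?ifF//; lia.
have vm : pl (vtx s) m%:R = last (0 : R3 R) s.
  by rewrite pmulrn pl_int vtx_nat ?ms// -nth_last ms.
have vm1 : pl (vtx s) (m%:R + 1) = head (0 : R3 R) s.
  by rewrite natr1 -ms pmulrn pl_int vtx_size nth0.
suff -> : rcons s (last (0 : R3 R) s + c *: (head (0 : R3 R) s - last (0 : R3 R) s)) =
    mkseq (pl (vtx s) \o tau) (size s).+1.
  apply: (@represents_pieces _ (size s)%:R) => //.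
  - by lia.
  - exact: simple_loop.
  - move=> j; rewrite ms ltnS leq_eqVlt ltnS => /orP[/eqP ->|].
      by rewrite tau_m1 tau_m2; lra.
    rewrite leq_eqVlt => /orP[/eqP ->|jm]; first by rewrite tau_m1 tau_small//; lra.
    by rewrite !tau_small// ?(ltnW jm)// ltr_nat.
  - by rewrite ms tau_m2 tau_small// add0r natr1.
  - move=> j t; rewrite ms ltnS leq_eqVlt ltnS => /orP[/eqP ->|].
      rewrite tau_m1 tau_m2 => /andP[t1 t2].
      exists ((t - (m%:R + c)) / (m%:R + 1 - (m%:R + c))).
      by apply: (@pl_subsegment _ _ m%:Z) => //; rewrite -?pmulrn; lra.
    rewrite leq_eqVlt => /orP[/eqP ->|jm].
      rewrite tau_m1 tau_small// => /andP[t1 t2].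
      exists ((t - m%:R) / (m%:R + c - m%:R)).
      by apply: (@pl_subsegment _ _ m%:Z) => //; rewrite -?pmulrn; lra.
    rewrite !tau_small// ?(ltnW jm)// -natr1 => /andP[t1 t2].
    exists ((t - j%:R) / (j%:R + 1 - j%:R)).
    by apply: (@pl_subsegment _ _ j%:Z) => //; rewrite -?pmulrn; lra.
apply: (@eq_from_nth _ 0); first by rewrite size_rcons size_mkseq.
move=> j; rewrite size_rcons ltnS leq_eqVlt => /orP[/eqP ->|js].
  rewrite nth_rcons ltnn eqxx nth_mkseq// ms /= tau_m1 -vm -vm1.
  rewrite [RHS](@pl_subsegment _ _ m%:Z m%:R (m%:R + 1)) -?pmulrn; [|lra..].
  have -> : m%:R + 1 - m%:R = 1 :> R by lra.
  have -> : m%:R + c - m%:R = c by lra.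
  by rewrite divr1.
rewrite nth_rcons js nth_mkseq; last by rewrite ltnS ltnW.
by rewrite /= tau_small; [rewrite pmulrn pl_int vtx_nat|rewrite -ltnS -ms].
Qed.

Lemma represents_rot_seq (s : seq (R3 R)) (k : nat) : (k <= size s)%N ->
  represents K (size s) (vtx s) -> represents K (size s) (vtx (rot k s)).
Proof. by move=> ks rs; rewrite vtx_rot//; exact: represents_rot. Qed.

End KnotType.
End VertexLists.

(** * Polygonal knots *)

Section Polygonal.
Variable R : realType.
Implicit Types (t T : R) (n : nat) (a b x y : R3 R).

(** This is the point [a] alone when the two points coincide. *)
Definition line a b : set (R3 R) := [set x | exists c, x = a + c *: (b - a)].

Lemma line_segment_sub a b x : line_segment a b x -> line a b x.
Proof.
move=> [c _ <-]; exists c.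
by rewrite scalerBl scale1r scalerBr addrA addrAC.
Qed.

Lemma point_closed x : closed [set x].
Proof.
exact: (@compact_closed (R3 R) [set x] (@norm_hausdorff R (R3 R)) (@compact_set1 _ x)).
Qed.

Lemma line_closed a b : closed (line a b).
Proof.
have [->|/eqP ab] := eqVneq a b.
  have -> : line b b = [set b].
    apply/seteqP; split=> [x [c ->]|x ->]; first by rewrite subrr scaler0 addr0.
    by exists 0; rewrite scale0r addr0.
  exact: point_closed.
have [l lc lE] := segment_coordinate ab.
have -> : line a b = (fun x => x - (a + l x *: (b - a))) @^-1` [set 0].
  apply/seteqP; split=> [x [c ->] /=|x /= /eqP]; first by rewrite lE subrr.
  by rewrite subr_eq0 => /eqP e; exists (l x).
apply: closed_comp => [x _|]; last first.
  exact: point_closed.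
apply: cvgB; first exact: cvg_id.
by apply: cvgD; [exact: cvg_cst|apply: cvgZl; exact: lc].
Qed.

Lemma line_segment_closed a b : closed (line_segment a b).
Proof.
apply: (@compact_closed (R3 R) _ (@norm_hausdorff R (R3 R))).
apply: continuous_compact; last exact: segment_compact.
apply: continuous_subspaceT => t; apply: cvgD; apply: cvgZl; last exact: cvg_id.
by apply: cvgB; [exact: cvg_cst|exact: cvg_id].
Qed.

Lemma line_two_points a b x y z : line a b x -> line a b y -> x <> y ->
  line x y z <-> line a b z.
Proof.
move=> [c1 ->] [c2 ->] xy.
have c12 : c2 - c1 != 0.
  by rewrite subr_eq0; apply/eqP => e; apply: xy; rewrite e.
have e : a + c2 *: (b - a) - (a + c1 *: (b - a)) = (c2 - c1) *: (b - a).
  by rewrite opprD addrACA subrr add0r -scalerBl.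
split=> -[c ->].
  by exists (c1 + c * (c2 - c1)); rewrite e scalerA -addrA -scalerDl.
exists ((c - c1) / (c2 - c1)).
by rewrite e scalerA divfK// -addrA -scalerDl [c1 + _]addrC subrK.
Qed.

Lemma closed_contains_itv (C : set R) t1 t2 t : closed C -> t1 < t2 ->
  (forall u, t1 < u < t2 -> C u) -> t1 <= t <= t2 -> C t.
Proof.
move=> cC t12 sub t_in; apply: contrapT => nCt.
have : nbhs t (~` C) by apply: open_nbhs_nbhs; split=> //; exact: closed_openC.
move=> /nbhs_ballP[e /= e0 eP].
pose m := (t1 + t2) / 2.
pose d := Num.min 1 (e / (`|m - t| + 1) / 2).
have m1 : 0 < `|m - t| + 1 by rewrite ltr_wpDl.
have d0 : 0 < d by rewrite lt_min ltr01 !divr_gt0.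
have d1 : d <= 1 by rewrite ge_min lexx.
apply: (eP (t + d * (m - t))); last first.
  by apply: sub; move: t_in; rewrite /m => /andP[]; nra.
rewrite /ball /= opprD addrA subrr add0r normrN normrM (gtr0_norm d0).
have : d <= e / (`|m - t| + 1) / 2 by rewrite ge_min lexx orbT.
rewrite ler_pdivlMr// ler_pdivlMr// => h.
by have := normr_ge0 (m - t); nra.
Qed.

(** For two of the given segments of which the second does not lie on the line
    [l] of the first, [l] meets the second in at most one point.  Cut the
    parameter interval at the finitely many parameters of these points.  On an
    open piece fix a segment that is met, with line [l]: the set of parameters
    sent to [l] is closed, and it is open because its complement there is the
    set of parameters sent to segments that do not lie on [l].  The piece being
    connected, all of it is sent to [l], and the polygon whose vertices are the
    images of the cutting points is a reparametrization of the knot. *)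
Lemma polygonal_represents (K : set (oriented_set R)) (p : R -> R3 R) :
  oriented_knot_type K -> loop (2 * pi) p -> K (knot_of (2 * pi) p) ->
  is_polygonal (range p) -> exists s, represents K (size s) (vtx s).
Proof.
move=> typeK lp Kp [S rp].
have cover v : exists2 ab, ab \in S & line_segment ab.1 ab.2 (p v).
  have : range p (p v) by exists v.
  by rewrite rp => -[ab abS h]; exists ab.
clear rp; have [pc pper pinj] := lp.
pose bad (ab cd : R3 R * R3 R) := ~ line_segment cd.1 cd.2 `<=` line ab.1 ab.2.
pose E (ab cd : R3 R * R3 R) x := bad ab cd /\ line ab.1 ab.2 x /\ line_segment cd.1 cd.2 x.
have E1 ab cd x y : E ab cd x -> E ab cd y -> x = y.
  move=> [bd [x1 x2]] [_ [y1 y2]]; apply: contrapT => xy; apply: bd => z zs.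
  apply/(line_two_points z x1 y1 xy).
  apply/(line_two_points z (line_segment_sub x2) (line_segment_sub y2) xy).
  exact: line_segment_sub.
have /choice[u uP] : forall q : (R3 R * R3 R) * (R3 R * R3 R), exists u : R,
    forall t, 0 <= t < 2 * pi -> E q.1 q.2 (p t) -> t = u.
  move=> q; have [[t [t1 t2]]|no] :=
      pselect (exists t, 0 <= t < 2 * pi /\ E q.1 q.2 (p t)).
    exists t => t' t'1 /(E1 _ _ _ _ t2) e; apply/esym/(loop_inj_short lp e).
    by rewrite ltr_norml; lra.
  by exists 0 => t t1 t2; exfalso; apply: no; exists t.
have pi2 : 2 <= pi :> R by exact: pi_ge2.
(* the points 1 and 2 only serve to have at least three vertices *)
pose ts0 := [:: 0; 1; 2] ++ [seq u (ab, cd) | ab <- S, cd <- S].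
pose ts := sort <=%O (undup [seq t <- ts0 | 0 <= t < 2 * pi]).
have mem_ts t : t \in ts = (0 <= t < 2 * pi) && (t \in ts0).
  by rewrite mem_sort mem_undup mem_filter.
have ts_sorted : sorted <%O ts by rewrite sort_lt_sorted undup_uniq.
have m0 : (0 : R) \in ts by rewrite mem_ts !inE eqxx /= andbT; lra.
have m1 : (1 : R) \in ts by rewrite mem_ts !inE eqxx orbT /= andbT; lra.
have m2 : (2 : R) \in ts by rewrite mem_ts !inE eqxx !orbT /= andbT; lra.
pose n := size ts; pose tau j := nth (2 * pi) ts j.
have n2 : (2 < n)%N.
  have sub : {subset [:: 0 : R; 1; 2] <= ts}.
    by move=> t; rewrite !inE => /or3P[] /eqP ->.
  have u3 : uniq [:: 0 : R; 1; 2].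
    rewrite /= !inE !andbT negb_or -andbA.
    by apply/and3P; split; apply/eqP => h; lra.
  exact: (uniq_leq_size u3 sub).
have tau_in j : (j < n)%N -> 0 <= tau j < 2 * pi.
  by move=> jn; have := mem_nth (2 * pi) jn; rewrite mem_ts => /andP[].
have tau_n : tau n = 2 * pi by rewrite /tau nth_default.
have tau_lt i j : (i < j)%N -> (j < n)%N -> tau i < tau j.
  move=> ij jn; apply: (sorted_ltn_nth lt_trans) => //; rewrite inE //.
  exact: ltn_trans jn.
have tau_inc j : (j < n)%N -> tau j < tau j.+1.
  move=> jn; have [h|h] := ltnP j.+1 n; first exact: tau_lt.
  have -> : j.+1 = n by lia.
  by rewrite tau_n; case/andP: (tau_in j jn).
have tau_0 : tau 0%N = 0.
  have := nth_index (2 * pi) m0; rewrite -/(tau _).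
  have := m0; rewrite -index_mem => h.
  case: (index 0 ts) h => [//|k] h e.
  have := tau_lt 0%N k.+1 isT h; rewrite e => h0.
  have /andP[h1 _] := tau_in 0%N (ltn_trans (isT : (0 < 2)%N) n2).
  by move: h0; rewrite ltNge h1.
have gap j t : (j < n)%N -> tau j < t < tau j.+1 -> t \notin ts.
  move=> jn tj; apply/negP => tts.
  have e := nth_index (2 * pi) tts; move: tts; rewrite -index_mem => h.
  rewrite -/(tau _) in e; set i := index t ts in e h.
  have [ij|ij] := leqP i j.
    have : tau i <= tau j by move: ij; rewrite leq_eqVlt => /orP[/eqP ->//|ij]; apply/ltW/tau_lt.
    by rewrite e; lra.
  have : tau j.+1 <= tau i.
    by move: ij; rewrite leq_eqVlt => /orP[/eqP ->//|ij]; apply/ltW/tau_lt.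
  by rewrite e; lra.
exists (mkseq (p \o tau) n); rewrite size_mkseq.
apply: (@represents_pieces R K n (2 * pi) p tau) => //.
  by rewrite tau_n tau_0 add0r.
move=> j t jn tj.
have tj1 : tau j.+1 <= 2 * pi.
  by have [h|h] := ltnP j.+1 n; [have := tau_in _ h; lra|rewrite (_ : j.+1 = n) ?tau_n//; lia].
have tj0 : 0 <= tau j by have := tau_in j jn; lra.
pose I : set R := `]tau j, tau j.+1[%classic.
have IE v : I v = (tau j < v < tau j.+1) by rewrite /I /= in_itv.
have jj := tau_inc j jn.
pose mid := (tau j + tau j.+1) / 2.
have [ab abS abm] := cover mid.
have avoid v cd : I v -> cd \in S -> ~ E ab cd (p v).
  rewrite IE => Iv cdS Ev.
  have v2 : 0 <= v < 2 * pi by lra.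
  have /negP := gap j v jn Iv; apply.
  rewrite mem_ts v2 mem_cat; apply/orP; right.
  by rewrite (uP (ab, cd) v v2 Ev); apply: allpairs_f.
pose C : set R := p @^-1` (line ab.1 ab.2).
have cC : closed C by apply: closed_comp => [v _|]; [exact: pc|exact: line_closed].
pose D : set R := [set v | exists2 cd, cd \in S & bad ab cd /\ line_segment cd.1 cd.2 (p v)].
have cD : closed D.
  have -> : D = \bigcup_(cd in [set cd | cd \in S])
      (if pselect (bad ab cd) then p @^-1` (line_segment cd.1 cd.2) else set0).
    apply/seteqP; split=> [v [cd cdS [bd h]]|v [cd cdS]].
      by exists cd => //; case: pselect.
    by case: pselect => // bd h; exists cd.
  apply: closed_bigcup => [|cd _]; first exact: finite_seq.
  case: pselect => bd; last exact: closed0.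
  by apply: closed_comp => [v _|]; [exact: pc|exact: line_segment_closed].
have CI : I `&` C = I.
  have cI : connected I by apply/connected_intervalP; exact: interval_is_interval.
  apply: cI.
  - by exists mid; split; [rewrite IE /mid; lra|exact: line_segment_sub].
  - exists (~` D); first exact: closed_openC.
    apply/seteqP; split=> v [Iv]; [move=> Cv|move=> nDv]; split=> //.
      by move=> [cd cdS [bd h]]; apply: (avoid v cd Iv cdS).
    have [cd cdS h] := cover v.
    have [bd|nbd] := pselect (bad ab cd); first by exfalso; apply: nDv; exists cd.
    by apply: (contrapT nbd).
  - by exists C.
have all_in v : tau j <= v <= tau j.+1 -> line ab.1 ab.2 (p v).
  apply: (@closed_contains_itv C) => // w; rewrite -IE -CI => -[] //.
have ll : p (tau j) <> p (tau j.+1).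
  move=> /(loop_inj_short lp) h.
  suff : tau j = tau j.+1 by lra.
  apply: h; rewrite ltr_norml.
  have [h|h] := ltnP j.+1 n; first by have := tau_in _ h; lra.
  have j0 : (0 < j)%N by rewrite -ltnS; apply: leq_trans h; exact: ltnW.
  by have := tau_lt 0%N j j0 jn; rewrite tau_0; lra.
have [c ->] : line (p (tau j)) (p (tau j.+1)) (p t).
  by apply/(line_two_points _ (all_in _ _) (all_in _ _) ll); [lra|lra|exact: all_in].
by exists c.
Qed.

End Polygonal.

(** * Two parametrizations of one knot; regular knots *)

Section SameRange.
Variable R : realType.
Implicit Types (s t u T : R) (p q : R -> R3 R).

Lemma loop_opp T q : loop T q -> loop T (fun t => q (- t)).
Proof.
move=> [qc qper qinj]; split.
- by move=> t; apply: (@continuous_comp _ _ _ -%R q); [exact: opp_continuous|exact: qc].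
- by move=> t; rewrite opprD -[in LHS](qper (- t - T)) subrK.
- by move=> s t /qinj[k e]; exists (- k); rewrite mulrNz mulNr; lra.
Qed.

(** The change of parameter [phi] over one period is extended to the line; the
    value at the origin, where it may jump, is dealt with separately. *)
Lemma same_range_increasing T p q (phi : R -> R) : 0 < T -> loop T p -> loop T q ->
  range p = range q ->
  (forall t, 0 <= t < T -> phi 0 <= phi t < phi 0 + T /\ q (phi t) = p t) ->
  (forall s t, 0 < s -> s < t -> t < T -> phi s < phi t) ->
  exists2 psi, reparam T T psi & p = q \o psi.
Proof.
move=> T0 lp lq rpq phiP phi_inc.
have [_ pper pinj] := lp; have [_ qper qinj] := lq.
have phi_inc0 s t : 0 <= s -> s < t -> t < T -> phi s < phi t.
  rewrite le_eqVlt => /orP[/eqP <-|]; last exact: phi_inc.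
  move=> t0 tT; have [/andP[h1 _] h2] := phiP t (introT andP (conj (ltW t0) tT)).
  rewrite lt_neqAle h1 andbT; apply/eqP => e.
  have [_ h3] := phiP 0 (introT andP (conj (lexx _) T0)).
  have : p 0 = p t by rewrite -h3 -h2 e.
  by move/(loop_inj_short lp) => h; have := h (_ : _); rewrite sub0r normrN ger0_norm ?ltW// => /(_ tT); lra.
pose tau (i : int) := i%:~R * T.
pose ups (i : int) := phi 0 + i%:~R * T.
pose f (i : int) t := phi (t - i%:~R * T) + i%:~R * T.
have [psi rpsi psiE] : exists2 psi, reparam T T psi &
    forall i t, tau i <= t -> t < tau (i + 1) -> psi t = f i t.
  apply: (@glue_reparam _ 1%N T T tau ups) => //.
  - by move=> i; rewrite /tau intrD1 mulrDl mul1r ltrDl.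
  - by move=> i; rewrite /tau intrD1 mulrDl mul1r.
  - by move=> i; rewrite /ups intrD1 mulrDl mul1r addrA.
  - move=> i s t; rewrite /tau intrD1 mulrDl mul1r => s1 st t1.
    by rewrite /f ltrD2r phi_inc0//; lra.
  - move=> i t; rewrite /tau /ups /f intrD1 mulrDl mul1r => t1 t2.
    have [|h _] := phiP (t - i%:~R * T); first by lra.
    by lra.
  - move=> i y; rewrite /tau /ups /f intrD1 mulrDl mul1r => y1 y2.
    have [t _ pt] : range p (q (y - i%:~R * T)) by rewrite rpq; exists (y - i%:~R * T).
    have [u uT [k et]] := floor_period t T0.
    have [u1 u2] := phiP u uT.
    exists (u + i%:~R * T); first by lra.
    rewrite addrK; suff -> : phi u = y - i%:~R * T by rewrite subrK.
    apply: (loop_inj_short lq); last by rewrite ltr_norml; lra.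
    by rewrite u2 -pt et (periodicMz _ _ pper).
  - move=> i t t1 t2; rewrite /f intrD1 mulrDl mul1r.
    have -> : t + T - (i%:~R * T + T) = t - i%:~R * T by lra.
    by rewrite addrA.
exists psi => //; apply/funext => t /=.
have [u uT [k et]] := floor_period t T0.
rewrite (psiE k); [|rewrite /tau ?intrD1 ?mulrDl; lra..].
rewrite /f (periodicMz _ _ qper) et addrK (periodicMz _ _ pper).
by have [_ ->] := phiP u uT.
Qed.

(** Two loops with the same image differ by a homeomorphism of the circle.  Over
    the open period it has a lift that is continuous, by compactness of the
    image, and injective, hence increasing or decreasing. *)
Lemma same_range_reparam T p q : 0 < T -> loop T p -> loop T q ->
  range p = range q -> exists2 psi, reparam T T psi &
    p = q \o psi \/ p = (fun t => q (- t)) \o psi.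
Proof.
move=> T0 lp lq rpq.
have [pc pper pinj] := lp; have [qc qper qinj] := lq.
have [u0 _ qu0] : range q (p 0) by rewrite -rpq; exists 0.
have /choice[phi phiP] : forall t, exists u, u0 <= u < u0 + T /\ q u = p t.
  move=> t; have [u _ qu] : range q (p t) by rewrite -rpq; exists t.
  have [v vT [k ek]] := floor_period (u - u0) T0.
  exists (v + u0); split; first by lra.
  by rewrite -qu -[u](subrK u0) ek addrAC (periodicMz _ _ qper).
have phi_q u t : u0 <= u < u0 + T -> q u = p t -> u = phi t.
  have [ht pt] := phiP t; move=> hu; rewrite -pt; move/(loop_inj_short lq); apply.
  by rewrite ltr_norml; lra.
have phi0 : phi 0 = u0 by apply/esym/phi_q => //; rewrite lexx ltrDl.
have phi_gt t : 0 < t < T -> u0 < phi t.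
  move=> tT; have [/andP[h1 _] h2] := phiP t.
  rewrite lt_neqAle h1 andbT; apply/eqP => e.
  have : p 0 = p t by rewrite -h2 -e.
  move/(loop_inj_short lp) => h; have : 0 = t by apply: h; rewrite ltr_norml; lra.
  by lra.
have phi_c : {within `]0, T[, continuous phi}.
  apply/subspace_continuousP => t /=; rewrite in_itv /= => tT.
  apply: cvg_trans; first by apply: cvg_app; exact: cvg_within.
  apply/cvgrPdist_lt => e e0.
  pose C : set R := `[u0, u0 + T] `&` ~` (ball (phi t) e).
  have cC : closed (q @` C).
    apply: (@compact_closed (R3 R) _ (@norm_hausdorff R (R3 R))).
    apply: continuous_compact; first exact: continuous_subspaceT.
    apply: compact_closedI; first exact: segment_compact.
    by apply: open_closedC; exact: ball_open.
  have nC : ~ (q @` C) (p t).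
    move=> [u [/=]]; rewrite in_itv /= => /andP[h1 h2] nb qu.
    move: h2; rewrite le_eqVlt => /orP[/eqP h2|h2]; last first.
      by apply: nb; rewrite (phi_q u t) ?h1//; exact: ballxx.
    have h3 := phi_gt t tT; suff h4 : u0 = phi t by lra.
    by apply: phi_q; [lra|rewrite -qu h2 qper].
  have : \forall t' \near t, (~` (q @` C)) (p t').
    apply: pc; apply: open_nbhs_nbhs; split=> //; exact: closed_openC.
  apply: filterS => t' /= nC'; apply: contrapT => nb; apply: nC'.
  have [h1 h2] := phiP t'; exists (phi t') => //; split=> //=.
  by rewrite in_itv /=; lra.
have phi_inj : {in `]0, T[ &, injective phi}.
  move=> s t; rewrite !in_itv /= => sT tT e.
  have [_ h1] := phiP s; have [_ h2] := phiP t.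
  by apply: (loop_inj_short lp); [rewrite -h1 -h2 e|rewrite ltr_norml; lra].
have [inc|dec] := itv_continuous_inj_mono phi_c phi_inj.
  have [||psi rpsi pE] := @same_range_increasing T p q phi T0 lp lq rpq.
  - by move=> t _; rewrite phi0; exact: phiP.
  - by move=> s t s0 st tT; apply: inc; rewrite ?in_itv //=; lra.
  by exists psi => //; left.
pose phi' t := if t == 0 then - u0 else T - phi t.
have phi'0 : phi' 0 = - u0 by rewrite /phi' eqxx.
have rpq' : range p = range (fun t => q (- t)).
  rewrite rpq; apply/seteqP; split=> [_ [t _ <-]|_ [t _ <-]].
    by exists (- t) => //; rewrite opprK.
  by exists (- t).
have [||psi rpsi pE] := @same_range_increasing T p _ phi' T0 lp (loop_opp lq) rpq'.
- move=> t tT; rewrite phi'0 /phi'; case: eqVneq => [->|tn0].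
    by split; [lra|rewrite opprK qu0].
  have t0 : 0 < t < T by have := tn0; rewrite lt_neqAle eq_sym => ->; lra.
  have [h1 h2] := phiP t; have h3 := phi_gt t t0.
  by split; [lra|rewrite opprB -h2 -[LHS]qper subrK].
- move=> s t s0 st tT; rewrite /phi' !gt_eqF//; last by lra.
  rewrite ltrD2l ltrN2.
  by apply: dec; rewrite ?in_itv //=; lra.
by exists psi => //; right.
Qed.

End SameRange.

Section Smooth.
Variable R : realType.
Implicit Types (s t u T : R) (p q : R -> R3 R).

(** A derivative bounded away from zero and uniform differentiability: all that
    inscribed polygons require of a smooth loop. *)
Definition regular p := exists D : R -> R3 R, exists2 m, 0 < m &
  (forall t, m <= `|D t|) /\
  forall e, 0 < e -> exists2 d, 0 < d & forall s t, `|s - t| <= d ->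
    `|p s - p t - (s - t) *: D t| <= e * `|s - t|.

Lemma regular_opp p : regular p -> regular (fun t => p (- t)).
Proof.
move=> [D [m m0 [Dm De]]]; exists (fun t => - D (- t)), m => //; split.
  by move=> t; rewrite normrN.
move=> e e0; have [d d0 dP] := De e e0; exists d => // s t st.
have st' : - s - - t = - (s - t) by rewrite opprB opprK addrC.
have := dP (- s) (- t); rewrite st' normrN => /(_ st).
by rewrite scalerN scaleNr.
Qed.

(** Near the diagonal the derivative bounds the chords from below, and
    compactness does so away from it. *)
Lemma regular_chord T p : 0 < T -> loop T p -> regular p ->
  exists2 c, 0 < c & forall s t, `|s - t| <= T / 2 -> c * `|s - t| <= `|p s - p t|.
Proof.
move=> T0 [pc pper pinj] [D [m m0 [Dm De]]].
have [d d0 dP] := De (m / 2) (divr_gt0 m0 (ltr0n _ 2)).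
have near s t : `|s - t| <= d -> m / 2 * `|s - t| <= `|p s - p t|.
  move=> st; have h := dP s t st.
  have h1 : m * `|s - t| <= `|(s - t) *: D t|.
    by rewrite normrZ mulrC ler_wpM2l.
  have h2 : `|(s - t) *: D t| <= `|p s - p t| + `|p s - p t - (s - t) *: D t|.
    rewrite -[X in `|X| <= _](subKr (p s - p t)); exact: ler_normB.
  by lra.
have [d' [d'0 d'd d'T]] : exists d', [/\ 0 < d', d' <= d & d' <= T / 2].
  exists (Num.min d (T / 2)).
  by rewrite lt_min d0 divr_gt0// !ge_min !lexx orbT.
pose B : set (R * R) := `[0, T] `*` `[d', T / 2].
pose f (x : R * R) := `|p (x.1 + x.2) - p x.1|.
have [c2 c20 c2f] : exists2 c, 0 < c & forall x, B x -> c <= f x.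
  apply: compact_pos_bound.
  - by exists (0, d'); split => /=; rewrite in_itv /= lexx ?d'T ?ltW.
  - by apply: compact_setX; exact: segment_compact.
  - move=> x; apply: cvg_norm; apply: cvgB.
      apply: (@continuous_comp _ _ _ (fun x : R * R => x.1 + x.2) p); last exact: pc.
      by apply: cvgD; [exact: cvg_fst|exact: cvg_snd].
    by apply: (@continuous_comp _ _ _ fst p); [exact: cvg_fst|exact: pc].
  - move=> [a u] [/=]; rewrite !in_itv /= => a1 u1.
    rewrite /f /= normr_gt0 subr_eq0; apply/eqP => e.
    have : a + u = a.
      apply: (loop_inj_short (And3 pc pper pinj) e).
      by rewrite addrAC subrr add0r gtr0_norm; lra.
    by move: u1 => /andP[u1 _]; lra.
have far s t : d' <= `|s - t| -> `|s - t| <= T / 2 -> c2 <= `|p s - p t|.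
  wlog st : s t / t <= s.
    move=> h; have [st|/ltW ts] := leP t s; first exact: h.
    by rewrite distrC [X in _ -> _ -> _ <= X]distrC; exact: h.
  rewrite ger0_norm ?subr_ge0// => h1 h2.
  have [r rT [k et]] := floor_period t T0.
  have -> : p s = p (r + (s - t)).
    by rewrite -[RHS](periodicMz k _ pper); congr p; lra.
  rewrite et (periodicMz _ _ pper) -et.
  by apply: (c2f (r, s - t)); split => /=; rewrite in_itv /=; lra.
exists (Num.min (m / 2) (c2 / (T / 2))).
  by rewrite lt_min !divr_gt0.
move=> s t st; have [h|h] := leP `|s - t| d.
  by apply: le_trans (near s t h); rewrite ler_wpM2r// ge_min lexx.
apply: le_trans (far s t _ st); last by lra.
apply: (@le_trans _ _ (c2 / (T / 2) * `|s - t|)).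
  by rewrite ler_wpM2r// ge_min lexx orbT.
by rewrite mulrAC ler_pdivrMr ?divr_gt0// ler_pM2l.
Qed.

(** The difference between a chord of the polygon and the corresponding chord of
    the loop is split into the two errors of linear approximation and the
    variation of the derivative. *)
Lemma chord_error_split (V : lmodType R) (a h : R) (A B D1 D2 : V) :
  a *: A - B = a *: (A - h *: D1) - (B - (a * h) *: D2) - (a * h) *: (D2 - D1).
Proof.
rewrite !scalerBr !scalerA; move: ((a * h) *: D1) ((a * h) *: D2) => P Q.
by rewrite !opprB addrAC !addrA !subrK.
Qed.

(** A fine inscribed polygon is close to the loop in the Lipschitz sense, because
    along each edge the derivative of the loop is close to the chord. *)
Lemma regular_represents (K : set (oriented_set R)) T p : 0 < T ->
  oriented_knot_type K -> loop T p -> K (knot_of T p) -> regular p ->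
  exists n v, represents K n v.
Proof.
move=> T0 typeK lp Kp rp.
have [c c0 cP] := regular_chord T0 lp rp.
have [D [m m0 [Dm De]]] := rp.
have [d d0 dP] := De (c / 8) (divr_gt0 c0 (ltr0n _ 8)).
pose N := (Num.truncn (T / d)).+3.
have N0 : 0 < N%:R :> R by rewrite ltr0n.
have NT : T / N%:R <= d.
  rewrite ler_pdivrMr// mulrC -ler_pdivrMr// /N.
  have h : T / d < (Num.truncn (T / d)).+1%:R by exact: truncnS_gt.
  apply: ltW; apply: lt_le_trans h _; rewrite ler_nat.
  exact: leq_trans (leqnSn _) (leqnSn _).
pose h := T / N%:R; have h0 : 0 < h by rewrite divr_gt0.
pose pN t := p (t * h).
have lpN : loop N%:R pN := loop_rescale N0 T0 lp.
have KpN : K (knot_of N%:R pN).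
  by rewrite /pN (knot_of_reparam p N0 T0 (reparam_scale N0 T0)).
have [_ pNper _] := lpN.
pose v (i : int) := pN i%:~R.
have vper i : v (i + N%:Z) = v i by rewrite /v intrD -pmulrn pNper.
(* differentiability being uniform, the derivative varies little: compare the
   two linear approximations based at s and at t *)
have Dd s t : `|s - t| <= d -> s != t -> `|D s - D t| <= c / 4.
  move=> st snt; have st0 : 0 < `|s - t| by rewrite normr_gt0 subr_eq0.
  have h1 := dP s t st; have h2 := dP t s; rewrite distrC in h2.
  have := ler_normD (p s - p t - (s - t) *: D t) (p t - p s - (t - s) *: D s).
  have -> : p s - p t - (s - t) *: D t + (p t - p s - (t - s) *: D s) =
      (s - t) *: (D s - D t).
    rewrite addrACA [p s - p t + _]addrA subrK subrr add0r.
    by rewrite -[t - s]opprB scaleNr opprK scalerBr addrC.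
  rewrite normrZ => h3.
  rewrite -(ler_pM2l st0); apply: (le_trans h3).
  apply: (le_trans (lerD h1 (h2 st))); rewrite -mulrDl mulrC ler_wpM2l//.
  by clear; lra.
have sth s t : `|s * h - t * h| = `|s - t| * h.
  by rewrite -mulrBl normrM (gtr0_norm h0).
have [lv iv] : loop N%:R (pl v) /\ ambient_isotopic (knot_of N%:R pN) (knot_of N%:R (pl v)).
  apply: (@lip_perturbation _ _ (c * h) (c / 2 * h)) => //.
  - move=> s t st; rewrite -mulrA [h * _]mulrC -sth; apply: cP; rewrite sth.
    have -> : T / 2 = N%:R / 2 * h by rewrite mulrAC [N%:R * h]mulrC divfK ?gt_eqF.
    by rewrite ler_pM2r.
  - by move=> t; exact: pl_periodic.
  - by rewrite mulr_ge0 ?divr_ge0// ltW.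
  - by rewrite ltr_pM2r//; lra.
  apply: lip_cells => i s t /andP[s1 s2] /andP[t1 t2].
  pose x := i%:~R * h : R.
  have e1 : `|v (i + 1) - v i - h *: D x| <= c / 8 * h.
    rewrite /v /pN intrD1 mulrDl mul1r -/x.
    have := dP (x + h) x; rewrite addrAC subrr add0r (gtr0_norm h0); exact.
  have e2 : `|pN s - pN t - ((s - t) * h) *: D (t * h)| <= c / 8 * (`|s - t| * h).
    rewrite -sth mulrBl; apply: dP; rewrite sth.
    apply: le_trans NT; rewrite -/h ler_piMl ?(ltW h0)// ler_norml; lra.
  have e3 : `|D (t * h) - D x| <= c / 4.
    have [->|tx] := eqVneq (t * h) x; first by rewrite subrr normr0; lra.
    apply: Dd => //; apply: le_trans NT; rewrite /x -mulrBl normrM (gtr0_norm h0) -/h.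
    by rewrite ler_piMl ?(ltW h0)// ler_norml; lra.
  have -> : pl v s - pN s - (pl v t - pN t) = (pl v s - pl v t) - (pN s - pN t).
    by rewrite !opprD !opprK addrACA.
  rewrite !(@plE _ _ v i)// opprD addrACA subrr add0r -scalerBl.
  have -> : s - i%:~R - (t - i%:~R) = s - t by rewrite opprB addrA subrK.
  set A := v (i + 1) - v i in e1 *; set Bt := pN s - pN t in e2 *.
  rewrite (chord_error_split (s - t) h A Bt (D x) (D (t * h))).
  rewrite (le_trans (ler_normB _ _))//.
  have f1 : `|(s - t) *: (A - h *: D x)| <= `|s - t| * (c / 8 * h).
    by rewrite normrZ ler_wpM2l.
  have f3 : `|((s - t) * h) *: (D (t * h) - D x)| <= `|s - t| * h * (c / 4).
    by rewrite normrZ normrM (gtr0_norm h0) ler_wpM2l// mulr_ge0// ltW.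
  have f2 := ler_normB ((s - t) *: (A - h *: D x)) (Bt - ((s - t) * h) *: D (t * h)).
  have := normr_ge0 (s - t); nra.
exists N, v; split.
  by split=> //; case: lv.
exact: (oriented_knot_type_ambient typeK N0 lv iv KpN).
Qed.

End Smooth.

(** * Tame knot types contain polygons *)

Section SmoothRegular.
Variable R : realType.
Implicit Types (s t u T : R) (p q : R -> R3 R).

(** The mean value theorem is about real functions, so derivatives are taken one
    coordinate at a time. *)
Lemma is_derive_coordinate (l : R3 R -> R) q t : continuous l ->
  (forall x y, l (x - y) = l x - l y) -> (forall c x, l (c *: x) = c * l x) ->
  derivable q t 1 -> is_derive t (1 : R) (l \o q) (l (derive1 q t)).
Proof.
move=> lc lB lZ dq; rewrite derive1E.
have h : (fun h => h^-1 *: ((l \o q) (h *: 1 + t) - (l \o q) t)) @ 0^' --> l ('D_1 q t).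
  have -> : (fun h => h^-1 *: ((l \o q) (h *: 1 + t) - (l \o q) t)) =
      l \o (fun h => h^-1 *: (q (h *: 1 + t) - q t)).
    by apply/funext => x /=; rewrite lZ lB.
  by apply: (cvg_comp _ _ dq); exact: lc.
apply: DeriveDef; first by apply/cvg_ex; exists (l ('D_1 q t)).
exact: (cvg_lim (@norm_hausdorff R R) h).
Qed.

Lemma periodic_unif_continuous T (D : R -> R3 R) : 0 < T -> continuous D ->
  (forall t, D (t + T) = D t) -> forall e, 0 < e ->
  exists2 d, 0 < d & forall s t, `|s - t| <= d -> `|D s - D t| < e.
Proof.
move=> T0 cD perD e e0.
pose f (x : R * R) := D (x.1 + x.2) - D x.1.
have fc : continuous f.
  move=> x; apply: cvgB.
    apply: (@continuous_comp _ _ _ (fun x : R * R => x.1 + x.2) D); last exact: cD.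
    by apply: cvgD; [exact: cvg_fst|exact: cvg_snd].
  by apply: (@continuous_comp _ _ _ fst D); [exact: cvg_fst|exact: cD].
pose B : set (R * R) := (`[0, T] `*` `[-1, 1]) `&` [set x | e <= `|f x|].
have Bc : compact B.
  apply: compact_closedI; first by apply: compact_setX; exact: segment_compact.
  have -> : [set x | e <= `|f x|] = (fun x => `|f x|) @^-1` [set y | e <= y].
    by [].
  by apply: closed_comp => [x _|]; [apply: cvg_norm; exact: fc|exact: closed_ge].
have sc : continuous (fun x : R * R => `|x.2|).
  by move=> x; apply: cvg_norm; exact: cvg_snd.
have [d d0 dP] : exists2 d, 0 < d & forall x, B x -> d <= `|x.2|.
  have [B0|B0] := pselect (B !=set0); last first.
    by exists 1 => // x Bx; exfalso; apply: B0; exists x.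
  apply: compact_pos_bound => // -[a u] [_ /= h].
  rewrite normr_gt0; apply/eqP => u0; move: h.
  by rewrite /f /= u0 addr0 subrr normr0 leNgt e0.
exists (Num.min 1 (d / 2)); first by rewrite lt_min ltr01 divr_gt0.
move=> s t; rewrite le_min => /andP[st1 std]; rewrite ltNge; apply/negP => h.
have [r rT [k et]] := floor_period t T0.
have : d <= `|s - t|; last by lra.
apply: (dP (r, s - t)); split.
  split => /=; rewrite in_itv /=; first by lra.
  by rewrite -ler_norml.
rewrite /f /=; have -> : D (r + (s - t)) = D s.
  by rewrite -(periodicMz k _ perD); congr D; lra.
by rewrite (_ : D r = D t)// et (periodicMz _ _ perD).
Qed.

(** Periodicity and compactness make the derivative uniformly continuous and
    bound it away from zero; the mean value theorem does the rest. *)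
Lemma smooth_regular T q : 0 < T -> loop T q ->
  (forall n t, derivable (derive1n n q) t 1) -> (forall t, derive1 q t != 0) ->
  regular q.
Proof.
move=> T0 [qc qper qinj] dq D0.
pose D := derive1 q.
have Dc : continuous D.
  by move=> t; apply: differentiable_continuous; apply/derivable1_diffP; exact: (dq 1%N t).
have Dper t : D (t + T) = D t.
  by rewrite /D /derive1; under eq_fun do rewrite addrA !qper.
exists D.
have [m m0 mP] : exists2 m, 0 < m & forall x, `[0, T]%classic x -> m <= `|D x|.
  apply: compact_pos_bound.
  - by exists 0; rewrite /= in_itv /= lexx ltW.
  - exact: segment_compact.
  - by move=> x; apply: cvg_norm; exact: Dc.
  - by move=> x _; rewrite normr_gt0.
exists m => //; split.
  move=> t; have [r rT [k ->]] := floor_period t T0.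
  by rewrite (periodicMz _ _ Dper); apply: mP; rewrite /= in_itv /=; lra.
move=> e e0; have [d d0 dP] := periodic_unif_continuous T0 Dc Dper e0.
exists d => // s t st.
have coord (l : R3 R -> R) : continuous l ->
    (forall x y, l (x - y) = l x - l y) -> (forall c x, l (c *: x) = c * l x) ->
    (forall x, `|l x| <= `|x|) ->
    `|l (q s - q t - (s - t) *: D t)| <= e * `|s - t|.
  move=> lc lB lZ l1; rewrite !lB lZ.
  have der (x : R) : is_derive x (1 : R) (l \o q) (l (D x)).
    by apply: is_derive_coordinate => //; exact: (dq 0%N x).
  have cont a b : {within `[a, b], continuous (l \o q)}.
    by apply: continuous_subspaceT => x; apply: continuous_comp; [exact: qc|exact: lc].
  have [x xs ->] : exists2 x, `|x - t| <= `|s - t| &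
      l (q s) - l (q t) = l (D x) * (s - t).
    have [ts|ts|<-] := ltgtP t s; last by exists t => //; rewrite !subrr mulr0.
    - have [x] := MVT ts (fun x _ => der x) (cont t s).
      rewrite in_itv /= => xi e1; exists x => //.
      by rewrite !gtr0_norm; lra.
    - have [x] := MVT ts (fun x _ => der x) (cont s t).
      rewrite in_itv /= => xi e1; exists x; first by rewrite !ltr0_norm; lra.
      by move: e1 => /=; lra.
  rewrite [(s - t) * _]mulrC -mulrBl normrM -lB ler_wpM2r//.
  by rewrite (le_trans (l1 _))// ltW// dP// (le_trans xs).
rewrite ler_normR3; apply/and3P; split.
- apply: (coord (fun x => x.1.1)) => //.
    by move=> x; apply: (@continuous_comp _ _ _ fst fst); exact: cvg_fst.
  by move=> x; have := lexx `|x|; rewrite {1}ler_normR3 => /and3P[].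
- apply: (coord (fun x => x.1.2)) => //.
    by move=> x; apply: (@continuous_comp _ _ _ fst snd); [exact: cvg_fst|exact: cvg_snd].
  by move=> x; have := lexx `|x|; rewrite {1}ler_normR3 => /and3P[].
- apply: (coord (fun x => x.2)) => //.
    by move=> x; exact: cvg_snd.
  by move=> x; have := lexx `|x|; rewrite {1}ler_normR3 => /and3P[].
Qed.

(** A smooth knot has its own orientation and a smooth parametrization that may
    be opposite to it; in that case the reversed parametrization is used. *)
Lemma tame_represents (K : set (oriented_set R)) : tame_knot_types R K ->
  exists s : seq (R3 R), represents K (size s) (vtx s).
Proof.
move=> [typeK [k Kk tame]].
have ok : is_oriented_knot k by case: typeK Kk => k0 _ -> [].
have [p lp ek] := is_oriented_knotE ok.
have T0 := two_pi_gt0 R.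
rewrite ek in Kk tame; case: tame => /=; last exact: polygonal_represents.
move=> [q [kq dq Dq]].
have [lq rq] := knot_param_loop kq; simpl in rq.
have regq := smooth_regular T0 lq dq Dq.
suff [n [v rv]] : exists n v, represents K n v.
  exists (mkseq (fun j => v j%:Z) n); rewrite size_mkseq.
  suff -> : vtx (mkseq (fun j => v j%:Z) n) = v by [].
  have [[n2 per _] _] := rv.
  by apply: vtx_mkseq => //; lia.
have [psi rpsi [ep|ep]] := same_range_reparam T0 lp lq rq.
- by apply: (regular_represents T0 typeK lq) => //; rewrite -(knot_of_reparam _ T0 T0 rpsi) -ep.
- apply: (regular_represents T0 typeK (loop_opp lq)); last exact: regular_opp.
  by rewrite -(knot_of_reparam _ T0 T0 rpsi) -ep.
Qed.

End SmoothRegular.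

(** * Closing a chain by a monotone path *)

Section Closing.
Variable R : realType.
Implicit Types (s t u : R) (w : int -> R3 R) (X l : R3 R -> R) (m N : nat).

Definition affine X := forall s a b, X ((1 - s) *: a + s *: b) = (1 - s) * X a + s * X b.

Lemma affine_pl X w (i : nat) t : affine X -> i%:R <= t -> t <= i%:R + 1 ->
  X (pl w t) = (1 - (t - i%:R)) * X (w i%:Z) + (t - i%:R) * X (w i.+1%:Z).
Proof.
move=> aX it ti; rewrite (@plE _ _ w i%:Z) -?pmulrn// -aX.
have -> : i.+1%:Z = i%:Z + 1 by lia.
set c := t - _; congr X; rewrite (scalerBl 1 c) scale1r scalerBr.
by rewrite [RHS]addrAC addrA.
Qed.

Lemma nat_cell N t : 0 <= t -> t < N%:R -> exists i : nat, [/\ (i < N)%N, i%:R <= t & t < i%:R + 1].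
Proof.
move=> t0 tN; exists (Num.truncn t).
have /andP[h1 h2] := truncn_itv t0.
rewrite h1 natr1 h2; split=> //.
by rewrite -(ltr_nat R); exact: le_lt_trans tN.
Qed.

(** The first part of a closed polygon, up to the vertex number [m]: it does not
    intersect itself and touches the plane [X = 0] at its two ends only. *)
Definition half_space_chain X m w :=
  [/\ forall t u, 0 <= t <= m%:R -> 0 <= u <= m%:R -> pl w t = pl w u -> t = u,
      X (w 0) = 0, X (w m%:Z) = 0 & forall i : nat, (0 < i < m)%N -> X (w i%:Z) < 0].

(** The remaining part: monotone in some direction, hence free of
    self-intersections, and separated from the chain by the plane. *)
Definition monotone_closing X l m N w :=
  (forall i : nat, (m <= i <= N)%N -> 0 <= X (w i%:Z)) /\
  (forall i : nat, (m <= i < N)%N -> l (w i%:Z) < l (w i.+1%:Z)).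

Lemma half_space_chain_neg X m w t : (1 < m)%N -> affine X ->
  half_space_chain X m w -> 0 < t -> t < m%:R -> X (pl w t) < 0.
Proof.
move=> m1 aX [_ X0 Xm Xi] t0 tm.
have [i [im it ti]] := nat_cell (ltW t0) tm.
rewrite (affine_pl w aX it (ltW ti)).
have [i0|i0] := posnP i.
  subst i; rewrite X0 mulr0 add0r; have := Xi 1%N m1.
  by rewrite subr0 pmulr_rlt0.
have h1 := Xi i (introT andP (conj i0 im)).
have h2 : X (w i.+1%:Z) <= 0.
  move: im; rewrite leq_eqVlt => /orP[/eqP ->|im]; first by rewrite Xm.
  by apply/ltW/Xi.
by nra.
Qed.

Lemma monotone_closing_inc X l m N w t u : affine l ->
  monotone_closing X l m N w -> m%:R <= t -> t < u -> u <= N%:R ->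
  l (pl w t) < l (pl w u).
Proof.
move=> al [_ inc] mt tu uN.
have t0 : 0 <= t by rewrite (le_trans _ mt).
have tN : t < N%:R by exact: lt_le_trans uN.
have [i [iN it ti]] := nat_cell t0 tN.
have mi : (m <= i)%N by rewrite -ltnS -(ltr_nat R) -natr1; exact: le_lt_trans ti.
have li : l (w i%:Z) < l (w i.+1%:Z) by apply: inc; rewrite mi iN.
rewrite (affine_pl w al it (ltW ti)).
have [ui|ui] := leP u (i%:R + 1).
  have iu : i%:R <= u by exact: le_trans (ltW tu).
  rewrite (affine_pl w al iu ui); nra.
have mono (j : nat) : (i < j)%N -> (j <= N)%N -> l (w i.+1%:Z) <= l (w j%:Z).
  elim: j => // j IH; rewrite ltnS leq_eqVlt => /orP[/eqP ->//|ij] jN.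
  apply: le_trans (IH ij (ltnW jN)) _; apply/ltW/inc.
  by rewrite jN andbT (leq_trans mi)// ltnW.
apply: (@lt_le_trans _ _ (l (w i.+1%:Z))); first by nra.
move: uN; rewrite le_eqVlt => /orP[/eqP ->|uN].
  by rewrite pmulrn pl_int; apply: mono.
have [j [jN ju uj]] := nat_cell (ltW (le_lt_trans t0 tu)) uN.
have ij : (i < j)%N.
  rewrite -ltnS -(ltr_nat R) -[in X in _ < X]natr1 -natr1; exact: lt_trans uj.
rewrite (affine_pl w al ju (ltW uj)).
have h1 := mono _ ij (ltnW jN).
have h2 : l (w j%:Z) < l (w j.+1%:Z) by apply: inc; rewrite jN (leq_trans mi)// ltnW.
by nra.
Qed.

(** The plane separates the open chain from the closing path, and each of the two
    is injective by itself. *)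
Lemma closing_simple X l m N w : affine X -> affine l -> (1 < m)%N -> (m < N)%N ->
  (forall i, w (i + N%:Z) = w i) -> half_space_chain X m w ->
  monotone_closing X l m N w -> simple N w.
Proof.
move=> aX al m1 mN per ch cl; split=> //; first by lia.
have N0 : 0 < N%:R :> R by rewrite ltr0n; lia.
have [inj X0 Xm Xi] := ch.
have Xge u : m%:R <= u -> u < N%:R -> 0 <= X (pl w u).
  move=> mu uN; have [i [iN iu ui]] := nat_cell (le_trans (ler0n _ _) mu) uN.
  have mi : (m <= i)%N by rewrite -ltnS -(ltr_nat R) -natr1; exact: le_lt_trans ui.
  rewrite (affine_pl w aX iu (ltW ui)).
  have h1 : 0 <= X (w i%:Z) by apply: cl.1; lia.
  have h2 : 0 <= X (w i.+1%:Z) by apply: cl.1; lia.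
  by nra.
suff main t u : 0 <= t < N%:R -> 0 <= u < N%:R -> pl w t = pl w u -> t = u.
  move=> t u.
  have [t' t1 [k ->]] := floor_period t N0; have [u' u1 [j ->]] := floor_period u N0.
  rewrite !(periodicMz _ _ (fun t => pl_periodic t per)) => /(main _ _ t1 u1) ->.
  by exists (k - j); rewrite intrB mulrBl; lra.
have lw0 u' : m%:R <= u' -> u' < N%:R -> pl w 0 <> pl w u'.
  move=> mu uN e; have := monotone_closing_inc al cl mu uN (lexx _).
  have -> : N%:R = 0 + N%:R :> R by rewrite add0r.
  by rewrite (pl_periodic _ per) e ltxx.
have mixed t' u' : 0 <= t' -> t' < m%:R -> m%:R <= u' -> u' < N%:R -> pl w t' <> pl w u'.
  rewrite le_eqVlt => /orP[/eqP <- _|t0 tm]; first exact: lw0.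
  move=> mu uN e; have := half_space_chain_neg m1 aX ch t0 tm.
  by rewrite e ltNge Xge.
move=> /andP[t0 tN] /andP[u0 uN] e.
have [tm|tm] := ltP t m%:R; have [um|um] := ltP u m%:R.
- by apply: inj => //; rewrite ?t0 ?u0 ltW.
- by have := mixed _ _ t0 tm um uN e.
- by have := mixed _ _ u0 um tm tN (esym e).
- have [tu|ut|//] := ltgtP t u.
  + by have := monotone_closing_inc al cl tm tu (ltW uN); rewrite e ltxx.
  + by have := monotone_closing_inc al cl um ut (ltW tN); rewrite e ltxx.
Qed.

Lemma mix_lt s (a b c d : R) : 0 <= s <= 1 -> a < b -> c < d ->
  (1 - s) * a + s * c < (1 - s) * b + s * d.
Proof.
move=> /andP[s0 s1] ab cd.
have [->|sn1] := eqVneq s 1; first by rewrite subrr !mul0r !mul1r !add0r.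
have s1' : s < 1 by rewrite lt_neqAle sn1.
by rewrite ltr_leD ?ltr_pM2l ?subr_gt0// ler_wpM2l// ltW.
Qed.

Lemma pl_agree m w w' t : (forall i : nat, (i <= m)%N -> w i%:Z = w' i%:Z) ->
  0 <= t <= m%:R -> pl w t = pl w' t.
Proof.
move=> ww' /andP[t0]; rewrite le_eqVlt => /orP[/eqP ->|tm].
  by rewrite pmulrn !pl_int ww'.
have [i [im it ti]] := nat_cell t0 tm.
rewrite !(@plE _ _ _ i%:Z) -?pmulrn// ?(ltW ti)//.
have -> : i%:Z + 1 = i.+1%:Z by lia.
by rewrite !ww' ?(ltnW im).
Qed.

(** Both conditions on the closing path are convex, so every polygon on the
    segment between the two satisfies them and is simple. *)
Lemma closing_represents K X l m N w w' : oriented_knot_type K ->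
  affine X -> affine l -> (1 < m)%N -> (m < N)%N ->
  (forall i, w' (i + N%:Z) = w' i) ->
  (forall i : nat, (i <= m)%N -> w i%:Z = w' i%:Z) ->
  half_space_chain X m w -> monotone_closing X l m N w ->
  monotone_closing X l m N w' -> represents K N w -> represents K N w'.
Proof.
move=> typeK aX al m1 mN per' ww' ch [clX cll] [clX' cll'] rw.
have [[_ per _] _] := rw.
apply: (represents_linear typeK _ rw) => s s01.
have wsE (i : nat) : (i <= m)%N -> w i%:Z = interp s w w' i%:Z.
  by move=> im; rewrite /interp -ww'// -scalerDl subrK scale1r.
apply: (closing_simple aX al m1 mN).
- exact: interp_periodic.
- have [inj X0 Xm Xi] := ch; split.
  + move=> t u t1 u1; rewrite -!(pl_agree wsE)//; exact: inj.
  + by rewrite -(wsE 0%N).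
  + by rewrite -wsE.
  + by move=> i im; rewrite -wsE; [exact: Xi|lia].
- split=> i im; rewrite /interp ?aX ?al.
    have h1 := clX i im; have h2 := clX' i im; move: s01 => /andP[s0 s1].
    by rewrite addr_ge0 ?mulr_ge0 ?subr_ge0.
  exact: mix_lt s01 (cll i im) (cll' i im).
Qed.

End Closing.

(** * Chains and tails as lists of vertices *)

Section NormalForm.
Variable R : realType.
Local Notation "s `_ i" := (@nth (R3 R) 0 s i) : ring_scope.
Implicit Types (s t u c e : R) (x y a b : R3 R) (v d : seq (R3 R)) (X l : R3 R -> R).

Section ChainAndTail.
Variables (X : R3 R -> R) (v : seq (R3 R)).
Hypothesis aX : affine X.
Hypothesis v3 : (2 < size v)%N.
Hypotheses (Xhead : X (head (0 : R3 R) v) = 0) (Xlast : X (last (0 : R3 R) v) = 0).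
Hypothesis Xneg : forall i : nat, (0 < i < (size v).-1)%N -> X v`_i < 0.

Lemma vtx_cat_chain d (i : nat) : (i <= (size v).-1)%N -> vtx (v ++ d) i%:Z = v`_i.
Proof.
move=> im; have iv : (i < size v)%N by lia.
by rewrite vtx_nat ?size_cat ?nth_cat ?iv//; lia.
Qed.

Lemma vtx_cat_tail d (i : nat) : (i <= size d)%N ->
  vtx (v ++ d) (i + (size v).-1)%N%:Z = nth (0 : R3 R) (last (0 : R3 R) v :: d) i.
Proof.
case: i => [|i] id; first by rewrite add0n vtx_cat_chain// nth_last.
rewrite vtx_nat ?size_cat ?nth_cat; last by lia.
rewrite ifF; last by lia.
by rewrite /= (_ : (i.+1 + (size v).-1 - size v)%N = i)//; lia.
Qed.

Lemma vtx_cat_end d : vtx (v ++ d) (size (v ++ d))%:Z = head (0 : R3 R) v.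
Proof. by rewrite vtx_size nth_cat ifT ?nth0//; lia. Qed.

Lemma simple_half_space_chain d : (0 < size d)%N ->
  simple (size (v ++ d)) (vtx (v ++ d)) ->
  half_space_chain X (size v).-1 (vtx (v ++ d)).
Proof.
move=> d0 sv; split.
- move=> t u t1 u1 e; apply: (loop_inj_short (simple_loop sv) e).
  have : (size v).-1%:R < (size (v ++ d))%:R :> R by rewrite ltr_nat size_cat; lia.
  by rewrite ltr_norml; lra.
- by rewrite (@vtx_cat_chain _ 0%N)// nth0.
- by rewrite vtx_cat_chain// nth_last.
- by move=> i im; rewrite vtx_cat_chain ?Xneg//; lia.
Qed.

Lemma path_monotone_closing l d : (forall x, x \in d -> 0 <= X x) ->
  path (fun x y => l x < l y) (last (0 : R3 R) v) (rcons d (head (0 : R3 R) v)) ->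
  monotone_closing X l (size v).-1 (size (v ++ d)) (vtx (v ++ d)).
Proof.
move=> Xd /(pathP 0) inc; split=> i /andP[mi].
  rewrite leq_eqVlt => /orP[/eqP ->|iN]; first by rewrite vtx_cat_end Xhead.
  have -> : i = (i - (size v).-1 + (size v).-1)%N by lia.
  rewrite size_cat in iN; rewrite vtx_cat_tail; last by lia.
  have : (i - (size v).-1 <= size d)%N by lia.
  case: (i - (size v).-1)%N => [|j] jd; first by rewrite /= Xlast.
  by apply: Xd; apply: mem_nth; rewrite /= in jd *.
move=> iN; rewrite size_cat in iN.
have := inc (i - (size v).-1)%N; rewrite size_rcons => h.
have -> : i.+1 = ((i - (size v).-1).+1 + (size v).-1)%N by lia.
rewrite {1}(_ : i = (i - (size v).-1 + (size v).-1)%N); last by lia.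
have : (i - (size v).-1 <= size d)%N by lia.
move: (i - (size v).-1)%N h => j h jd.
rewrite vtx_cat_tail//.
have -> : l (vtx (v ++ d) (j.+1 + (size v).-1)%N%:Z) = l (nth (0 : R3 R) (rcons d (head (0 : R3 R) v)) j).
  congr l; rewrite nth_rcons; move: jd; rewrite leq_eqVlt => /orP[/eqP ->|jd].
    rewrite ltnn eqxx -(vtx_cat_end d); congr vtx; rewrite size_cat; lia.
  by rewrite jd vtx_cat_tail.
have := h (_ : (j < (size d).+1)%N); rewrite ltnS => /(_ jd).
by case: j jd {h} => [|j] jd //=; rewrite nth_rcons jd.
Qed.

Lemma closing_represents_seq K l d d' : oriented_knot_type K -> affine l ->
  (0 < size d)%N -> size d' = size d ->
  (forall x, x \in d -> 0 <= X x) -> (forall x, x \in d' -> 0 <= X x) ->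
  path (fun x y => l x < l y) (last (0 : R3 R) v) (rcons d (head (0 : R3 R) v)) ->
  path (fun x y => l x < l y) (last (0 : R3 R) v) (rcons d' (head (0 : R3 R) v)) ->
  represents K (size (v ++ d)) (vtx (v ++ d)) ->
  represents K (size (v ++ d')) (vtx (v ++ d')).
Proof.
move=> typeK al d0 dd' Xd Xd' pd pd' rd.
have e : size (v ++ d') = size (v ++ d) by rewrite !size_cat dd'.
have [sd _] := rd.
rewrite e; apply: (closing_represents typeK aX al _ _ _ _ (simple_half_space_chain d0 sd) _ _ rd).
- by lia.
- by rewrite size_cat; lia.
- by move=> i; rewrite -e vtx_periodic.
- by move=> i im; rewrite !vtx_cat_chain.
- exact: path_monotone_closing.
- by rewrite -e; exact: path_monotone_closing.
Qed.

(** The ends of the interval belong to the first and the last vertex of the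
    chain; the path that closes it starts at the last one. *)
Definition even_heights d := forall j : nat, (j < size d)%N ->
  (d`_j).2 = (last (0 : R3 R) v).2 + j.+1%:R / (size d).+1%:R * ((head (0 : R3 R) v).2 - (last (0 : R3 R) v).2).

(** The functional that is monotone is the height, signed so that it increases. *)
Lemma even_heights_path d : (head (0 : R3 R) v).2 != (last (0 : R3 R) v).2 -> even_heights d ->
  path (fun x y => ((head (0 : R3 R) v).2 - (last (0 : R3 R) v).2) * x.2 <
    ((head (0 : R3 R) v).2 - (last (0 : R3 R) v).2) * y.2)
    (last (0 : R3 R) v) (rcons d (head (0 : R3 R) v)).
Proof.
move=> ne hd; set r := _ - _; have r0 : r != 0 by rewrite subr_eq0.
have L0 : 0 < (size d).+1%:R :> R by rewrite ltr0n.
apply/(pathP 0) => i; rewrite size_rcons ltnS => id.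
have hE (j : nat) : (j <= (size d).+1)%N ->
    (nth (0 : R3 R) (last (0 : R3 R) v :: rcons d (head (0 : R3 R) v)) j).2 = (last (0 : R3 R) v).2 + j%:R / (size d).+1%:R * r.
  case: j => [|j] jd; first by rewrite /= mul0r mul0r addr0.
  rewrite /= nth_rcons; move: jd; rewrite ltnS leq_eqVlt => /orP[/eqP ->|jd].
    by rewrite ltnn eqxx divff ?gt_eqF// mul1r addrC subrK.
  by rewrite jd hd.
have := hE i.+1 id; rewrite [nth _ _ _.+1]/= => ->.
rewrite hE; last exact: ltnW.
rewrite -subr_gt0 -mulrBr opprD addrACA subrr add0r -mulrBl -mulrBl -natr1.
rewrite addrAC subrr add0r mulrCA mulr_gt0 ?divr_gt0//.
by rewrite -expr2 exprn_even_gt0.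
Qed.

End ChainAndTail.

(** A knot of the given type cut open: closing the chain in the opposite
    half-space by whatever vertices gives a knot of that type, provided that
    the heights of these vertices divide the interval between the ends evenly.
    Their horizontal positions stay free within the half-space, so that they can
    follow another knot. *)
Definition normal_chain (K : set (oriented_set R)) X v :=
  [/\ (2 < size v)%N, forall x, x \in v -> X x <= 0,
      (head (0 : R3 R) v).2 != (last (0 : R3 R) v).2 &
      forall d, (0 < size d)%N -> (forall x, x \in d -> 0 <= X x) ->
        even_heights v d -> represents K (size (v ++ d)) (vtx (v ++ d))].

Lemma seq_argmax (T : eqType) (f : T -> R) (s : seq T) : s != [::] ->
  exists2 m : T, m \in s & forall z : T, z \in s -> f z <= f m.
Proof.
elim: s => // w [|z s] IH _.
  by exists w; [rewrite inE|move=> z; rewrite inE => /eqP ->].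
have [//|m ms mP] := IH.
have [h|h] := leP (f w) (f m).
  exists m; first by rewrite inE ms orbT.
  by move=> u; rewrite inE => /orP[/eqP ->|/mP].
exists w; first by rewrite inE eqxx.
move=> u; rewrite inE => /orP[/eqP ->//|/mP uy].
exact: le_trans (ltW h).
Qed.

Lemma vtx_map (f : R3 R -> R3 R) v i : (0 < size v)%N ->
  vtx (map f v) i = f (vtx v i).
Proof.
move=> v0; have nz : (size v)%:Z != 0 by lia.
have h : (absz (i %% (size v)%:Z)%Z < size v)%N.
  by have := @ltz_pmod i (size v)%:Z; have := modz_ge0 i nz; lia.
by rewrite /vtx size_map (nth_map (0 : R3 R)).
Qed.

End NormalForm.

(** * Cutting a knot open at a farthest vertex *)

Section NormalChains.
Variable R : realType.
Local Notation "s `_ i" := (@nth (R3 R) 0 s i) : ring_scope.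
Local Notation hd v := (head (0 : R3 R) v).
Local Notation lst v := (last (0 : R3 R) v).
Implicit Types (s t u c e : R) (x y a b : R3 R) (v d : seq (R3 R)).

Lemma affine_x (q x0 : R) : affine (fun x : R3 R => q * x.1.1 - x0).
Proof.
move=> s a b; have -> : ((1 - s) *: a + s *: b).1.1 = (1 - s) * a.1.1 + s * b.1.1 by [].
ring.
Qed.

Lemma affine_zX (X : R3 R -> R) (r M : R) : affine X ->
  affine (fun x : R3 R => r * (x.2 + M * X x)).
Proof.
move=> aX s a b; rewrite aX.
have -> : ((1 - s) *: a + s *: b).2 = (1 - s) * a.2 + s * b.2 by [].
ring.
Qed.

Lemma affineE (X : R3 R -> R) a b c : affine X ->
  X (a + c *: (b - a)) = X a + c * (X b - X a).
Proof.
move=> aX; have -> : a + c *: (b - a) = (1 - c) *: a + c *: b.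
  by rewrite scalerBl scale1r scalerBr addrA addrAC.
by rewrite aX; ring.
Qed.

Section Tip.
Variables (K : set (oriented_set R)) (X : R3 R -> R) (v : seq (R3 R)) (tip : R3 R).
Hypotheses (typeK : oriented_knot_type K) (aX : affine X) (v3 : (2 < size v)%N).
Hypotheses (Xhead : X (hd v) = 0) (Xlast : X (lst v) = 0).
Hypothesis Xneg : forall i : nat, (0 < i < (size v).-1)%N -> X v`_i < 0.
Hypotheses (Xtip : 0 < X tip) (zne : (hd v).2 != (lst v).2).
Hypothesis rtip : represents K (size (v ++ [:: tip])) (vtx (v ++ [:: tip])).

Let even (n j : nat) := lst v + (j.+1%:R / n.+1%:R) *: (hd v - lst v).

(** The closing path through the tip and the straight segment between the ends
    are both monotone for the height after a shear, which fixes the cutting plane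
    and brings the tip to a height between those of the ends. *)
Lemma tip_to_segment n : (0 < n)%N -> represents K (size (v ++ [:: even n 0])) (vtx (v ++ [:: even n 0])).
Proof.
move=> n0; set m := even n 0.
pose za := (lst v).2; pose zb := (hd v).2; pose r := zb - za.
have r2 : 0 < r * r by rewrite -expr2 exprn_even_gt0//= subr_eq0.
have Xm : X m = 0 by rewrite affineE// Xhead Xlast subrr mulr0 addr0.
pose c : R := 1%:R / n.+1%:R.
have c0 : 0 < c by rewrite divr_gt0// ltr0n.
have c1 : c < 1 by rewrite ltr_pdivrMr ?ltr0n// mul1r ltr_nat.
have mz : m.2 = za + c * r by [].
move: m Xm mz => m Xm mz.
(* the shear that brings the tip to the height midway between the endpoints *)
pose M := ((za + zb) / 2 - tip.2) / X tip.
have Mt : M * X tip = (za + zb) / 2 - tip.2 by rewrite divfK// gt_eqF.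
have zbE : zb = za + r by rewrite addrC subrK.
apply: (@closing_represents_seq _ X v aX v3 Xhead Xlast Xneg K
  (fun x => r * (x.2 + M * X x)) [:: tip]) => //.
- exact: affine_zX.
- by move=> x; rewrite inE => /eqP ->; exact: ltW.
- by move=> x; rewrite inE => /eqP ->; rewrite Xm.
- rewrite /= Xhead Xlast Mt !mulr0 !addr0 -/za -/zb zbE.
  by rewrite !andbT; apply/andP; split; nra.
- rewrite /= Xhead Xlast Xm !mulr0 !addr0 -/za -/zb mz zbE.
  rewrite andbT; apply/andP; split; rewrite -subr_gt0.
    have -> : r * (za + c * r) - r * za = c * (r * r) by ring.
    exact: mulr_gt0.
  have -> : r * (za + r) - r * (za + c * r) = (1 - c) * (r * r) by ring.
  by rewrite mulr_gt0// subr_gt0.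
Qed.

(** Vertices are added on the last edge, one at a time. *)
Lemma subdivided_segment n (j : nat) : (j < n)%N ->
  represents K (size (v ++ mkseq (even n) j.+1)) (vtx (v ++ mkseq (even n) j.+1)).
Proof.
elim: j => [|j IH] jn; first exact: tip_to_segment.
have rj := IH (ltnW jn).
have n1 : 0 < n.+1%:R :> R by rewrite ltr0n.
pose c : R := (n.+1%:R - j.+1%:R)^-1.
have nj : 1 < n.+1%:R - j.+1%:R :> R.
  have : j.+1%:R + 1 < n.+1%:R :> R by rewrite natr1 ltr_nat.
  by lra.
have c0 : 0 < c by rewrite invr_gt0; lra.
have c1 : c < 1 by rewrite invf_lt1; lra.
have := represents_rcons c0 c1 rj.
set p := v ++ _ in rj *.
have -> : lst p = even n j by rewrite /p last_cat mkseqS last_rcons.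
have -> : hd p = hd v by rewrite /p; case: (v) v3.
have -> : even n j + c *: (hd v - even n j) = even n j.+1.
  rewrite /even; set a := lst v; set b := hd v.
  have -> : b - (a + (j.+1%:R / n.+1%:R) *: (b - a)) = (1 - j.+1%:R / n.+1%:R) *: (b - a).
    by rewrite scalerBl scale1r opprD addrA.
  rewrite scalerA -addrA -scalerDl; congr (_ + _ *: _).
  rewrite -[in RHS]natr1; rewrite /c; field.
  by rewrite !gt_eqF//; lra.
have -> : rcons p (even n j.+1) = v ++ mkseq (even n) j.+2.
  by rewrite /p -cats1 -catA cats1 -mkseqS.
suff -> : size (v ++ mkseq (even n) j.+2) = (size p).+1 by [].
by rewrite /p !size_cat !size_mkseq addnS.
Qed.

(** The closing segment, subdivided to have as many vertices as the given tail,
    is moved to that tail; both are monotone in height. *)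
Lemma tip_normal_chain d : (0 < size d)%N -> (forall x, x \in d -> 0 <= X x) ->
  even_heights v d -> represents K (size (v ++ d)) (vtx (v ++ d)).
Proof.
move=> d0 Xd hd_.
have r1 := @subdivided_segment (size d) (size d).-1 (_ : ((size d).-1 < size d)%N).
rewrite prednK// in r1; have {}r1 := r1 (leqnn _).
have Xe x : x \in mkseq (even (size d)) (size d) -> X x = 0.
  by move=> /mapP[j _ ->]; rewrite affineE// Xhead Xlast subrr mulr0 addr0.
apply: (@closing_represents_seq _ X v aX v3 Xhead Xlast Xneg K
  (fun x => ((hd v).2 - (lst v).2) * (x.2 + 0 * X x)) (mkseq (even (size d)) (size d))) => //.
- exact: affine_zX.
- by rewrite size_mkseq.
- by rewrite size_mkseq.
- by move=> x /Xe ->.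
- rewrite (eq_path (e' := fun x y => ((hd v).2 - (lst v).2) * x.2 <
    ((hd v).2 - (lst v).2) * y.2)); last by move=> x y; rewrite !mul0r !addr0.
  apply: even_heights_path => // j; rewrite size_mkseq => jd.
  by rewrite nth_mkseq.
- rewrite (eq_path (e' := fun x y => ((hd v).2 - (lst v).2) * x.2 <
    ((hd v).2 - (lst v).2) * y.2)); last by move=> x y; rewrite !mul0r !addr0.
  exact: even_heights_path.
Qed.

End Tip.

(** Cut the polygon along a plane just before a farthest vertex, which has been
    pushed outwards to be strictly farthest: the two edges at that vertex are
    the only ones that meet the plane. *)
Lemma exists_normal_chain (K : set (oriented_set R)) (s0 : seq (R3 R)) (q : R) :
  oriented_knot_type K -> q * q = 1 -> represents K (size s0) (vtx s0) ->
  exists v, normal_chain K (fun x => q * x.1.1) v.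
Proof.
move=> typeK qq r0.
have [[s2 _ _] _] := r0.
pose Y (x : R3 R) := q * x.1.1.
have [|tip0 ts tipP] := @seq_argmax _ _ Y s0; first by case: (s0) s2.
(* rotate the vertex that is farthest in the given direction to the end *)
have [s' r1] : exists2 s', size s' = (size s0).-1 & (forall y, y \in s' -> Y y <= Y tip0) /\
    represents K (size (rcons s' tip0)) (vtx (rcons s' tip0)).
  pose i := index tip0 s0.
  have is0 : (i < size s0)%N by rewrite index_mem.
  exists (drop i.+1 s0 ++ take i s0).
    have aux (n j : nat) : (j < n)%N -> (n - j.+1 + j)%N = n.-1 by lia.
    by rewrite size_cat size_drop size_takel ?(ltnW is0)// aux.
  split.
    by move=> y; rewrite mem_cat => /orP[/mem_drop|/mem_take] /tipP.
  have rE : rot 1 (rot i s0) = rcons (drop i.+1 s0 ++ take i s0) tip0.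
    by rewrite /i (rot_index ts) rot1_cons.
  rewrite -rE !size_rot.
  have h := represents_rot_seq (ltnW is0) r0.
  rewrite -[size s0](size_rot i); apply: represents_rot_seq; rewrite size_rot//.
  exact: leq_trans s2.
move=> [s'Y]; set p1 := rcons s' tip0 => r1'.
have s'2 : (1 < size s')%N by lia.
(* push it outwards *)
have [e e0 eP] := represents_perturb typeK r1'.
pose tip1 : R3 R := tip0 + (q * e, 0, 0).
have r2 : represents K (size (rcons s' tip1)) (vtx (rcons s' tip1)).
  have sz : size (rcons s' tip1) = size p1 by rewrite !size_rcons.
  rewrite sz; apply: eP => i; first by rewrite -sz vtx_periodic.
  rewrite /vtx -sz; set j := absz _.
  rewrite !nth_rcons; case: ifP => _; first by rewrite subrr normr0 ltW.
  case: ifP => _; last by rewrite subrr normr0 ltW.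
  have q1 : `|q| = 1.
    by apply/eqP; rewrite -sqrp_eq1// real_normK ?num_real// expr2 qq.
  rewrite /tip1 addrAC subrr add0r ler_normR3 /= normr0 (ltW e0) !andbT.
  by rewrite normrM q1 mul1r gtr0_norm.
have Ytip1 : Y tip1 = Y tip0 + e.
  by rewrite /Y /= mulrDr mulrA qq mul1r.
(* translate so that the cutting plane passes through the origin *)
pose x0 := Y tip0 + e / 2.
pose f (x : R3 R) := x + (- (q * x0), 0, 0).
have Yf x : Y (f x) = Y x - x0.
  by rewrite /Y /f /= mulrDr mulrN mulrA qq mul1r.
pose u := map f s'; pose tip := f tip1.
have r3 : represents K (size (rcons u tip)) (vtx (rcons u tip)).
  have -> : rcons u tip = map f (rcons s' tip1) by rewrite map_rcons.
  rewrite size_map; have := represents_translate typeK (- (q * x0), 0, 0) r2.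
  suff -> : (fun i => vtx (rcons s' tip1) i + (- (q * x0), 0, 0)) =
    vtx (map f (rcons s' tip1)) by [].
  by apply/funext => i; rewrite vtx_map// size_rcons.
have uneg x : x \in u -> Y x < 0.
  by move=> /mapP[y ys ->]; rewrite Yf /x0; have := s'Y y ys; lra.
have Ytip : 0 < Y tip by rewrite Yf Ytip1 /x0; lra.
have u2 : (1 < size u)%N by rewrite size_map.
move: u tip r3 uneg Ytip u2 => {s' r1 s'Y p1 r1' s'2 e e0 eP tip1 r2 Ytip1 x0 f Yf}.
move=> u tip r3 uneg Ytip u2.
have aY : affine Y.
  by move=> t a b; have := affine_x q 0 t a b; rewrite !subr0.
have cut a b : Y a < 0 -> 0 < Y b -> exists2 c, 0 < c < 1 & Y (a + c *: (b - a)) = 0.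
  move=> a0 b0; have ab : 0 < Y b - Y a by lra.
  exists (- Y a / (Y b - Y a)); last by rewrite affineE// divfK ?gt_eqF// subrr.
  by rewrite divr_gt0 ?oppr_gt0//= ltr_pdivrMr//; lra.
have cut' a b : 0 < Y a -> Y b < 0 -> exists2 c, 0 < c < 1 & Y (a + c *: (b - a)) = 0.
  move=> a0 b0; have ab : 0 < Y a - Y b by lra.
  exists (Y a / (Y a - Y b)).
    by rewrite divr_gt0//= ltr_pdivrMr//; lra.
  rewrite affineE//; have -> : Y b - Y a = - (Y a - Y b) by rewrite opprB.
  by rewrite mulrN divfK ?gt_eqF// subrr.
have hu : Y (hd u) < 0 by apply: uneg; case: (u) u2 => //= z ? _; rewrite inE eqxx.
have lu : Y (lst u) < 0.
  by apply: uneg; case: (u) u2 => //= z ? _; exact: mem_last.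
have [ca /andP[ca0 ca1] Ya] := cut _ _ lu Ytip.
set a := _ + _ in Ya.
have r4 : represents K (size (rcons (rcons u a) tip)) (vtx (rcons (rcons u a) tip)).
  have h1 : represents K (size (tip :: u)) (vtx (tip :: u)).
    have e : rot (size u) (rcons u tip) = tip :: u by rewrite -cats1 rot_size_cat.
    rewrite -e size_rot; apply: represents_rot_seq => //.
    by rewrite size_rcons.
  have := represents_rcons ca0 ca1 h1.
  have -> : lst (tip :: u) = lst u by case: (u) u2.
  rewrite [hd _]/= -/a => h2.
  have h3 : represents K (size (rcons (tip :: u) a)) (vtx (rcons (tip :: u) a)).
    by rewrite size_rcons.
  have := @represents_rot_seq _ _ _ 1 _ h3; rewrite rot1_cons.
  by rewrite !size_rcons /= => /(_ isT).
have [cb /andP[cb0 cb1] Yb] := cut' _ _ Ytip hu.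
set b := _ + _ in Yb.
have r5 : represents K (size (b :: rcons (rcons u a) tip)) (vtx (b :: rcons (rcons u a) tip)).
  have := represents_rcons cb0 cb1 r4.
  rewrite last_rcons; have -> : hd (rcons (rcons u a) tip) = hd u by case: (u) u2.
  rewrite -/b => h2.
  set z := rcons (rcons u a) tip in h2 *.
  have h3 : represents K (size (rcons z b)) (vtx (rcons z b)) by rewrite size_rcons.
  have e : rot (size z) (rcons z b) = b :: z by rewrite -cats1 rot_size_cat.
  have hz : (size z <= size (rcons z b))%N by rewrite size_rcons leqnSn.
  rewrite -e size_rot; exact: represents_rot_seq hz h3.
move: b Yb r5 => b Yb r5.
(* the ends must have different heights for a closing path to be monotone *)
have [b' [Yb' bz] r6] : exists2 b', Y b' = 0 /\ b'.2 != a.2 &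
    represents K (size (b' :: rcons (rcons u a) tip)) (vtx (b' :: rcons (rcons u a) tip)).
  have [ez|nz] := eqVneq b.2 a.2; last by exists b.
  have [e e0 eP] := represents_perturb typeK r5.
  exists (b + (0, 0, e)).
    split; first by rewrite /Y /= addr0.
    by rewrite /= ez -subr_eq0 addrAC subrr add0r gt_eqF.
  apply: eP => i; first exact: (vtx_periodic (b + (0, 0, e) :: rcons (rcons u a) tip)).
  rewrite /vtx /=; case: (absz _) => [|j] /=; last by rewrite subrr normr0 ltW.
  by rewrite addrAC subrr add0r ler_normR3 /= normr0 gtr0_norm// lexx ltW.
pose v := b' :: rcons u a.
have v3 : (2 < size v)%N by rewrite /v /= size_rcons !ltnS ltnW.
have vlast : lst v = a by rewrite /v /= last_rcons.
have vneg (i : nat) : (0 < i < (size v).-1)%N -> Y v`_i < 0.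
  rewrite /v /= size_rcons; case: i => // i /= iu; rewrite nth_rcons.
  by rewrite -ltnS iu; apply: uneg; apply: mem_nth; rewrite -ltnS.
exists v; split=> //.
- move=> x; rewrite /v inE mem_rcons inE => /or3P[/eqP ->|/eqP ->|/uneg/ltW//].
    by rewrite -/(Y b') Yb'.
  by rewrite -/(Y a) Ya.
- by rewrite vlast.
- apply: (@tip_normal_chain K Y v tip) => //; first by rewrite vlast.
    by rewrite vlast.
  by rewrite cats1.
Qed.

End NormalChains.

(** * Planar points in general position *)

Section GeneralPosition.
Variable R : realType.
Implicit Types (p a b c d e f : R * R) (u v w : R3 R) (s : seq (R * R)).

Definition cross u v : R3 R :=
  (u.1.2 * v.2 - u.2 * v.1.2, u.2 * v.1.1 - u.1.1 * v.2, u.1.1 * v.1.2 - u.1.2 * v.1.1).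

Definition dot u v : R := u.1.1 * v.1.1 + u.1.2 * v.1.2 + u.2 * v.2.

(** Points and lines of the plane in homogeneous coordinates:
    [cross (homog a) (homog b)] is the line through two points, and the cross
    product of two lines is their common point. *)
Definition homog p : R3 R := (p.1, p.2, 1).

(** It vanishes when the three points are on a line. *)
Definition area a b c := dot (homog a) (cross (homog b) (homog c)).

(** It vanishes when the lines [a b], [c d] and [e f] have a common point. *)
Definition concurrency a b c d e f :=
  dot (cross (homog a) (homog b)) (cross (cross (homog c) (homog d)) (cross (homog e) (homog f))).

Definition generic s := [/\ uniq s,
  forall a b c, a \in s -> b \in s -> c \in s -> uniq [:: a; b; c] -> area a b c != 0 &
  forall a b c d e f, a \in s -> b \in s -> c \in s -> d \in s -> e \in s -> f \in s ->
    uniq [:: a; b; c; d; e; f] -> concurrency a b c d e f != 0].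

Lemma area_rot a b c : area b c a = area a b c.
Proof. rewrite /area /dot /cross /=; ring. Qed.

Lemma concurrency_swap a b c d e f : concurrency b a c d e f = - concurrency a b c d e f.
Proof. rewrite /concurrency /dot /cross /=; ring. Qed.

Lemma concurrency_rot a b c d e f : concurrency c d e f a b = concurrency a b c d e f.
Proof. rewrite /concurrency /dot /cross /=; ring. Qed.

Lemma concurrencyE a b c d e f : concurrency a b c d e f =
  dot (homog a) (cross (homog b) (cross (cross (homog c) (homog d)) (cross (homog e) (homog f)))).
Proof. rewrite /concurrency /dot /cross /=; ring. Qed.

(** The concurrency of [a b], [c d] and [e f] is linear in [homog a]; its value at
    [a = c] shows that it is not identically zero when the other points are in
    general position. *)
Lemma dot_concurrency b c d e f :
  dot (homog c) (cross (homog b) (cross (cross (homog c) (homog d)) (cross (homog e) (homog f)))) =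
  - (area c e f * area b c d).
Proof. rewrite /area /dot /cross /=; ring. Qed.

(** Finitely many lines meet a parabola through the given point in finitely many
    points: their equations multiply to a nonzero polynomial along it. *)
Lemma avoid_lines (L : seq (R3 R)) p (eps : R) : 0 < eps -> 0 \notin L ->
  exists2 p', `|p' - p| <= eps & forall l, l \in L -> dot (homog p') l != 0.
Proof.
move=> eps0 L0.
pose P (l : R3 R) : {poly R} :=
  l.1.2 *: 'X^2 + l.1.1 *: 'X + (l.1.1 * p.1 + l.1.2 * p.2 + l.2)%:P.
have PE l t : (P l).[t] = dot (homog (p.1 + t, p.2 + t ^+ 2)) l.
  by rewrite /P !hornerE /dot /=; ring.
have P0 l : l != 0 -> P l != 0.
  apply: contraNneq => Pl.
  have c2 : (P l)`_2 = l.1.2.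
    by rewrite /P !coefD !coefZ coefXn coefX coefC /= mulr1 mulr0 !addr0.
  have c1 : (P l)`_1 = l.1.1.
    by rewrite /P !coefD !coefZ coefXn coefX coefC /= mulr1 mulr0 add0r addr0.
  have c0 : (P l)`_0 = l.1.1 * p.1 + l.1.2 * p.2 + l.2.
    by rewrite /P !coefD !coefZ coefXn coefX coefC /= !mulr0 !add0r.
  move: c0 c1 c2; rewrite Pl !coef0; case: l Pl => [[l1 l2] l3] /= _ h0 h1 h2.
  rewrite -h1 -h2 !mul0r !add0r in h0.
  by rewrite -h0 -h1 -h2.
pose Q := \prod_(l <- L) P l.
have Q0 : Q != 0.
  rewrite /Q prodf_seq_neq0; apply/allP => l lL /=; apply: P0.
  by apply: contraNneq L0 => <-.
pose e1 := Num.min eps 1.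
have e10 : 0 < e1 by rewrite lt_min eps0 ltr01.
pose rs := [seq e1 / k.+1%:R | k <- iota 0 (size Q)].
have urs : uniq rs.
  rewrite map_inj_uniq ?iota_uniq// => i j /(mulfI (lt0r_neq0 e10))/invr_inj/eqP.
  by rewrite eqr_nat => /eqP[].
have [t trs tQ] : exists2 t, t \in rs & ~~ root Q t.
  apply/hasP; apply/negPn/negP; rewrite -all_predC => h.
  have all_root : all (root Q) rs.
    by apply: sub_all h => x /=; rewrite negbK.
  have := max_poly_roots Q0 all_root urs.
  by rewrite size_map size_iota ltnn.
have [t0 te] : 0 < t /\ t <= e1.
  move/mapP: trs => [k _ ->]; rewrite divr_gt0// ler_pdivrMr//; split=> //.
  by apply: ler_peMr; rewrite ?ler1n ?(ltW e10).
have tE : t <= eps by apply: le_trans te _; rewrite ge_min lexx.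
have t1 : t <= 1 by apply: le_trans te _; rewrite ge_min lexx orbT.
exists (p.1 + t, p.2 + t ^+ 2).
  rewrite prod_normE ge_max /= !(addrAC _ _ (- _)) !subrr !add0r.
  rewrite !ger0_norm ?sqr_ge0 ?(ltW t0)// tE /= (le_trans _ tE)//.
  by rewrite expr2 ler_piMl// ltW.
move=> l lL; rewrite -PE; apply: contraNneq tQ => h.
by rewrite /root /Q horner_prod prodf_seq_eq0; apply/hasP; exists l => //=; rewrite h.
Qed.

Lemma cross_homog_neq0 b c : b != c -> cross (homog b) (homog c) != 0.
Proof.
apply: contraNneq => -[h1 h2 _]; case: b c h1 h2 => [b1 b2] [c1 c2] /= h1 h2.
by apply/eqP; congr pair; lra.
Qed.

(** The new point must avoid finitely many lines: the vertical lines through the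
    old points, to differ from them, the lines through two old points, and the
    lines from an old point to the intersection of two lines through old points. *)
Lemma generic_extend s p (eps : R) : 0 < eps -> generic s ->
  exists2 p', `|p' - p| <= eps & generic (p' :: s).
Proof.
move=> eps0 [us gD gT].
pose L1 := [seq (1, 0, - x.1) | x <- s] : seq (R3 R).
pose L2 := [seq cross (homog b) (homog c) | b <- s, c <- s].
pose L3 := [seq cross (homog x.1) (cross (cross (homog x.2) (homog y.1.1)) (cross (homog y.1.2) (homog y.2)))
  | x <- [seq (b, c) | b <- s, c <- s], y <- [seq (x, f) | x <- [seq (d, e) | d <- s, e <- s], f <- s]].
pose L := [seq l <- L1 ++ L2 ++ L3 | l != 0].
have [|p' p'P av] := @avoid_lines L p eps eps0.
  by rewrite mem_filter eqxx.
exists p' => //.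
have avoid l : l \in L1 ++ L2 ++ L3 -> l != 0 -> dot (homog p') l != 0.
  by move=> lL l0; apply: av; rewrite mem_filter l0.
have p's : p' \notin s.
  apply/negP => ps; have : dot (homog p') (1, 0, - p'.1) != 0.
    apply: avoid; first by rewrite mem_cat; apply/orP; left; apply/mapP; exists p'.
    by apply/eqP => -[] /eqP; rewrite oner_eq0.
  by rewrite /dot /= mulr1 mulr0 addr0 mul1r subrr eqxx.
have areaP b c : b \in s -> c \in s -> b != c -> area p' b c != 0.
  move=> bs cs bc; apply: avoid; last exact: cross_homog_neq0.
  by rewrite !mem_cat; apply/orP; right; apply/orP; left; apply: allpairs_f.
have concP b c d e f : b \in s -> c \in s -> d \in s -> e \in s -> f \in s ->
    uniq [:: b; c; d; e; f] -> concurrency p' b c d e f != 0.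
  move=> bs cs ds es fs u5; rewrite concurrencyE; apply: avoid.
    rewrite !mem_cat; apply/orP; right; apply/orP; right.
    apply/allpairsPdep; exists (b, c), ((d, e), f); split.
    - exact: allpairs_f.
    - by apply: allpairs_f => //; exact: allpairs_f.
    - by [].
  apply/eqP => h; have := dot_concurrency b c d e f.
  rewrite h /dot /= !mulr0 !addr0 => /esym/eqP; rewrite oppr_eq0 mulf_eq0.
  move: u5; rewrite /= !inE !negb_or => /and5P[/and4P[bc bd be bf] /and3P[cd ce cf] /andP[de df] ef _].
  rewrite (negbTE (gD _ _ _ cs es fs _)) ?(negbTE (gD _ _ _ bs cs ds _))//.
    by rewrite /= !inE !negb_or bc bd cd.
  by rewrite /= !inE !negb_or ce cf ef.
have in_s x : x \in p' :: s -> x != p' -> x \in s.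
  by rewrite inE => /orP[->|].
split; first by rewrite /= p's.
- have first b c : b \in p' :: s -> c \in p' :: s -> uniq [:: p'; b; c] -> area p' b c != 0.
    move=> bs cs; rewrite /= !inE !negb_or => /and3P[/andP[pb pc] bc _].
    by apply: areaP => //; apply: in_s => //; rewrite eq_sym.
  move=> a b c As Bs Cs u3.
  have [ea|na] := eqVneq a p'; first by subst a; exact: first.
  have [eb|nb] := eqVneq b p'.
    subst b; rewrite -area_rot; apply: first => //.
    by rewrite -(rot_uniq 2).
  have [ec|nc] := eqVneq c p'.
    subst c; rewrite area_rot; apply: first => //.
    by rewrite -(rot_uniq 1).
  by apply: gD => //; exact: in_s.
- have first b c d e f : b \in p' :: s -> c \in p' :: s -> d \in p' :: s ->
      e \in p' :: s -> f \in p' :: s -> uniq [:: p'; b; c; d; e; f] ->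
      concurrency p' b c d e f != 0.
    move=> bs cs ds es fs; rewrite cons_uniq => /andP[pn u5].
    move: pn; rewrite !inE !negb_or => /and5P[pb pc pd pe pf].
    by apply: concP => //; apply: in_s => //; rewrite eq_sym.
  have swap a b c d e f : uniq [:: a; b; c; d; e; f] -> uniq [:: b; a; c; d; e; f].
    move=> u6; rewrite (perm_uniq (_ : perm_eq _ [:: a; b; c; d; e; f]))//.
    by rewrite -[[:: b, a & _]]/([:: b; a] ++ _) -[[:: a, b & _]]/([:: a; b] ++ _)
      perm_cat2r -[[:: b; a]]/([:: b] ++ [:: a]) perm_catC.
  have rot2 a b c d e f : uniq [:: a; b; c; d; e; f] -> uniq [:: c; d; e; f; a; b].
    by rewrite -(rot_uniq 2).
  have second a b c d e f : a \in p' :: s -> b \in p' :: s -> c \in p' :: s ->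
      d \in p' :: s -> e \in p' :: s -> f \in p' :: s ->
      uniq [:: a; b; c; d; e; f] -> (a == p') || (b == p') ->
      concurrency a b c d e f != 0.
    move=> As Bs Cs Ds Es Fs u6 /orP[/eqP ea|/eqP eb]; first by subst a; exact: first.
    subst b; rewrite concurrency_swap oppr_eq0; apply: first => //; exact: swap.
  move=> a b c d e f As Bs Cs Ds Es Fs u6.
  have [h|h1] := boolP ((a == p') || (b == p')); first exact: second.
  have [h|h2] := boolP ((c == p') || (d == p')).
    by rewrite -concurrency_rot; apply: second => //; exact: rot2.
  have [h|h3] := boolP ((e == p') || (f == p')).
    rewrite -concurrency_rot -concurrency_rot; apply: second => //.
    exact/rot2/rot2.
  move: h1 h2 h3; rewrite !negb_or => /andP[? ?] /andP[? ?] /andP[? ?].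
  by apply: gT => //; exact: in_s.
Qed.

Lemma generic_approx s (eps : R) : 0 < eps -> exists2 s', size s' = size s &
  generic s' /\ forall i, (i < size s)%N -> `|nth 0 s' i - nth 0 s i| <= eps.
Proof.
move=> eps0; elim: s => [|p s [s' sz [gs' sP]]]; first by exists [::].
have [p' p'P gp'] := generic_extend p eps0 gs'.
exists (p' :: s'); first by rewrite /= sz.
by split=> // -[|i] //=; exact: sP.
Qed.

End GeneralPosition.

(** * Crossings of a generic closed polygon *)

Section Crossings.
Variable R : realType.
Implicit Types (A B C D E F P : R * R) (t u : R) (i j k : nat).

Lemma homog_mix A B (s : R) : homog ((1 - s) *: A + s *: B) =
  ((1 - s) * A.1 + s * B.1, (1 - s) * A.2 + s * B.2, 1).
Proof. by []. Qed.

Lemma area_mix A B C D (s : R) :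
  area ((1 - s) *: A + s *: B) C D = (1 - s) * area A C D + s * area B C D.
Proof. rewrite /area homog_mix /dot /cross /homog /=; ring. Qed.

Lemma area_eq0 A C : area A A C = 0 /\ area C A C = 0.
Proof. by split; rewrite /area /dot /cross /homog /=; ring. Qed.

(** The incidence lemmas below evaluate the area with two points fixed, which
    is affine along an edge and vanishes on the line through these points. *)
Lemma area_mix_line C D (s : R) : area ((1 - s) *: C + s *: D) C D = 0.
Proof. rewrite /area homog_mix /dot /cross /homog /=; ring. Qed.

Lemma edge_point_inj A B C (s s' : R) : area A B C != 0 ->
  (1 - s) *: A + s *: B = (1 - s') *: A + s' *: B -> s = s'.
Proof.
move=> h /(congr1 (fun P => area P B C)); rewrite !area_mix (area_eq0 B C).1.
by rewrite !mulr0 !addr0 => /(mulIf h); lra.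
Qed.

Lemma adjacent_edges_disjoint A B C (s s' : R) : area A B C != 0 -> s < 1 ->
  (1 - s) *: A + s *: B <> (1 - s') *: B + s' *: C.
Proof.
move=> h s1 /(congr1 (fun P => area P B C)).
rewrite area_mix_line area_mix (area_eq0 B C).1 mulr0 addr0 => /eqP.
by rewrite mulf_eq0 (negbTE h) orbF; lra.
Qed.

Lemma two_edges_one_point A B C D (s s' r r' : R) : area A C D != 0 ->
  (1 - s) *: A + s *: B = (1 - r) *: C + r *: D ->
  (1 - s') *: A + s' *: B = (1 - r') *: C + r' *: D -> s = s'.
Proof.
move=> h /(congr1 (fun P => area P C D)) + /(congr1 (fun P => area P C D)).
rewrite !area_mix_line !area_mix => e e'.
have : (s - s') * area A C D = 0.
  set a := area A C D in e e' *; set b := area B C D in e e'.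
  have : (1 - s') * ((1 - s) * a + s * b) - (1 - s) * ((1 - s') * a + s' * b) = 0.
    by rewrite e e' !mulr0 subrr.
  have -> : (1 - s') * ((1 - s) * a + s * b) - (1 - s) * ((1 - s') * a + s' * b) = (s - s') * b by ring.
  move=> /eqP; rewrite mulf_eq0 => /orP[/eqP ->|/eqP b0]; first by rewrite mul0r.
  have : (s - s') * a = ((1 - s') * a + s' * b) - ((1 - s) * a + s * b) - (s' - s) * b by ring.
  by rewrite e e' b0 mulr0 !subr0.
by move=> /eqP; rewrite mulf_eq0 (negbTE h) orbF subr_eq0 => /eqP.
Qed.

(** Concurrency is a combination of the areas that the common point spans with
    the three edges. *)
Lemma three_edges_concurrent P A B C D E F (r s t : R) :
  P = (1 - r) *: A + r *: B -> P = (1 - s) *: C + s *: D -> P = (1 - t) *: E + t *: F ->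
  concurrency A B C D E F = 0.
Proof.
move=> eA eC eE.
have h1 : area P A B = 0 by rewrite eA area_mix_line.
have h2 : area P C D = 0 by rewrite eC area_mix_line.
have h3 : area P E F = 0 by rewrite eE area_mix_line.
have -> : concurrency A B C D E F =
    area P A B * (cross (cross (homog C) (homog D)) (cross (homog E) (homog F))).2 +
    area P C D * (cross (cross (homog E) (homog F)) (cross (homog A) (homog B))).2 +
    area P E F * (cross (cross (homog A) (homog B)) (cross (homog C) (homog D))).2.
  rewrite /concurrency /area /dot /cross /homog /=; ring.
by rewrite h1 h2 h3 !mul0r !addr0.
Qed.

Lemma seq_gap (L : seq R) : exists2 d, 0 < d &
  forall x y, x \in L -> y \in L -> `|x - y| < d -> x = y.
Proof.
have one z : exists2 e, 0 < e & forall y, y \in L -> `|z - y| < e -> z = y.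
  elim: L => [|w L [e e0 eP]]; first by exists 1.
  have [zw|zw] := eqVneq z w.
    by exists e => // y; rewrite inE => /orP[/eqP ->//|yL]; exact: eP.
  exists (Num.min e `|z - w|); first by rewrite lt_min e0 normr_gt0 subr_eq0.
  move=> y; rewrite inE lt_min => /orP[/eqP ->|yL] /andP[h1 h2]; last exact: eP.
  by rewrite ltxx in h2.
have all_ (L' : seq R) : exists2 e, 0 < e &
    forall x y, x \in L' -> y \in L -> `|x - y| < e -> x = y.
  elim: L' => [|z L' [e e0 eP]]; first by exists 1.
  have [e' e'0 e'P] := one z.
  exists (Num.min e e'); first by rewrite lt_min e0.
  move=> x y; rewrite inE lt_min => /orP[/eqP ->|xL] yL /andP[h1 h2].
    exact: e'P.
  exact: eP.
exact: all_.
Qed.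

Section GenericPolygon.
Variables (N : nat) (g : int -> R * R).
Hypotheses (N3 : (2 < N)%N) (g_per : forall i : int, g (i + N%:Z) = g i).
Hypothesis g3 : forall i j k, (i < N)%N -> (j < N)%N -> (k < N)%N ->
  uniq [:: i; j; k] -> area (g i%:Z) (g j%:Z) (g k%:Z) != 0.
Hypothesis g6 : forall i j k i' j' k', (i < N)%N -> (j < N)%N -> (k < N)%N ->
  (i' < N)%N -> (j' < N)%N -> (k' < N)%N -> uniq [:: i; i'; j; j'; k; k'] ->
  concurrency (g i%:Z) (g i'%:Z) (g j%:Z) (g j'%:Z) (g k%:Z) (g k'%:Z) != 0.

Definition crossing t u := pl g t = pl g u /\ ~ exists k : int, t = u + k%:~R * N%:R.

Let nxt i := if i.+1 == N then 0%N else i.+1.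

Lemma nxtP i : (i < N)%N -> (nxt i < N)%N /\ g i.+1%:Z = g (nxt i)%:Z.
Proof.
move=> iN; rewrite /nxt; case: eqP => [->|ne]; last by split=> //; lia.
by split; [lia|rewrite -[N%:Z]add0r g_per].
Qed.

Lemma nxtE i : (i.+1 = N /\ nxt i = 0%N) \/ (i.+1 <> N /\ nxt i = i.+1).
Proof. by rewrite /nxt; case: eqP; [left|right]. Qed.

Lemma pl_cell i t : (i < N)%N -> i%:R <= t -> t < i%:R + 1 ->
  pl g t = (1 - (t - i%:R)) *: g i%:Z + (t - i%:R) *: g (nxt i)%:Z.
Proof.
move=> iN it ti; have [_ <-] := nxtP iN.
rewrite (@plE _ _ g i%:Z) -?pmulrn// ?(ltW ti)//.
have -> : i.+1%:Z = i%:Z + 1 by lia.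
set c := t - _; rewrite (scalerBl 1 c) scale1r scalerBr.
by rewrite [RHS]addrAC addrA.
Qed.

(** In general position neither an edge nor two adjacent edges produce a
    crossing, so the two edges involved have four different end points. *)
Lemma crossing_cells i j t u : (i < N)%N -> (j < N)%N ->
  i%:R <= t -> t < i%:R + 1 -> j%:R <= u -> u < j%:R + 1 ->
  pl g t = pl g u -> t <> u -> uniq [:: i; nxt i; j; nxt j].
Proof.
move=> iN jN it ti ju uj e tu.
have [niN _] := nxtP iN; have [njN _] := nxtP jN.
have ci := pl_cell iN it ti; have cj := pl_cell jN ju uj.
have [nniN _] := nxtP niN; have [nnjN _] := nxtP njN.
have u3 k : (k < N)%N -> uniq [:: k; nxt k; nxt (nxt k)].
  move=> kN; have [[? ->]|[? ->]] := nxtE k.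
    by have [[? ->]|[? ->]] := nxtE 0%N; rewrite /= !inE; lia.
  by have [[? ->]|[? ->]] := nxtE k.+1; rewrite /= !inE; lia.
have ij : i <> j.
  move=> ij; subst j; apply: tu.
  rewrite ci cj in e.
  have := edge_point_inj (g3 iN niN nniN (u3 i iN)) e; lra.
have nij : nxt i <> j.
  move=> h; subst j; rewrite ci cj in e.
  by apply: adjacent_edges_disjoint (g3 iN niN nniN (u3 i iN)) _ e; lra.
have nji : nxt j <> i.
  move=> h; subst i; rewrite ci cj in e.
  by apply: adjacent_edges_disjoint (g3 jN njN nnjN (u3 j jN)) _ (esym e); lra.
clear -ij nij nji iN jN; move: ij nij nji.
have [[? ->]|[? ->]] := nxtE i; have [[? ->]|[? ->]] := nxtE j;
  rewrite /= !inE; lia.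
Qed.

Lemma crossing_sym t u : crossing t u -> crossing u t.
Proof.
move=> [e n]; split=> // -[k ek]; apply: n; exists (- k).
by rewrite mulrNz mulNr; lra.
Qed.

Lemma crossing_shift t u (k l : int) : crossing t u ->
  crossing (t + k%:~R * N%:R) (u + l%:~R * N%:R).
Proof.
have pp v (m : int) : pl g (v + m%:~R * N%:R) = pl g v.
  by apply: periodicMz => w; exact: pl_periodic.
move=> [e n]; split; first by rewrite !pp.
move=> [m em]; apply: n; exists (m + l - k).
by rewrite intrB intrD; lra.
Qed.

Lemma crossing_reduce t u : crossing t u -> exists t' u' (k l : int),
  [/\ 0 <= t' < N%:R, 0 <= u' < N%:R, t = t' + k%:~R * N%:R, u = u' + l%:~R * N%:R &
      crossing t' u' /\ t' <> u'].
Proof.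
have N0 : 0 < N%:R :> R by rewrite ltr0n; lia.
move=> c; have [t' t1 [k ek]] := floor_period t N0; have [u' u1 [l el]] := floor_period u N0.
exists t', u', k, l; split=> //.
have c' : crossing t' u'.
  have := crossing_shift (- k) (- l) c; rewrite !mulrNz !mulNr ek el.
  by rewrite !addrK.
split=> // e; case: c' => _; apply; exists 0; rewrite mul0r addr0 //.
Qed.

(** Three strands through one point would lie on three edges without common
    vertices, and the lines of such edges are not concurrent. *)
Lemma crossing_partner t u u' : crossing t u -> crossing t u' ->
  exists k : int, u = u' + k%:~R * N%:R.
Proof.
have N0 : 0 < N%:R :> R by rewrite ltr0n; lia.
move=> c c'; apply: contrapT => nu.
have c'' : crossing u u' by split=> //; case: c => <- _; case: c'.
have [t0 [u0 [k [l [t01 u01 ek el [c0 n0]]]]]] := crossing_reduce c.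
have [v0 v01 [m em]] := floor_period u' N0.
have c1 : crossing t0 v0.
  have := crossing_shift (- k) (- m) c'; rewrite !mulrNz !mulNr ek em !addrK //.
have c2 : crossing u0 v0.
  have := crossing_shift (- l) (- m) c''; rewrite !mulrNz !mulNr el em !addrK //.
have ne x y : crossing x y -> x <> y.
  by move=> [_ h] e; apply: h; exists 0; rewrite mul0r addr0.
move: t01 u01 v01 => /andP[ta tb] /andP[ua ub] /andP[va vb].
have [i [iN it ti]] := nat_cell ta tb.
have [j [jN ju uj]] := nat_cell ua ub.
have [p [pN pv vp]] := nat_cell va vb.
have d1 := crossing_cells iN jN it ti ju uj c0.1 n0.
have d2 := crossing_cells iN pN it ti pv vp c1.1 (ne _ _ c1).
have d3 := crossing_cells jN pN ju uj pv vp c2.1 (ne _ _ c2).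
have u6 : uniq [:: i; nxt i; j; nxt j; p; nxt p].
  move: d1 d2 d3; rewrite /= !inE !negb_or !andbT.
  move=> /and3P[/and3P[? ? ?] /andP[? ?] ?] /and3P[/and3P[? ? ?] /andP[? ?] ?].
  move=> /and3P[/and3P[? ? ?] /andP[? ?] ?].
  by do !(apply/andP; split).
have [niN _] := nxtP iN; have [njN _] := nxtP jN; have [npN _] := nxtP pN.
have /eqP := g6 iN jN pN niN njN npN u6; apply.
apply: (@three_edges_concurrent (pl g t0)).
- exact: pl_cell.
- by rewrite c0.1; exact: pl_cell.
- by rewrite c1.1; exact: pl_cell.
Qed.

(** Two edges cross at most once, so there are finitely many crossings in a
    period.  Their translates by one period are included in the list in order to
    compare crossings on both sides of the origin. *)
Lemma crossing_discrete : exists2 d, 0 < d & forall t t' u u', crossing t u ->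
  crossing t' u' -> `|t - t'| < d -> t = t'.
Proof.
have N0 : 0 < N%:R :> R by rewrite ltr0n; lia.
have /choice[tau tauP] : forall ij : nat * nat, exists x : R, forall t u,
    [/\ (ij.1 < N)%N, (ij.2 < N)%N, ij.1%:R <= t < ij.1%:R + 1, ij.2%:R <= u < ij.2%:R + 1 &
      pl g t = pl g u /\ t <> u] -> t = x.
  move=> [i j] /=; have [[t [u [iN jN /andP[it ti] /andP[ju uj] [e ne]]]]|no] := pselect (exists t u,
    [/\ (i < N)%N, (j < N)%N, i%:R <= t < i%:R + 1, j%:R <= u < j%:R + 1 & pl g t = pl g u /\ t <> u]).
    exists t => t' u' [_ _ /andP[it' ti'] /andP[ju' uj'] [e' ne']].
    have := crossing_cells iN jN it ti ju uj e ne.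
    have [niN _] := nxtP iN; have [njN _] := nxtP jN.
    rewrite (pl_cell iN it ti) (pl_cell jN ju uj) in e.
    rewrite (pl_cell iN it' ti') (pl_cell jN ju' uj') in e'.
    move=> u4.
    have u3 : uniq [:: i; j; nxt j].
      move: u4; rewrite /= !inE !negb_or !andbT.
      move=> /and3P[/and3P[? ? ?] /andP[? ?] ?].
      by do !(apply/andP; split).
    by have := two_edges_one_point (g3 iN jN njN u3) e e'; lra.
  by exists 0 => t u h; exfalso; apply: no; exists t, u.
pose L := [seq tau (i, j) | i <- iota 0 N, j <- iota 0 N].
have [d d0 dP] := seq_gap (L ++ [seq x + N%:R | x <- L]).
have inL t u : 0 <= t < N%:R -> crossing t u -> t \in L.
  move=> /andP[t0 tN] c; have [t' [u' [k [l [t01 u01 ek el [c0 n0]]]]]] := crossing_reduce c.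
  have k0 : k = 0.
    have h : -1 < k%:~R :> R by rewrite -(ltr_pM2r N0); lra.
    have h' : k%:~R < 1 :> R by rewrite -(ltr_pM2r N0); lra.
    have : `|k|%:~R < 1 :> R by rewrite intr_norm ltr_norml h.
    by rewrite (ltr_int R _ 1); clear; lia.
  rewrite ek k0 mul0r addr0; move: t01 u01 => /andP[ta tb] /andP[ua ub].
  have [i [iN it ti]] := nat_cell ta tb; have [j [jN ju uj]] := nat_cell ua ub.
  rewrite (tauP (i, j) t' u').
    by apply: allpairs_f; rewrite mem_iota.
  by split=> //=; [rewrite it|rewrite ju|split=> //; case: c0].
exists (Num.min d 1); first by rewrite lt_min d0 ltr01.
move=> t t' u u' c c'; rewrite lt_min => /andP[td t1].
wlog tt : t t' u u' c c' td t1 / t <= t'.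
  move=> h; have [tt|/ltW tt] := leP t t'; first exact: (h t t' u u').
  by apply/esym; apply: (h t' t u' u); rewrite // distrC.
have [r r01 [k ek]] := floor_period t N0.
have er : r = t - k%:~R * N%:R by lra.
pose r' := t' - k%:~R * N%:R.
have rr : `|r - r'| = `|t - t'| by congr `|_|; rewrite /r'; lra.
suff : r = r' by rewrite /r'; lra.
have cr : crossing r u.
  by have := crossing_shift (- k) 0 c; rewrite mulrNz mulNr -er mul0r addr0.
have cr' : crossing r' u'.
  by have := crossing_shift (- k) 0 c'; rewrite mulrNz mulNr mul0r addr0.
apply: dP; last by rewrite rr.
  by rewrite mem_cat (inL r u).
have r'0 : 0 <= r' by rewrite /r'; lra.
have [h|h] := ltP r' N%:R; first by rewrite mem_cat (inL r' u')// r'0.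
rewrite mem_cat; apply/orP; right; apply/mapP; exists (r' - N%:R); last by rewrite subrK.
apply: (inL _ u'); last first.
  by have := crossing_shift (-1) 0 cr'; rewrite mulrNz mulNr mul1r mul0r addr0.
have N1 : 1 <= N%:R :> R by rewrite ler1n; exact: leq_trans N3.
have : r' <= r + 1.
  by move: t1; rewrite -rr ltr_norml; lra.
by lra.
Qed.

End GenericPolygon.
End Crossings.

(** * Two knot types over one plane polygon *)

Section CommonProjection.
Variable R : realType.
Local Notation "s `_ i" := (@nth (R3 R) 0 s i) : ring_scope.
Local Notation hd v := (head (0 : R3 R) v).
Local Notation lst v := (last (0 : R3 R) v).
Implicit Types (v : seq (R3 R)).

(** The copy of [w] by which the chain [v] is closed: it lies over the same
    points of the plane as [w] and has evenly spaced heights. *)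
Definition even_tail v (w : seq (R3 R)) : seq (R3 R) :=
  mkseq (fun j => ((w`_j).1, (lst v).2 + j.+1%:R / (size w).+1%:R * ((hd v).2 - (lst v).2)))
    (size w).

Lemma even_tail_represents (K : set (oriented_set R)) (q : R) v w :
  normal_chain K (fun x => q * x.1.1) v ->
  (0 < size w)%N -> (forall x, x \in w -> 0 <= q * x.1.1) ->
  represents K (size (v ++ even_tail v w)) (vtx (v ++ even_tail v w)).
Proof.
move=> [_ _ _ nv] w0 wq; apply: nv.
- by rewrite size_mkseq.
- by move=> x /mapP[j jw ->] /=; apply: wq; apply: mem_nth; rewrite mem_iota in jw.
- by move=> j; rewrite size_mkseq => jw; rewrite nth_mkseq.
Qed.

Lemma generic_uniq_nth (T : eqType) (x0 : T) (s : seq T) (I : seq nat) :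
  uniq s -> all (fun i => (i < size s)%N) I -> uniq I -> uniq [seq nth x0 s i | i <- I].
Proof.
move=> us /allP Is uI; rewrite map_inj_in_uniq// => i j iI jI /eqP.
by rewrite nth_uniq// ?Is// => /eqP.
Qed.

Definition common_projection (g : int -> R * R) (v1 v2 : int -> R3 R) :=
  forall i, (v1 i).1 = g i /\ (v2 i).1 = g i.

(** General position of the vertices of one period, by index: their number
    decides which of them count as different. *)
Definition generic_closed (N : nat) (g : int -> R * R) :=
  (forall i j k : nat, (i < N)%N -> (j < N)%N -> (k < N)%N ->
    uniq [:: i; j; k] -> area (g i%:Z) (g j%:Z) (g k%:Z) != 0) /\
  (forall i j k i' j' k' : nat, (i < N)%N -> (j < N)%N -> (k < N)%N ->
    (i' < N)%N -> (j' < N)%N -> (k' < N)%N -> uniq [:: i; i'; j; j'; k; k'] ->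
    concurrency (g i%:Z) (g i'%:Z) (g j%:Z) (g j'%:Z) (g k%:Z) (g k'%:Z) != 0).

(** The chain [v] of the first type followed by the trivial copy of [w], and the
    trivial copy of [v] followed by the chain [w] of the second type, have the
    same projection, vertex by vertex.  The same small horizontal perturbation
    applied to both makes it generic. *)
Lemma exists_common_projection (K1 K2 : set (oriented_set R)) :
  tame_knot_types R K1 -> tame_knot_types R K2 ->
  exists (N : nat) (g : int -> R * R) (v1 v2 : int -> R3 R),
    [/\ represents K1 N v1, represents K2 N v2, common_projection g v1 v2
    & generic_closed N g].
Proof.
move=> t1 t2; have [type1 _] := t1; have [type2 _] := t2.
have [s1 r1] := tame_represents t1; have [s2 r2] := tame_represents t2.
have [v nv] := exists_normal_chain type1 (mulr1 (1 : R)) r1.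
have hq : (-1 : R) * -1 = 1 by rewrite mulrNN mulr1.
have [w nw] := exists_normal_chain type2 hq r2.
have [v3 vneg _ _] := nv.
have [w3 wneg _ _] := nw.
pose d := even_tail v w; pose e := even_tail w v.
have rd : represents K1 (size (v ++ d)) (vtx (v ++ d)).
  apply: (even_tail_represents nv) => [|x xw]; first exact: ltnW (ltnW w3).
  by have := wneg x xw; rewrite /= mulN1r oppr_le0 mul1r.
have re : represents K2 (size (w ++ e)) (vtx (w ++ e)).
  apply: (even_tail_represents nw) => [|x xv]; first exact: ltnW (ltnW v3).
  by have := vneg x xv; rewrite /= mulN1r oppr_ge0 mul1r.
have re' : represents K2 (size (e ++ w)) (vtx (e ++ w)).
  have <- : rot (size w) (w ++ e) = e ++ w by rewrite rot_size_cat.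
  by rewrite size_rot; apply: represents_rot_seq => //; rewrite size_cat leq_addr.
pose A := v ++ d; pose B := e ++ w; pose N := size A.
have NE : N = (size v + size w)%N by rewrite /N size_cat size_mkseq.
have BN : size B = N by rewrite NE /B size_cat size_mkseq.
have AB j : (j < N)%N -> (A`_j).1 = (B`_j).1.
  move=> jN; rewrite /A /B !nth_cat size_mkseq; case: ltnP => jv.
    by rewrite nth_mkseq.
  by rewrite nth_mkseq//; rewrite NE in jN; rewrite ltn_subLR.
have [e1 e10 e1P] := represents_perturb type1 rd.
have [e2 e20 e2P] := represents_perturb type2 re'.
pose eps := Num.min e1 e2.
have eps0 : 0 < eps by rewrite lt_min e10.
have [C sC [[uC areaC concC] CP]] := @generic_approx R [seq x.1 | x <- A] eps eps0.
rewrite size_map -/N in sC CP.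
have N0 : (0 < N)%N by rewrite NE; lia.
have nz : N%:Z != 0 by lia.
have imod i : (absz (i %% N%:Z)%Z < N)%N.
  by have := @ltz_pmod i N%:Z; have := modz_ge0 i nz; lia.
pose g i := nth 0 C (absz (i %% N%:Z)%Z).
have gE (j : nat) : (j < N)%N -> g j%:Z = nth 0 C j.
  by move=> jN; rewrite /g modz_small//; lia.
pose lift s i : R3 R := (g i, (vtx s i).2).
have near s i : size s = N -> (forall j, (j < N)%N -> (s`_j).1 = (A`_j).1) ->
    `|lift s i - vtx s i| <= eps.
  move=> sN sA; rewrite /lift /vtx sN prod_normE ge_max /= subrr normr0 (ltW eps0) andbT.
  rewrite sA ?imod//; have := CP _ (imod i).
  by rewrite (nth_map (0 : R3 R)) ?imod.
have per s i : size s = N -> lift s (i + N%:Z) = lift s i.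
  by move=> sN; rewrite /lift -{2}sN vtx_periodic /g modzDr.
exists N, g, (lift A), (lift B); split.
- apply: e1P => i; first exact: per.
  by rewrite (le_trans (near A i _ _))// ge_min lexx.
- rewrite -[N]BN; apply: e2P => i; first by rewrite BN; exact: per.
  rewrite (le_trans (near B i _ _))// ?ge_min ?lexx ?orbT// => j jN.
  by rewrite AB.
- by [].
split=> [i j k iN jN kN u3|i j k i' j' k' iN jN kN iN' jN' kN' u6].
  rewrite !gE//; apply: areaC; rewrite ?mem_nth ?sC//.
  by apply: (@generic_uniq_nth _ 0 C [:: i; j; k]) => //=; rewrite sC iN jN kN.
rewrite !gE//; apply: concC; rewrite ?mem_nth ?sC//.
apply: (@generic_uniq_nth _ 0 C [:: i; i'; j; j'; k; k']) => //=.
by rewrite sC iN jN kN iN' jN' kN'.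
Qed.

End CommonProjection.

(** * Heights over a common projection *)

Section Heights.
Variable R : realType.
Implicit Types (t u : R).

Lemma pl_fst (v : int -> R3 R) t : (pl v t).1 = pl (fun i => (v i).1) t.
Proof. by []. Qed.

Lemma polygon_polygonal n (w : int -> R3 R) : simple n w -> is_polygonal (range (pl w)).
Proof.
move=> [n2 per _].
exists [seq (w j%:Z, w j.+1%:Z) | j <- iota 0 n].
have jE (j : nat) : j.+1%:Z = j%:Z + 1 by lia.
apply/seteqP; split=> [_ [t _ <-]|x [ab /= /mapP[j _ ->]] [c /=]].
  have n0 : 0 < n%:R :> R by rewrite ltr0n; lia.
  have [u /andP[u0 un] [k ->]] := floor_period t n0.
  rewrite (periodicMz _ _ (fun t => pl_periodic t per)).
  have [j [jn ju uj]] := nat_cell u0 un.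
  exists (w j%:Z, w j.+1%:Z) => /=; first by apply/mapP; exists j => //; rewrite mem_iota.
  exists (u - j%:R); first by rewrite /= in_itv /=; lra.
  rewrite (@plE _ _ w j%:Z) -?pmulrn// ?(ltW uj)// jE; set c := u - _.
  by rewrite (scalerBl 1 c) scale1r scalerBr [LHS]addrAC addrA.
rewrite in_itv /= => /andP[c0 c1] <-; exists (j%:R + c) => //.
rewrite (@plE _ _ w j%:Z) -?pmulrn ?lerDl ?lerD2l// jE addrAC subrr add0r.
by rewrite scalerBl scale1r scalerBr [RHS]addrAC addrA.
Qed.

(** The absolute value is linear on a cell on which the heights do not change
    sign. *)
Lemma pl_norm (G : int -> R) t : (forall j, 0 <= G j * G (j + 1)) ->
  `|pl (G : int -> R^o) t| = pl ((fun j => `|G j|) : int -> R^o) t.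
Proof.
move=> GG; have [j jt tj] := floorP t.
rewrite !(@plE _ _ _ j)// ?ltW//; set c := t - _.
have c0 : 0 <= c by rewrite subr_ge0.
have c1 : c <= 1 by rewrite /c; lra.
have E (a b : R) : a + c *: (b - a : R^o) = (1 - c) * a + c * b.
  by rewrite /GRing.scale /=; ring.
rewrite !E; have := GG j; move: (G j) (G (j + 1)) => a b ab.
have [a0|a0] := leP 0 a; have [b0|b0] := leP 0 b.
- by rewrite !ger0_norm// addr_ge0// mulr_ge0//; lra.
- have : a = 0 by nra.
  by move=> ->; rewrite normr0 !mulr0 !add0r normrM (ger0_norm c0) (ltr0_norm b0).
- have : b = 0 by nra.
  by move=> ->; rewrite normr0 !mulr0 !addr0 normrM (ltr0_norm a0) ger0_norm//; lra.
- rewrite !ler0_norm ?(ltW a0) ?(ltW b0)//; first by ring.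
  have h1 : (1 - c) * a <= 0 by rewrite mulr_ge0_le0 ?(ltW a0)//; lra.
  have h2 : c * b <= 0 by rewrite mulr_ge0_le0 ?(ltW b0).
  by lra.
Qed.

(** Two points of a simple polygon with the same projection and the same height
    have the same parameter modulo the period. *)
Lemma crossing_heights N (g : int -> R * R) (v : int -> R3 R) t u : simple N v ->
  (forall i, (v i).1 = g i) -> crossing N g t u -> (pl v t).2 != (pl v u).2.
Proof.
move=> [_ _ inj] vg [e nk]; apply/eqP => h; apply: nk; apply: inj.
have vgt x : (pl v x).1 = pl g x by rewrite pl_fst; congr pl; apply/funext => i.
by rewrite [LHS]surjective_pairing [RHS]surjective_pairing !vgt e h.
Qed.

Lemma rescale_period (N M : nat) (k : int) (a b : R) : 0 < M%:R :> R ->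
  a / M%:R = b / M%:R + k%:~R * N%:R -> a = b + k%:~R * (N * M)%:R.
Proof.
move=> MR e; rewrite -[a](divfK (lt0r_neq0 MR)) e mulrDl divfK ?lt0r_neq0//.
by rewrite natrM mulrA.
Qed.

(** During the linear motion from the old heights to the new ones the order at
    each crossing is kept, so the polygon stays simple. *)
Lemma change_heights (K : set (oriented_set R)) (N M : nat) (g : int -> R * R)
    (v : int -> R3 R) (H : int -> R) : oriented_knot_type K -> (0 < M)%N ->
  represents K N v -> (forall i, (v i).1 = g i) ->
  (forall j, H (j + (N * M)%:Z) = H j) ->
  (forall t u, crossing N g t u -> (pl v t).2 < (pl v u).2 ->
     pl (H : int -> R^o) (t * M%:R) < pl (H : int -> R^o) (u * M%:R)) ->
  represents K (N * M) (fun j => ((refine M v j).1, H j)).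
Proof.
move=> typeK M0 rv vg perH mono.
have rr := represents_refine M0 rv.
have MR : 0 < M%:R :> R by rewrite ltr0n.
have [[N3 pv inj] _] := rv.
have [[NM3 pr _] _] := rr.
have vgt t : (pl v t).1 = pl g t by rewrite pl_fst; congr pl; apply/funext => i.
apply: (represents_linear typeK _ rr) => s s01; split; first exact: NM3.
  by apply: interp_periodic => // j; rewrite pr perH.
set w := fun j => _.
have p1 a : (pl (interp s (refine M v) w) a).1 = pl g (a / M%:R).
  rewrite pl_fst -vgt -pl_refine// pl_fst; congr pl; apply/funext => j.
  by rewrite /interp /w /= -scalerDl subrK scale1r.
have p2 a : (pl (interp s (refine M v) w) a).2 =
    (1 - s) * (pl v (a / M%:R)).2 + s * pl (H : int -> R^o) a.
  by rewrite /interp pl_interp -pl_refine.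
move=> a b e; have := congr1 fst e; rewrite !p1 => e1.
have := congr1 snd e; rewrite !p2 => e2.
have [[k ek]|nk] := pselect (exists k : int, a / M%:R = b / M%:R + k%:~R * N%:R).
  exists k; exact: rescale_period MR ek.
exfalso.
have main x y : crossing N g (x / M%:R) (y / M%:R) ->
    (1 - s) * (pl v (x / M%:R)).2 + s * pl (H : int -> R^o) x =
    (1 - s) * (pl v (y / M%:R)).2 + s * pl (H : int -> R^o) y ->
    ~ (pl v (x / M%:R)).2 < (pl v (y / M%:R)).2.
  move=> c ee lt; have := mono (x / M%:R) (y / M%:R) c lt.
  rewrite (divfK (lt0r_neq0 MR) x) (divfK (lt0r_neq0 MR) y) => lt'.
  by have := mix_lt s01 lt lt'; rewrite ee ltxx.
have cab : crossing N g (a / M%:R) (b / M%:R) := conj e1 nk.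
have [h|h|h] := ltgtP (pl v (a / M%:R)).2 (pl v (b / M%:R)).2.
- exact: main cab e2 h.
- exact: main (crossing_sym cab) (esym e2) h.
- apply: nk; apply: inj; rewrite [LHS]surjective_pairing [RHS]surjective_pairing.
  by rewrite !vgt e1 h.
Qed.

(** The polygon is subdivided so finely that the parameters of different
    crossings are more than four steps apart; vertices within one step of
    different ones are then neither equal nor adjacent.  The vertices within one step of a crossing get the height that
    is wanted there, the others height zero: heights are then constant on the
    cell of a crossing, and adjacent ones never have opposite signs. *)
Lemma exists_folding_heights (N : nat) (g : int -> R * R) (z1 z2 : R -> R) :
  (2 < N)%N -> (forall i, g (i + N%:Z) = g i) -> generic_closed N g ->
  (forall t, z1 (t + N%:R) = z1 t) -> (forall t, z2 (t + N%:R) = z2 t) ->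
  (forall t u, crossing N g t u -> z1 t != z1 u) ->
  (forall t u, crossing N g t u -> z2 t != z2 u) ->
  exists M (G : int -> R), [/\ (0 < M)%N, forall j, G (j + (N * M)%:Z) = G j,
    forall j, 0 <= G j * G (j + 1),
    forall t u, crossing N g t u -> z1 t < z1 u ->
      pl (G : int -> R^o) (t * M%:R) < pl (G : int -> R^o) (u * M%:R) &
    forall t u, crossing N g t u -> z2 t < z2 u ->
      `|pl (G : int -> R^o) (t * M%:R)| < `|pl (G : int -> R^o) (u * M%:R)|].
Proof.
move=> N3 gper [g3 g6] per1 per2 ne1 ne2.
have [d d0 dP] := crossing_discrete N3 gper g3.
pose M := (Num.truncn (4 / d)).+1.
have M0 : 0 < M%:R :> R by rewrite ltr0n.
have Md : 4 < M%:R * d.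
  by rewrite mulrC -ltr_pdivrMl// mulrC; exact: truncnS_gt.
(* the height wanted at t when t crosses u *)
pose val t u : R := if z2 t < z2 u then 1 else if z1 u < z1 t then 2 else -2.
have valu t u u' : crossing N g t u -> crossing N g t u' -> val t u = val t u'.
  move=> c c'; have [k ->] := crossing_partner N3 gper g3 g6 c c'.
  by rewrite /val (periodicMz _ _ per1) (periodicMz _ _ per2).
have valN t u (k : int) : val (t + k%:~R * N%:R) u = val t u.
  by rewrite /val (periodicMz _ _ per1) (periodicMz _ _ per2).
pose near t (j : int) := `|t * M%:R - j%:~R| <= 1.
have close t t' u u' (r : R) : crossing N g t u -> crossing N g t' u' ->
    `|t * M%:R - t' * M%:R| <= r -> r < 4 -> t = t'.
  move=> c c' h r4; apply: dP c c' _.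
  rewrite -(ltr_pM2r M0) -[in X in X < _](gtr0_norm M0) -normrM mulrBl.
  by rewrite [d * _]mulrC; lra.
have /choice[G GP] : forall j : int, exists y : R,
    (forall t u, crossing N g t u -> near t j -> y = val t u) /\
    ((~ exists t u, crossing N g t u /\ near t j) -> y = 0).
  move=> j; have [[t [u [c tj]]]|no] := pselect (exists t u, crossing N g t u /\ near t j).
    exists (val t u); split=> [t' u' c' t'j|no]; last by exfalso; apply: no; exists t, u.
    suff e : t = t' by subst t'; exact: valu.
    apply: (close t t' u u' 2 c c'); last by lra.
    by move: tj t'j; rewrite /near !ler_norml; lra.
  by exists 0; split=> // t u c tj; exfalso; apply: no; exists t, u.
have GE t u j : crossing N g t u -> near t j -> G j = val t u.
  by move=> c tj; have [h _] := GP j; exact: h.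
have G0 j : (~ exists t u, crossing N g t u /\ near t j) -> G j = 0.
  by have [_ h] := GP j.
have nearN t j (k : int) : near t j -> near (t + k%:~R * N%:R) (j + k * (N * M)%:Z).
  rewrite /near intrD intrM -pmulrn natrM.
  by rewrite (_ : (t + _) * _ - _ = t * M%:R - j%:~R)//; ring.
have plG t u : crossing N g t u -> pl (G : int -> R^o) (t * M%:R) = val t u.
  move=> c; have [j jt tj] := floorP (t * M%:R).
  rewrite (@plE _ _ _ j)// ?ltW// (GE t u j c) ?(GE t u (j + 1) c) ?subrr ?scaler0 ?addr0//.
    by rewrite /near intrD1 ler_norml; lra.
  by rewrite /near ler_norml; lra.
exists M, G; split=> //.
- move=> j; have [[t [u [c tj]]]|no] := pselect (exists t u, crossing N g t u /\ near t j).
    rewrite (GE t u j c tj) -[(N * M)%:Z]mul1r.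
    rewrite (GE (t + 1%:~R * N%:R) (u + 1%:~R * N%:R)); last exact: nearN.
      by rewrite valN /val (periodicMz _ _ per1) (periodicMz _ _ per2).
    by apply: crossing_shift.
  rewrite (G0 j no) G0// => -[t [u [c tj]]]; apply: no.
  exists (t + (-1)%:~R * N%:R), (u + (-1)%:~R * N%:R); split; first exact: crossing_shift.
  rewrite (_ : j = j + (N * M)%:Z + (-1) * (N * M)%:Z); first exact: nearN.
  by rewrite mulN1r addrK.
- move=> j; have [[t [u [c tj]]]|no] := pselect (exists t u, crossing N g t u /\ near t j); last first.
    by rewrite (G0 j no) mul0r.
  have [[t' [u' [c' tj']]]|no] := pselect (exists t u, crossing N g t u /\ near t (j + 1)); last first.
    by rewrite (G0 _ no) mulr0.
  suff e : t = t'.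
    subst t'; rewrite (GE _ _ _ c tj) (GE _ _ _ c' tj') (valu _ _ _ c c').
    by rewrite -expr2 sqr_ge0.
  apply: (close t t' u u' 3 c c'); last by lra.
  by move: tj tj'; rewrite /near intrD1 !ler_norml; lra.
- move=> t u c lt; rewrite (plG t u c) (plG u t (crossing_sym c)) /val lt.
  rewrite [z1 u < z1 t]ltNge (ltW lt) /=.
  by have [h|h|/eqP h] := ltgtP (z2 t) (z2 u); [lra|lra|rewrite (negbTE (ne2 _ _ c)) in h].
- move=> t u c lt; rewrite (plG t u c) (plG u t (crossing_sym c)) /val lt.
  rewrite [z2 u < z2 t]ltNge (ltW lt) /= normr1.
  by case: ifP => _; rewrite ?normrN ger0_norm; lra.
Qed.

End Heights.

Theorem theorem2p1 (R : realType) (K1 K2 : set (oriented_set R)) :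
  tame_knot_types R K1 -> tame_knot_types R K2 ->
  exists k1 : oriented_set R,
    knot_of_type K1 k1 /\
    homeomorphism_on (carrier k1) (carrier (oriented_image (@fold R) k1))
      (@fold R) /\
    knot_of_type K2 (oriented_image (@fold R) k1).
Proof.
move=> t1 t2; have [type1 _] := t1; have [type2 _] := t2.
have [N [g [v1 [v2 [r1 r2 vg gen]]]]] := exists_common_projection t1 t2.
have [s1 _] := r1; have [s2 _] := r2.
have [N3 pv1 _] := s1; have [_ pv2 _] := s2.
have vg1 i : (v1 i).1 = g i by case: (vg i).
have vg2 i : (v2 i).1 = g i by case: (vg i).
have gper i : g (i + N%:Z) = g i by rewrite -!vg1 pv1.
have [M [G [M0 perG GG mono1 mono2]]] :=
  exists_folding_heights N3 gper gen
    (fun t => congr1 snd (pl_periodic t pv1)) (fun t => congr1 snd (pl_periodic t pv2))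
    (fun t u => @crossing_heights _ _ _ _ t u s1 vg1)
    (fun t u => @crossing_heights _ _ _ _ t u s2 vg2).
pose w j := ((refine M v1 j).1, G j) : R3 R.
pose w' j := ((refine M v2 j).1, `|G j|) : R3 R.
have rw : represents K1 (N * M) w by exact: (change_heights type1 M0 r1 vg1 perG mono1).
have rw' : represents K2 (N * M) w'.
  apply: (change_heights type2 M0 r2 vg2) => [j|t u c lt]; first by rewrite perG.
  by rewrite -!pl_norm//; exact: mono2.
have w1 t : (pl w t).1 = pl g (t / M%:R).
  rewrite (_ : pl g (t / M%:R) = (pl (refine M v1) t).1).
    by rewrite [LHS]pl_fst [RHS]pl_fst.
  by rewrite pl_refine// pl_fst; congr pl; apply/funext => i.
have w'1 t : (pl w' t).1 = pl g (t / M%:R).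
  rewrite (_ : pl g (t / M%:R) = (pl (refine M v2) t).1).
    by rewrite [LHS]pl_fst [RHS]pl_fst.
  by rewrite pl_refine// pl_fst; congr pl; apply/funext => i.
have w'2 t : (pl w' t).2 = `|(pl w t).2| by exact: esym (pl_norm t GG).
have foldE : @fold R \o pl w = pl w'.
  apply/funext => t; rewrite [LHS]/comp; have := w'2 t; have := w'1 t; rewrite -w1.
  by move: (pl w t : R3 R) (pl w' t : R3 R) => [[x y] z] [p q] /= -> ->.
have [sw Kw] := rw; have [sw' Kw'] := rw'.
have lw := simple_loop sw; have lw' := simple_loop sw'.
have T0 := simple_gt0 sw.
have fold_c : continuous (@fold R).
  move=> [[x y] z] /=; have -> : @fold R = fun v => (v.1, `|v.2|).
    by apply/funext => -[[x' y'] z'].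
  apply: (@cvg_pair _ _ _ (nbhs (x, y, z)) (nbhs (x, y)) (nbhs `|z|) _ _ _ fst (fun x => `|x.2|)).
    exact: cvg_fst.
  by apply: cvg_norm; exact: cvg_snd.
have imE : oriented_image (@fold R) (knot_of (N * M)%:R (pl w)) = knot_of (N * M)%:R (pl w').
  by rewrite oriented_image_knot_of foldE.
have foldw t : fold (pl w t) = pl w' t by rewrite -foldE.
exists (knot_of (N * M)%:R (pl w)); rewrite imE; split; [|split].
- by split=> //; right; exact: (polygon_polygonal sw).
- have [_ perw _] := lw; have [_ _ injw'] := lw'.
  have bij : set_bij (range (pl w)) (range (pl w')) (@fold R).
    split.
    + by move=> _ [t _ <-]; rewrite foldw; exists t.
    + move=> x y; rewrite !inE => -[t _ <-] [u _ <-]; rewrite !foldw => /injw'[k ->].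
      by rewrite (periodicMz _ _ perw).
    + by move=> _ [t _ <-]; exists (pl w t); [exists t|exact: foldw].
  have [b bK] : exists b : R3 R -> R3 R, {in range (pl w), cancel (@fold R) b}.
    have /choice[b bP] : forall y, exists x, range (pl w') y -> range (pl w) x /\ fold x = y.
      move=> y; have [[t _ <-]|no] := pselect (range (pl w') y); last by exists 0.
      by exists (pl w t) => _; split; [exists t|exact: foldw].
    exists b => x; rewrite inE => xw; have [_ inj _] := bij.
    have [h1 h2] := bP (fold x) (let: And3 f _ _ := bij in f x xw).
    by apply: inj h2; rewrite inE.
  split; [exact: bij|exact: continuous_subspaceT|exists b => //].
  have -> : carrier (knot_of (N * M)%:R (pl w')) = @fold R @` range (pl w).
    by rewrite image_comp foldE.
  apply: (@compact_pullback_continuous _ _ _ (range (pl w)) (@fold R) b).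
  + exact: norm_hausdorff.
  + rewrite (loop_range T0 perw); apply: continuous_compact; last exact: segment_compact.
    by apply: continuous_subspaceT; case: lw.
  + exact: continuous_subspaceT.
  + have cid : {within range (pl w), continuous (@idfun (R3 R))}.
      by apply: continuous_subspaceT => x; exact: cvg_id.
    have e : {in range (pl w), @idfun (R3 R) =1 b \o @fold R} by move=> x xw; rewrite /= bK.
    exact: (@subspace_eq_continuous _ _ _ (@idfun (R3 R) : subspace (range (pl w)) -> R3 R) _ e cid).
- by split=> //; right; exact: (polygon_polygonal sw').
Qed.
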